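(* Fix an integer $\ell\geq1$ and a parameter $\lambda\in k\setminus\{0\}$. For any $(u,i)$ and $(v,j)$ in $\mathbb{Z}_n^2$ with $2i+u-1\not\equiv0\pmod d$ and $2j+v-1\not\equiv0\pmod d$, there is an isomorphism of $\mathcal{D}$-modules $$\operatorname{core}(C_\lambda^\ell(u,i)\otimes L(v,j))\cong\bigoplus_{\theta\in\mathfrak{I}}C_\lambda^\ell(u+v,i+j+\theta),$$ where, with $N=\dim L(u,i)$ and $N'=\dim L(v,j)$, $\mathfrak{I}=\{\theta\in\mathbb{Z}: 0\leq\theta\leq\min(N,N')-1\}$ if $N+N'\leq d$, and $\mathfrak{I}=\{\theta\in\mathbb{Z}: N+N'-d\leq\theta\leq\min(N,N')-1\}$ otherwise.
   Context: Setting. $k$ is an algebraically closed field; $n$ and $d$ are positive integers with $d\mid n$, and the characteristic of $k$ does not divide $d$; $q\in k$ is a fixed primitive $d$-th root of unity; $\mathbb{Z}_n=\mathbb{Z}/n\mathbb{Z}$ (so $q^i$ and congruences mod $d$ make sense for $i\in\mathbb{Z}_n$). $\mathcal{D}=\mathcal{D}(\Lambda_{n,d})$ is the Drinfeld double of the dual $\Lambda_{n,d}$ of the extended Taft algebra: the $n^2d^2$-dimensional Hopf algebra generated by $e_i,a_i$ ($i\in\mathbb{Z}_n$), $G$, $X$ with relations $e_ie_j=\delta_{ij}e_i$, $\sum_ie_i=1$, $a_i=e_{i+1}a_ie_i$, $a_{i+d-1}\cdots a_{i+1}a_i=0$, $G^n=1$, $X^d=0$, $GX=q^{-1}XG$,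 $Ge_i=e_iG$, $a_iG=q^{-1}Ga_i$, $e_iX=Xe_{i+1}$, $a_iX=q^{-1}(Xa_{i+1}-e_{i+1}+q^{i+1}Ge_{i+1})$; coproduct $\Delta(e_i)=\sum_{j+l=i}e_j\otimes e_l$, $\Delta(a_i)=\sum_{j+l=i}(e_j\otimes a_l+q^la_j\otimes e_l)$, $\Delta(G)=G\otimes G$, $\Delta(X)=X\otimes G+1\otimes X$; counit $\varepsilon(e_i)=\delta_{i0}$, $\varepsilon(a_i)=0$, $\varepsilon(G)=1$, $\varepsilon(X)=0$; antipode $S(e_i)=e_{-i}$, $S(a_i)=-q^{i+1}a_{-i-1}$, $S(G)=G^{-1}$, $S(X)=-XG^{-1}$. Write $\gamma_i^m=a_{i+m-1}\cdots a_{i+1}a_i$. Modules are finite-dimensional left modules; $\otimes=\otimes_k$ with action via $\Delta$. $\operatorname{core}(M)$ is the direct sum of the non-projective indecomposable summands of $M$. Simple modules. For $r$ an integer (or element of $\mathbb{Z}_n$), $\langle r\rangle\in\{1,\dots,d\}$ is its residue mod $d$; for $u\in\mathbb{Z}_n$, $\sigma_u$ is the permutation $\sigma_u(j)=d+j-\langle 2j+u-1\rangle$ of $\mathbb{Z}_n$. For $(u,i)\in\mathbb{Z}_n^2$ with $2i+u-1\not\equiv0\pmod d$, $L(u,i)$ is the simple $\mathcal{D}$-module, unique up to isomorphism, of dimension $d-\langle2i+u-1\rangle$, such that $G$ acts on $e_jL(u,i)$ as $q^{u+j}$ for all $j$, and the kernel of $X$ on $L(u,i)$ is a line contained in $e_iL(u,i)$.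 These are exactly the non-projective simple modules. The block $\mathbb{B}_{0,0}$. This is the block of $\mathcal{D}$ containing the trivial module $L(0,0)$; its simples are $L(0,\sigma_0^p(0))$, $p\in\mathbb{Z}_{2n/d}$. It is Morita equivalent to the path algebra of the quiver with vertices $\epsilon_p$ ($p\in\mathbb{Z}_{2n/d}$) and arrows $b_p:\epsilon_p\to\epsilon_{p+1}$, $\bar b_p:\epsilon_{p+1}\to\epsilon_p$, modulo $b_{p+1}b_p$, $\bar b_p\bar b_{p+1}$, $\bar b_pb_p-b_{p-1}\bar b_{p-1}$ for all $p$. An equivalence is fixed so that the simple at $\epsilon_p$ corresponds to $L(0,\sigma_0^p(0))$ and, with $j=\sigma_0^p(0)$, $N=\dim L(0,j)$: the length-2 representation with only $b_p$ acting non-trivially corresponds to a module $M$ with $\gamma_j^Ne_jM\neq0$, $X^Ne_{j+N-1}M=0$; the one with only $\bar b_{p-1}$ acting non-trivially to a module $M$ with $\gamma_j^Ne_jM=0$, $X^Ne_{j+N-1}M\neq0$. Band modules. For $\lambda\in k\setminus\{0\}$, $\ell\geq1$, $C_\lambda^\ell(0,0)$ corresponds to the representation with $V=k^\ell$ at every vertex, where $b_0$ acts as the Jordan block $J_\ell(\lambda)$, $b_{2p}$ ($2p\neq0$ in $\mathbb{Z}_{2n/d}$) and all $\bar b_{2p+1}$ act as the identity, and all $\bar b_{2p}$, $b_{2p+1}$ act as zero. For every $(v,j)\in\mathbb{Z}_n^2$ with $2j+v-1\not\equiv0\pmod d$, one sets (convention) $C_\lambda^\ell(v,j)=\operatorname{core}(C_\lambda^\ell(0,0)\otimes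 L(v,j))$. *)

(* Defs.v *)
From HB Require Import structures.
From Stdlib Require Import ClassicalEpsilon.
From Stdlib Require Relation_Operators List.
From mathcomp Require Import all_boot all_order all_algebra.
From mathcomp Require Import mxtens zify.

Set Implicit Arguments.
Unset Strict Implicit.
Unset Printing Implicit Defensive.

Import GRing.Theory.
Local Open Scope ring_scope.

(* Z/nZ as an additive group, correct for every n >= 1 ('Z_n is Z/2Z for     *)
(* n = 1).  The class of 1 is Zp1 and the class of m : nat is inZp m.        *)
Notation Zmod n := 'I_n.-1.+1.

Section Indices.
Variables n d : nat.

(* <r>, the residue of r modulo d chosen in {1, ..., d} *)
Definition bracket (r : int) : nat :=
  let m := `|(r %% d%:Z)%Z|%N in if m == 0%N then d else m.

(* 2j + u - 1; only its class modulo d matters, and d divides n *)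
Definition weight (u j : Zmod n) : int := 2%:Z * (j : nat)%:Z + (u : nat)%:Z - 1.

Definition nonproj_index (u j : Zmod n) : bool := ~~ (d%:Z %| weight u j)%Z.

(* the subtraction does not truncate since bracket _ <= d *)
Definition sigma (u j : Zmod n) : Zmod n := inZp (d + j - bracket (weight u j))%N.

(* 2n/d *)
Definition qvert : nat := ((2 * n) %/ d)%N.

(* the index set of the fusion rule, as an increasing list *)
Definition fusion_range (N N' : nat) : seq nat :=
  if (N + N' <= d)%N then index_iota 0 (minn N N')
  else index_iota (N + N' - d)%N (minn N N').

End Indices.

Section DoubleModules.
Variables (k : fieldType) (n d : nat) (q : k).

(* The actions of the generators on a finite-dimensional space, as matrices   *)
(* multiplying column vectors on the left.                                    *)
Record dmod := DMod {
  ddim : nat;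
  actE : Zmod n -> 'M[k]_ddim;
  actA : Zmod n -> 'M[k]_ddim;
  actG : 'M[k]_ddim;
  actX : 'M[k]_ddim }.

(* gamma_i^m = a_{i+m-1} ... a_{i+1} a_i *)
Fixpoint gamma (M : dmod) (i : Zmod n) (m : nat) : 'M[k]_(ddim M) :=
  if m is m'.+1 then actA M (i + inZp m') * gamma M i m' else 1.

(* M is a left module over the Drinfeld double D.  As d divides n and q has   *)
(* order d, q ^+ i does not depend on the representative of i : Z/nZ.         *)
Record is_dmod (M : dmod) : Prop := IsDMod {
  relEE : forall i j, actE M i * actE M j = (i == j)%:R *: actE M i;
  relE1 : \sum_i actE M i = 1;
  relA : forall i, actA M i = actE M (i + Zp1) * actA M i * actE M i;
  relAd : forall i, gamma M i d = 0;
  relGn : actG M ^+ n = 1;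
  relXd : actX M ^+ d = 0;
  relGX : actG M * actX M = q^-1 *: (actX M * actG M);
  relGE : forall i, actG M * actE M i = actE M i * actG M;
  relAG : forall i, actA M i * actG M = q^-1 *: (actG M * actA M i);
  relEX : forall i, actE M i * actX M = actX M * actE M (i + Zp1);
  relAX : forall i, actA M i * actX M =
    q^-1 *: (actX M * actA M (i + Zp1) - actE M (i + Zp1)
             + q ^+ i.+1 *: (actG M * actE M (i + Zp1))) }.

(* the trivial module, given by the counit *)
Definition dtriv : dmod :=
  @DMod 1 (fun i => (i == 0)%:R%:M) (fun _ => 0) 1 0.

(* the action on the tensor product, given by the coproduct *)
Definition dtens (M N : dmod) : dmod :=
  @DMod (ddim M * ddim N)
    (fun i => \sum_j \sum_(l | j + l == i) actE M j *t actE N l)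
    (fun i => \sum_j \sum_(l | j + l == i)
       (actE M j *t actA N l + q ^+ l *: (actA M j *t actE N l)))
    (actG M *t actG N)
    (actX M *t actG N + 1%:M *t actX N).

Definition dzero : dmod := @DMod 0 (fun _ => 0) (fun _ => 0) 0 0.

Definition dadd (M N : dmod) : dmod :=
  @DMod (ddim M + ddim N)
    (fun i => block_mx (actE M i) 0 0 (actE N i))
    (fun i => block_mx (actA M i) 0 0 (actA N i))
    (block_mx (actG M) 0 0 (actG N))
    (block_mx (actX M) 0 0 (actX N)).

Definition dsum (s : seq dmod) : dmod := foldr dadd dzero s.

Record is_dhom (M N : dmod) (f : 'M[k]_(ddim N, ddim M)) : Prop := IsDHom {
  homE : forall i, f *m actE M i = actE N i *m f;
  homA : forall i, f *m actA M i = actA N i *m f;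
  homG : f *m actG M = actG N *m f;
  homX : f *m actX M = actX N *m f }.

Definition diso (M N : dmod) : Prop :=
  exists (f : 'M[k]_(ddim N, ddim M)) (g : 'M[k]_(ddim M, ddim N)),
    [/\ is_dhom f, is_dhom g, f *m g = 1%:M & g *m f = 1%:M].

Definition mx_inj (m p : nat) (f : 'M[k]_(m, p)) : Prop :=
  forall v : 'cV[k]_p, f *m v = 0 -> v = 0.

Definition mx_surj (m p : nat) (f : 'M[k]_(m, p)) : Prop :=
  forall w : 'cV[k]_m, exists v : 'cV[k]_p, f *m v = w.

Record is_dsub (M : dmod) (U : {vspace 'cV[k]_(ddim M)}) : Prop := IsDSub {
  subE : forall i v, v \in U -> actE M i *m v \in U;
  subA : forall i v, v \in U -> actA M i *m v \in U;
  subG : forall v, v \in U -> actG M *m v \in U;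
  subX : forall v, v \in U -> actX M *m v \in U }.

Definition dsimple (M : dmod) : Prop :=
  [/\ is_dmod M, (0 < ddim M)%N
    & forall U : {vspace 'cV[k]_(ddim M)}, is_dsub U -> U = 0%VS \/ U = fullv].

Definition dindec (M : dmod) : Prop :=
  [/\ is_dmod M, (0 < ddim M)%N
    & forall A B, is_dmod A -> is_dmod B -> diso M (dadd A B) ->
      ddim A = 0%N \/ ddim B = 0%N].

(* D is finite-dimensional, so lifting against finite-dimensional modules     *)
(* is projectivity.                                                           *)
Definition dproj (P : dmod) : Prop :=
  is_dmod P /\
  forall (M N : dmod) (f : 'M[k]_(ddim N, ddim M)) (g : 'M[k]_(ddim N, ddim P)),
    is_dmod M -> is_dmod N -> is_dhom f -> mx_surj f -> is_dhom g ->
    exists2 h : 'M[k]_(ddim M, ddim P), is_dhom h & f *m h = g.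

(* K is the direct sum of the non-projective terms of a decomposition of M    *)
(* into indecomposable modules.                                               *)
Definition is_core (M K : dmod) : Prop :=
  exists s t : seq dmod,
    [/\ List.Forall (fun S => dindec S /\ ~ dproj S) s,
        List.Forall (fun S => dindec S /\ dproj S) t,
        diso M (dsum (s ++ t)) & diso K (dsum s)].

(* a choice of module in the isomorphism class provided by Krull-Schmidt *)
Definition core (M : dmod) : dmod := epsilon (inhabits dzero) (is_core M).

(* the defining properties of L(u,i) *)
Record is_L (u i : Zmod n) (L : dmod) : Prop := IsL {
  L_simple : dsimple L;
  L_dim : ddim L = (d - bracket d (weight u i))%N;
  L_G : forall j, actG L * actE L j = q ^+ (u + j)%N *: actE L j;
  L_kerX : exists v : 'cV[k]_(ddim L),
    [/\ v != 0, actE L i *m v = v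
      & forall w : 'cV[k]_(ddim L), actX L *m w = 0 <-> exists c, w = c *: v] }.

(* composition factors are the simple subquotients *)
Definition comp_factor (S M : dmod) : Prop :=
  dsimple S /\
  exists (V : dmod) (f : 'M[k]_(ddim M, ddim V)) (g : 'M[k]_(ddim S, ddim V)),
    is_dmod V /\ [/\ is_dhom f, mx_inj f, is_dhom g & mx_surj g].

(* Simple modules lie in the same block when they are related by a chain of   *)
(* simple modules in which consecutive ones are composition factors of a      *)
(* common indecomposable module.                                              *)
Definition same_block : dmod -> dmod -> Prop :=
  Relation_Operators.clos_refl_sym_trans dmod
    (fun S T => exists M, [/\ dindec M, comp_factor S M & comp_factor T M]).

(* M belongs to the block B_{0,0} containing the trivial module *)
Definition in_block0 (M : dmod) : Prop :=
  is_dmod M /\ forall S, comp_factor S M -> same_block dtriv S.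

(* Representations of the quiver with vertices p : Z/(2n/d) and arrows        *)
(* b_p : p -> p+1, bbar_p : p+1 -> p.                                         *)
Notation vertex := (Zmod (qvert n d)).

Record qrep := QRep {
  qdim : vertex -> nat;
  qb : forall p, 'M[k]_(qdim (p + Zp1), qdim p);
  qbb : forall p, 'M[k]_(qdim p, qdim (p + Zp1)) }.

(* The third relation is written at the vertex p+1. *)
Record is_qrep (V : qrep) : Prop := IsQRep {
  relbb : forall p, qb V (p + Zp1) *m qb V p = 0;
  relbbbb : forall p, qbb V p *m qbb V (p + Zp1) = 0;
  relbbb : forall p, qbb V (p + Zp1) *m qb V (p + Zp1) = qb V p *m qbb V p }.

Definition qmap (V W : qrep) : Type := forall p, 'M[k]_(qdim W p, qdim V p).

Record is_qhom (V W : qrep) (f : qmap V W) : Prop := IsQHom {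
  qhomb : forall p, f (p + Zp1) *m qb V p = qb W p *m f p;
  qhombb : forall p, f p *m qbb V p = qbb W p *m f (p + Zp1) }.

Definition qsimple (p : vertex) : qrep :=
  @QRep (fun r => (r == p) : nat) (fun _ => 0) (fun _ => 0).

(* Length-2 representations with one-dimensional spaces at p and p+1 on which *)
(* only b_p (resp. bbar_p) is nonzero; the block const_mx 1 is 1 x 1.         *)
Definition qdim2 (p r : vertex) : nat := ((r == p) + (r == (p + Zp1)%R))%N.

Definition qlen2b (p : vertex) : qrep :=
  @QRep (qdim2 p) (fun r => if r == p then const_mx 1 else 0) (fun _ => 0).

Definition qlen2bb (p : vertex) : qrep :=
  @QRep (qdim2 p) (fun _ => 0) (fun r => if r == p then const_mx 1 else 0).

Definition jordan (lam : k) (l : nat) : 'M[k]_l :=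
  \matrix_(i, j) (lam *+ (i == j) + (i.+1 == j)%N%:R).

(* 2n/d is even, so the parity of a vertex makes sense *)
Definition qband (lam : k) (l : nat) : qrep :=
  @QRep (fun _ => l)
    (fun p => if p == 0 then jordan lam l else if odd p then 0 else 1%:M)
    (fun p => if odd p then 1%:M else 0).

Unset Implicit Arguments.
(* F, with its action F1 on morphisms, is a k-linear equivalence from the     *)
(* category of representations of the bound quiver to the block B_{0,0},      *)
(* normalised by its values on simple and length-2 representations, so that   *)
(* the vertex p corresponds to L(0, sigma_0^p(0)).  Only the values at        *)
(* objects satisfying the relations are constrained.                          *)
Record is_block_equivalence (L : Zmod n -> Zmod n -> dmod)
    (F : qrep -> dmod)
    (F1 : forall V W, qmap V W -> 'M[k]_(ddim (F W), ddim (F V))) : Prop :=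
  IsBlockEquivalence {
  eqv_obj : forall V, is_qrep V -> in_block0 (F V);
  eqv_hom : forall V W (f : qmap V W), is_qrep V -> is_qrep W ->
    is_qhom f -> is_dhom (F1 V W f);
  eqv_id : forall V, is_qrep V -> F1 V V (fun _ => 1%:M) = 1%:M;
  eqv_comp : forall U V W (f : qmap U V) (g : qmap V W),
    is_qrep U -> is_qrep V -> is_qrep W -> is_qhom f -> is_qhom g ->
    F1 U W (fun p => g p *m f p) = F1 V W g *m F1 U V f;
  eqv_linear : forall V W (c : k) (f g : qmap V W), is_qrep V -> is_qrep W ->
    is_qhom f -> is_qhom g ->
    F1 V W (fun p => c *: f p + g p) = c *: F1 V W f + F1 V W g;
  eqv_faithful : forall V W (f g : qmap V W), is_qrep V -> is_qrep W ->
    is_qhom f -> is_qhom g -> F1 V W f = F1 V W g -> forall p, f p = g p;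
  eqv_full : forall V W (h : 'M[k]_(ddim (F W), ddim (F V))),
    is_qrep V -> is_qrep W -> is_dhom h -> exists2 f, is_qhom f & F1 V W f = h;
  eqv_surj : forall M, in_block0 M -> exists2 V, is_qrep V & diso (F V) M;
  eqv_simple : forall p : vertex,
    diso (F (qsimple p)) (L 0 (iter p (sigma d 0) 0));
  eqv_b : forall p : vertex, let j := iter p (sigma d 0) 0 in
    let N := ddim (L 0 j) in let M := F (qlen2b p) in
    gamma M j N * actE M j != 0 /\ actX M ^+ N * actE M (j + inZp N - Zp1) = 0;
  eqv_bb : forall p : vertex, let j := iter p (sigma d 0) 0 in
    let N := ddim (L 0 j) in let M := F (qlen2bb (p - Zp1)) in
    gamma M j N * actE M j = 0 /\ actX M ^+ N * actE M (j + inZp N - Zp1) != 0 }.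

(* C_lam^l(v,j), for a given choice of the equivalence F and of the simple    *)
(* modules L *)
Definition Cband (F : qrep -> dmod) (L : Zmod n -> Zmod n -> dmod)
    (lam : k) (l : nat) (v j : Zmod n) : dmod :=
  core (dtens (F (qband lam l)) (L v j)).
Set Implicit Arguments.

End DoubleModules.

Arguments Cband {k n} d q F L lam l v j.
Arguments is_block_equivalence {k n} d q L F F1.

Section QuiverRepresentations.
Variables (k : fieldType) (n d : nat).
Hypotheses (n_gt0 : (0 < n)%N) (d_dvd_n : (d %| n)%N).

Lemma qvertE : qvert n d = (2 * (n %/ d))%N.
Proof. by rewrite /qvert muln_divA. Qed.

Lemma qvert_even : ~~ odd (qvert n d) && (1 < qvert n d)%N.
Proof.
rewrite qvertE oddM /= -[1%N]/(2 * 0).+1%N.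
have : (0 < n %/ d)%N by rewrite divn_gt0 ?(dvdn_gt0 n_gt0) // dvdn_leq.
by lia.
Qed.

Lemma odd_succ (p : Zmod (qvert n d)) : odd (p + Zp1)%R = ~~ odd p.
Proof.
have /andP[+ +] := qvert_even.
case: (qvert n d) p => [|[|c]] //= p ev _.
rewrite (modn_small (m := 1)) //.
rewrite addn1; have := ltn_ord p; rewrite leq_eqVlt => /orP[/eqP [pc]|pc].
  by rewrite pc modnn /=; move: ev => /= /negPf; rewrite negbK => ->.
by rewrite modn_small.
Qed.

Lemma succ_neq (p : Zmod (qvert n d)) : (p + Zp1 == p) = false.
Proof. by apply/eqP => /(congr1 (fun x : Zmod _ => odd x)); rewrite odd_succ; case: odd. Qed.

Lemma qsimpleP p : is_qrep (@qsimple k n d p).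
Proof. by split=> r /=; rewrite !mulmx0. Qed.

Lemma qlen2bP p : is_qrep (@qlen2b k n d p).
Proof.
split=> r /=; rewrite ?mulmx0 ?mul0mx //.
case: eqP => [<-|_]; last by rewrite mul0mx.
by rewrite [in X in _ *m X]eq_sym succ_neq mulmx0.
Qed.

Lemma qlen2bbP p : is_qrep (@qlen2bb k n d p).
Proof.
split=> r /=; rewrite ?mulmx0 ?mul0mx //.
case: (r =P p) => [->|_]; last by rewrite mul0mx.
by rewrite succ_neq mulmx0.
Qed.

Lemma qbandP lam l : is_qrep (@qband k n d lam l).
Proof.
have E0 (r : Zmod (qvert n d)) : odd r -> (r == 0) = false.
  by move=> o; apply/eqP => r0; rewrite r0 in o.
split=> r /=; rewrite odd_succ; case: (boolP (odd r)) => o /=;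
  rewrite ?(E0 _ o) ?mulmx0 ?mul0mx //.
all: by rewrite E0 ?odd_succ // ?mulmx0 ?mul0mx.
Qed.
End QuiverRepresentations.

(* Main.v *)
(* The proof is a computation in the stable category.  The core of a module is     *)
(* unique (Krull-Schmidt) and depends only on its class up to projective summands,  *)
(* and tensoring with any module on either side preserves projectives, because the  *)
(* tensor functors have exact adjoints given by duals.  So, by associativity, the   *)
(* theorem reduces to L(u,i) (x) L(v,j) = sum of the L(u+v,i+j+theta) up to          *)
(* projectives.  An L(u,i) is determined by i and its dimension N; write it S(i,N). *)
(* One has S(0,2) (x) S(i,N) = S(i,N+1) + S(i+1,N-1) for N < d, where S(i,d) is      *)
(* projective; the general rule follows by induction on the dimension of the first  *)
(* factor, with cancellation.                                                       *)
(*                                                                                  *)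
(* Projectivity of S(i,d) requires n to be nonzero in k.  If n = 0 in k, no block   *)
(* equivalence exists: the trivial module then has a self-extension through the     *)
(* (d-1)-dimensional simple module L(0,1), on which G is not semisimple, and  *)
(* no representation of the bound quiver corresponds to it.                         *)

Require Import Defs.
From Stdlib Require Import ClassicalEpsilon Classical_Prop FunctionalExtensionality.
From mathcomp Require Import all_boot all_order all_algebra.
From mathcomp Require Import mxtens zify ring.

Set Implicit Arguments.
Unset Strict Implicit.
Unset Printing Implicit Defensive.

Import GRing.Theory.
Local Open Scope ring_scope.

(** Call two modules stably isomorphic ([stable]) when they become isomorphic after adding
    projective modules. By Krull-Schmidt, the core depends only on the stable class ([stable_core]),
    and summands can be cancelled ([stable_cancel]). Duals taken with the antipode or its inverse
    give tensor-hom adjunctions ([flipl_dhom], [flipr_dhom]), so tensoring on either side preserves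
    projectives and hence stable isomorphism. With C the image under [F] of the band representation,
    core(C (x) L(u,i)) (x) L(v,j) is therefore stably C (x) (L(u,i) (x) L(v,j)), and everything
    reduces to the stable decomposition of a product of two simple modules ([core_fusion]).

    Put A = sum of the a_i and K = sum of the q^i e_i. Then D looks like a quantum sl2: A raises the
    degree, X lowers it, and XA = qAX + 1 - GK. A vector v of degree i, killed by X and A^N, on
    which G acts by q^(1-N-i), spans with its images A^t v a quotient of the string module S(i,N)
    ([string_mod], [string_hom]). The non-projective simples are the strings with 0 < N < d
    ([is_L_string]). If n is nonzero in k, S(i,d) is projective ([steinberg_projective]). The
    Clebsch-Gordan rule S(0,2) (x) S(i,N) = S(i,N+1) + S(i+1,N-1) ([string_mod2_tens]) lets one
    expand S(0,2) (x) S(i,M+1) (x) S(j,N) in two ways. Comparing them and cancelling gives the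
    general rule by induction on M ([string_fusion]). Strings of length d vanish stably, which is
    why the lower values of theta disappear when N + N' > d.

    If n is zero in k, the equivalence [F] cannot exist. Now G may be non-diagonalisable, and
    [loop_mod] is an indecomposable module of the block, of dimension d + 1, on which the central
    element G K^-1 acts as 1 + phi with phi nonzero of square zero. If [loop_mod] were F V, some
    loop of the quiver would act non-trivially on V ([loop_acts]). Then V would contain both
    length-2 representations that end at the image of that loop ([low_hom], [high_hom]). The
    normalisation of [F] says in which degrees their images live, and these do not all fit into the
    degrees 0, ..., d-1 of [loop_mod] ([loop_module_contradiction]). *)

Notation dhom M N f := (@is_dhom _ _ M N f).

(** * Homomorphisms, isomorphisms and direct sums of modules *)

Section Modules.
Variables (k : fieldType) (n d : nat) (q : k).
Implicit Types M N P A B C : dmod k n.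

(** One index type for all the generators turns equivariance into a single equation ([dhomP]). *)
Inductive gen := gE of Zmod n | gA of Zmod n | gG | gX.

Definition act M (o : gen) : 'M[k]_(ddim M) :=
  match o with gE i => actE M i | gA i => actA M i | gG => actG M | gX => actX M end.

Lemma dhomP M N (f : 'M[k]_(ddim N, ddim M)) :
  dhom M N f <-> forall o, f *m act M o = act N o *m f.
Proof.
split=> [[hE hA hG hX] [i|i||]|h] //=.
split=> [i|i||].
- exact: (h (gE i)).
- exact: (h (gA i)).
- exact: (h gG).
exact: (h gX).
Qed.

Lemma dhom1 M : dhom M M 1%:M.
Proof. by apply/dhomP=> o; rewrite mul1mx mulmx1. Qed.

Lemma dhom0 M N : dhom M N 0.
Proof. by apply/dhomP=> o; rewrite mul0mx mulmx0. Qed.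

Lemma dhomM M N P (g : 'M_(ddim P, ddim N)) (f : 'M_(ddim N, ddim M)) :
  dhom N P g -> dhom M N f -> dhom M P (g *m f).
Proof.
by move=> /dhomP hg /dhomP hf; apply/dhomP=> o; rewrite -mulmxA hf mulmxA hg mulmxA.
Qed.

Lemma dhomD M N (f g : 'M_(ddim N, ddim M)) :
  dhom M N f -> dhom M N g -> dhom M N (f + g).
Proof.
by move=> /dhomP hf /dhomP hg; apply/dhomP=> o; rewrite mulmxDl hf hg mulmxDr.
Qed.

Lemma dhomN M N (f : 'M_(ddim N, ddim M)) : dhom M N f -> dhom M N (- f).
Proof. by move=> /dhomP hf; apply/dhomP=> o; rewrite mulNmx hf mulmxN. Qed.

Lemma dhomB M N (f g : 'M_(ddim N, ddim M)) :
  dhom M N f -> dhom M N g -> dhom M N (f - g).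
Proof. by move=> hf hg; apply: dhomD => //; apply: dhomN. Qed.

Lemma diso_refl M : diso M M.
Proof. by exists 1%:M, 1%:M; split; rewrite ?mulmx1 //; apply: dhom1. Qed.

Lemma diso_sym M N : diso M N -> diso N M.
Proof. by case=> f [g [hf hg fg gf]]; exists g, f. Qed.

Lemma diso_trans N M P : diso M N -> diso N P -> diso M P.
Proof.
case=> f [g [hf hg fg gf]] [f' [g' [hf' hg' fg' gf']]].
exists (f' *m f), (g *m g'); split; try exact: dhomM.
  by rewrite mulmxA -(mulmxA f') fg mulmx1.
by rewrite mulmxA -(mulmxA g) gf' mulmx1.
Qed.

Lemma left_inv_dim m p (f : 'M[k]_(m, p)) (g : 'M[k]_(p, m)) : g *m f = 1%:M -> (p <= m)%N.
Proof. by move=> gf; rewrite -(mxrank1 k p) -gf (leq_trans (mxrankM_maxr _ _)) // rank_leq_row. Qed.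

Lemma diso_dim M N : diso M N -> ddim M = ddim N.
Proof.
case=> f [g [_ _ fg gf]]; apply/eqP.
by rewrite eqn_leq (left_inv_dim fg) (left_inv_dim gf).
Qed.

Lemma dhom_inv M N (f : 'M_(ddim N, ddim M)) (g : 'M_(ddim M, ddim N)) :
  dhom M N f -> f *m g = 1%:M -> g *m f = 1%:M -> dhom N M g.
Proof.
move=> /dhomP hf fg gf; apply/dhomP=> o.
by rewrite -[g *m _]mulmx1 -fg mulmxA -(mulmxA g) -hf (mulmxA g) gf mul1mx.
Qed.

Lemma mx_inj_left_inv m p (f : 'M[k]_(m, p)) :
  mx_inj f -> exists g : 'M[k]_(p, m), g *m f = 1%:M.
Proof.
move=> inj_f; have: row_full f.
  rewrite -col_leq_rank -mxrank_tr leqNgt; apply/negP=> lt.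
  have: kermx f^T != 0 by rewrite -mxrank_eq0 mxrank_ker mxrank_tr subn_eq0 -ltnNge -mxrank_tr.
  case/rowV0Pn=> v /sub_kermxP vf v0; case/negP: v0.
  rewrite -trmx_eq0; apply/eqP/inj_f; rewrite -[f]trmxK -trmx_mul vf trmx0 //.
by case/row_fullP=> g gf; exists g.
Qed.

Lemma left_inv_mx_inj m p (f : 'M[k]_(m, p)) (g : 'M[k]_(p, m)) : g *m f = 1%:M -> mx_inj f.
Proof. by move=> gf v fv; rewrite -[v]mul1mx -gf -mulmxA fv mulmx0. Qed.

Lemma dhom_inj_diso M N (f : 'M_(ddim N, ddim M)) :
  dhom M N f -> mx_inj f -> (ddim N <= ddim M)%N -> diso M N.
Proof.
move=> hf /mx_inj_left_inv [g gf] le.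
have e : ddim M = ddim N by apply/eqP; rewrite eqn_leq le (left_inv_dim gf).
suff fg : f *m g = 1%:M by exists f, g; split=> //; apply: (dhom_inv hf).
clear hf le; move: f g gf; rewrite -e => f g gf.
exact: mulmx1C.
Qed.

Definition jointly_mono (T : Type) (M : dmod k n) (N : T -> dmod k n)
    (f : forall c, 'M_(ddim (N c), ddim M)) :=
  forall m (U V : 'M[k]_(ddim M, m)), (forall c, f c *m U = f c *m V) -> U = V.

(** Each relation of D can be checked after composing with the maps [f c], where it holds by
    assumption. One injective map gives the case of submodules and summands, the two projections
    give direct sums. *)
Lemma jointly_mono_dmod (T : Type) M (N : T -> dmod k n)
    (f : forall c, 'M_(ddim (N c), ddim M)) :
  (forall c, is_dmod d q (N c)) -> (forall c, dhom M (N c) (f c)) ->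
  jointly_mono f -> is_dmod d q M.
Proof.
move=> dN hf jm.
have hE c i := homE (hf c) i; have hA c i := homA (hf c) i.
have hG c := homG (hf c); have hX c := homX (hf c).
have [hEm hAm hGm hXm] : [/\ forall c i m (Y : 'M_(_, m)), f c *m (actE M i *m Y) = actE (N c) i *m (f c *m Y),
  forall c i m (Y : 'M_(_, m)), f c *m (actA M i *m Y) = actA (N c) i *m (f c *m Y),
  forall c m (Y : 'M_(_, m)), f c *m (actG M *m Y) = actG (N c) *m (f c *m Y)
  & forall c m (Y : 'M_(_, m)), f c *m (actX M *m Y) = actX (N c) *m (f c *m Y)].
  by split=> *; rewrite mulmxA ?hE ?hA ?hG ?hX mulmxA.
have hgam c i m : f c *m gamma M i m = gamma (N c) i m *m f c.
  elim: m => [|m IH] /=; first by rewrite -[1]/1%:M mulmx1 -[1]/1%:M mul1mx.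
  by rewrite -!mulmxE hAm IH mulmxA.
have hexp c m (Y : 'M_(ddim M)) (Z : 'M_(ddim (N c))) :
    f c *m Y = Z *m f c -> f c *m Y ^+ m = Z ^+ m *m f c.
  move=> YZ; elim: m => [|m IH]; first by rewrite !expr0 -[1]/1%:M mulmx1 mul1mx.
  by rewrite !exprS -!mulmxE mulmxA YZ -mulmxA IH mulmxA.
pose s := (mulmxDr, mulmxN, =^~ scalemxAr, hEm, hAm, hGm, hXm, hE, hA, hG, hX).
split=> [i j||i|i||||i|i|i|i]; apply: jm => c; rewrite -?mulmxE.
- by rewrite !s !mulmxA mulmxE (relEE (dN c)) scalemxAl.
- rewrite mulmx_sumr; under eq_bigr do rewrite hE.
  by rewrite -mulmx_suml (relE1 (dN c)) -[1]/1%:M mul1mx -[1]/1%:M mulmx1.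
- by rewrite -!mulmxA !s {1}(relA (dN c)) -!mulmxE !mulmxA.
- by rewrite hgam (relAd (dN c)) mul0mx mulmx0.
- by rewrite (hexp _ _ _ _ (hG c)) (relGn (dN c)) -[1]/1%:M mul1mx -[1]/1%:M mulmx1.
- by rewrite (hexp _ _ _ _ (hX c)) (relXd (dN c)) mul0mx mulmx0.
- by rewrite !s !mulmxA mulmxE (relGX (dN c)) -scalemxAl.
- by rewrite !s !mulmxA mulmxE (relGE (dN c)).
- by rewrite !s !mulmxA mulmxE (relAG (dN c)) -scalemxAl.
- by rewrite !s !mulmxA mulmxE (relEX (dN c)).
by rewrite !s mulmxA mulmxE (relAX (dN c)) -!mulmxE -scalemxAl !mulmxDl mulNmx -scalemxAl !mulmxA.
Qed.

Lemma left_inv_dmod M N (f : 'M_(ddim N, ddim M)) (g : 'M_(ddim M, ddim N)) :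
  is_dmod d q N -> dhom M N f -> g *m f = 1%:M -> is_dmod d q M.
Proof.
move=> dN hf gf; apply: (@jointly_mono_dmod unit _ (fun=> N) (fun=> f)) => // m U V /(_ tt) e.
by rewrite -[U]mul1mx -gf -mulmxA e mulmxA gf mul1mx.
Qed.

Lemma diso_dmod M N : diso M N -> is_dmod d q M -> is_dmod d q N.
Proof. by case=> f [g [hf hg fg gf]] dM; apply: (left_inv_dmod dM hg fg). Qed.

Lemma act_dadd A B o : act (dadd A B) o = block_mx (act A o) 0 0 (act B o).
Proof. by case: o. Qed.

Definition inl_mx A B : 'M[k]_(ddim (dadd A B), ddim A) := col_mx 1%:M 0.
Definition inr_mx A B : 'M[k]_(ddim (dadd A B), ddim B) := col_mx 0 1%:M.
Definition prl_mx A B : 'M[k]_(ddim A, ddim (dadd A B)) := row_mx 1%:M 0.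
Definition prr_mx A B : 'M[k]_(ddim B, ddim (dadd A B)) := row_mx 0 1%:M.

Lemma dhom_inl A B : dhom A (dadd A B) (inl_mx A B).
Proof. by apply/dhomP=> o; rewrite act_dadd mul_block_col mul_col_mx !(mul0mx, mulmx0, mul1mx, mulmx1, addr0, add0r). Qed.
Lemma dhom_inr A B : dhom B (dadd A B) (inr_mx A B).
Proof. by apply/dhomP=> o; rewrite act_dadd mul_block_col mul_col_mx !(mul0mx, mulmx0, mul1mx, mulmx1, addr0, add0r). Qed.
Lemma dhom_prl A B : dhom (dadd A B) A (prl_mx A B).
Proof. by apply/dhomP=> o; rewrite act_dadd mul_row_block mul_mx_row !(mul0mx, mulmx0, mul1mx, mulmx1, addr0, add0r). Qed.
Lemma dhom_prr A B : dhom (dadd A B) B (prr_mx A B).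
Proof. by apply/dhomP=> o; rewrite act_dadd mul_row_block mul_mx_row !(mul0mx, mulmx0, mul1mx, mulmx1, addr0, add0r). Qed.

Lemma prl_inl A B : prl_mx A B *m inl_mx A B = 1%:M.
Proof. by rewrite mul_row_col mulmx1 mulmx0 addr0. Qed.
Lemma prr_inr A B : prr_mx A B *m inr_mx A B = 1%:M.
Proof. by rewrite mul_row_col mulmx1 mulmx0 add0r. Qed.
Lemma prl_inr A B : prl_mx A B *m inr_mx A B = 0.
Proof. by rewrite mul_row_col mulmx1 mulmx0 addr0. Qed.
Lemma prr_inl A B : prr_mx A B *m inl_mx A B = 0.
Proof. by rewrite mul_row_col mulmx1 mulmx0 add0r. Qed.
Lemma dadd_id A B : inl_mx A B *m prl_mx A B + inr_mx A B *m prr_mx A B = 1%:M.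
Proof.
rewrite !mul_col_row !(mulmx1, mul1mx, mulmx0, mul0mx) add_block_mx !(addr0, add0r).
exact: esym (scalar_mx_block _ _ _).
Qed.

(** Direct sums by equations between maps instead of block matrices: commutativity and associativity
    then need no casts between sums of dimensions. *)
Definition biproduct_maps M A B (a : 'M[k]_(ddim M, ddim A)) (b : 'M[k]_(ddim M, ddim B))
    (a' : 'M[k]_(ddim A, ddim M)) (b' : 'M[k]_(ddim B, ddim M)) : Prop :=
  [/\ [/\ dhom A M a, dhom B M b, dhom M A a' & dhom M B b'],
      [/\ a' *m a = 1%:M, b' *m b = 1%:M, a' *m b = 0 & b' *m a = 0]
    & a *m a' + b *m b' = 1%:M].

Record biproduct M A B : Prop := Biproduct {
  biproductP : exists a b a' b', @biproduct_maps M A B a b a' b' }.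

Lemma biproduct_maps_dadd A B :
  @biproduct_maps (dadd A B) A B (inl_mx A B) (inr_mx A B) (prl_mx A B) (prr_mx A B).
Proof.
split; last exact: dadd_id.
  by split; [apply: dhom_inl|apply: dhom_inr|apply: dhom_prl|apply: dhom_prr].
by split; rewrite ?prl_inl ?prr_inr ?prl_inr ?prr_inl.
Qed.

Lemma biproduct_dadd A B : biproduct (dadd A B) A B.
Proof.
by constructor; exists (inl_mx A B), (inr_mx A B), (prl_mx A B), (prr_mx A B);
  apply: biproduct_maps_dadd.
Qed.

Lemma biproduct_iso M N A B : biproduct M A B -> biproduct N A B -> diso M N.
Proof.
case=> [[a [b [a' [b' [[ha hb ha' hb'] [aa bb ab ba] e]]]]]].
case=> [[c [f [c' [f' [[hc hf hc' hf'] [cc ff cf fc] e']]]]]].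
exists (c *m a' + f *m b'), (a *m c' + b *m f'); split.
- by apply: dhomD; apply: dhomM.
- by apply: dhomD; apply: dhomM.
- rewrite mulmxDl !mulmxDr -!mulmxA !(mulmxA a') !(mulmxA b').
  by rewrite aa bb ab ba !mul0mx !mul1mx !mulmx0 addr0 add0r.
rewrite mulmxDl !mulmxDr -!mulmxA !(mulmxA c') !(mulmxA f').
by rewrite cc ff cf fc !mul0mx !mul1mx !mulmx0 addr0 add0r.
Qed.

Lemma biproduct_daddP M A B : biproduct M A B <-> diso M (dadd A B).
Proof.
split=> [h|]; first exact: biproduct_iso h (biproduct_dadd _ _).
case=> f [g [hf hg fg gf]]; constructor.
exists (g *m inl_mx A B), (g *m inr_mx A B), (prl_mx A B *m f), (prr_mx A B *m f).
split; first by split; apply: dhomM => //;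
  [apply: dhom_inl|apply: dhom_inr|apply: dhom_prl|apply: dhom_prr].
  by split; rewrite mulmxA -(mulmxA _ f) fg mulmx1 ?prl_inl ?prr_inr ?prl_inr ?prr_inl.
by rewrite !mulmxA -!(mulmxA g) -mulmxDr -mulmxDl dadd_id mul1mx.
Qed.

Lemma biproduct_mapsC M A B a b a' b' :
  @biproduct_maps M A B a b a' b' -> @biproduct_maps M B A b a b' a'.
Proof.
by case=> [[ha hb ha' hb'] [aa bb ab ba] e]; split=> //; rewrite addrC.
Qed.

Lemma biproductC M A B : biproduct M A B -> biproduct M B A.
Proof.
by case=> [[a [b [a' [b' h]]]]]; constructor; exists b, a, b', a'; apply: biproduct_mapsC.
Qed.

Lemma daddC A B : diso (dadd A B) (dadd B A).
Proof. exact/biproduct_daddP/biproductC/biproduct_dadd. Qed.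

Lemma diso_dadd A A' B B' : diso A A' -> diso B B' -> diso (dadd A B) (dadd A' B').
Proof.
case=> f [g [hf hg fg gf]] [f' [g' [hf' hg' fg' gf']]].
apply/biproduct_daddP; constructor.
exists (inl_mx A B *m g), (inr_mx A B *m g'), (f *m prl_mx A B), (f' *m prr_mx A B).
have [hi hj hp hr] : [/\ dhom A _ (inl_mx A B), dhom B _ (inr_mx A B), dhom _ A (prl_mx A B) & dhom _ B (prr_mx A B)].
  by split; [apply: dhom_inl|apply: dhom_inr|apply: dhom_prl|apply: dhom_prr].
split; first by split; apply: dhomM.
  split.
  - by rewrite -mulmxA (mulmxA (prl_mx A B)) prl_inl mul1mx.
  - by rewrite -mulmxA (mulmxA (prr_mx A B)) prr_inr mul1mx.
  - by rewrite -mulmxA (mulmxA (prl_mx A B)) prl_inr mul0mx mulmx0.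
  by rewrite -mulmxA (mulmxA (prr_mx A B)) prr_inl mul0mx mulmx0.
by rewrite !mulmxA -!(mulmxA _ g) -(mulmxA _ g') gf gf' !mulmx1 dadd_id.
Qed.

Lemma diso_daddl A A' B : diso A A' -> diso (dadd A B) (dadd A' B).
Proof. by move=> h; apply: diso_dadd => //; apply: diso_refl. Qed.

Lemma diso_daddr A B B' : diso B B' -> diso (dadd A B) (dadd A B').
Proof. by move=> h; apply: diso_dadd => //; apply: diso_refl. Qed.

Lemma biproduct_mapsA M A B C N a b a' b' c f c' f' :
  @biproduct_maps M A N a b a' b' -> @biproduct_maps N B C c f c' f' ->
  @biproduct_maps M (dadd A B) C (a *m prl_mx A B + b *m c *m prr_mx A B) (b *m f)
    (inl_mx A B *m a' + inr_mx A B *m (c' *m b')) (f' *m b').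
Proof.
case=> [[ha hb ha' hb'] [aa bb ab ba] e] [[hc hf hc' hf'] [cc ff cf fc] e'].
have [hi hj hp hr] : [/\ dhom A _ (inl_mx A B), dhom B _ (inr_mx A B), dhom _ A (prl_mx A B) & dhom _ B (prr_mx A B)].
  by split; [apply: dhom_inl|apply: dhom_inr|apply: dhom_prl|apply: dhom_prr].
split.
- by split; try apply: dhomD; do ?apply: dhomM.
- split.
  + rewrite mulmxDl !mulmxDr !mulmxA -!(mulmxA _ a') -!(mulmxA _ b') aa bb ab ba.
    by rewrite !mulmx1 !mulmx0 !mul0mx -!(mulmxA _ c') cc mulmx1 addr0 add0r dadd_id.
  + by rewrite mulmxA -(mulmxA f') bb mulmx1.
  + rewrite mulmxDl !mulmxA -!(mulmxA _ a') -!(mulmxA _ b') ab bb.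
    by rewrite mulmx1 mulmx0 mul0mx -!(mulmxA _ c') cf mulmx0 addr0.
  by rewrite mulmxDr !mulmxA -!(mulmxA _ b') ba bb mulmx1 fc mulmx0 !mul0mx addr0.
rewrite mulmxDl !mulmxDr !mulmxA -!(mulmxA _ (prl_mx A B)) -!(mulmxA _ (prr_mx A B)).
rewrite prl_inl prl_inr prr_inl prr_inr !mulmx1 !mulmx0 !mul0mx addr0 add0r -addrA -mulmxDl.
by rewrite -!(mulmxA b) -mulmxDr e' mulmx1 e.
Qed.

Lemma biproductA M A B C N : biproduct M A N -> biproduct N B C ->
  biproduct M (dadd A B) C.
Proof.
case=> [[a [b [a' [b' h]]]]] [[c [f [c' [f' h']]]]].
by constructor; do 4!eexists; apply: biproduct_mapsA h h'.
Qed.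

Lemma daddA A B C : diso (dadd A (dadd B C)) (dadd (dadd A B) C).
Proof. exact/biproduct_daddP/(biproductA (biproduct_dadd _ _) (biproduct_dadd _ _)). Qed.

Lemma dadd0d A : diso (dadd (dzero k n) A) A.
Proof.
apply: diso_sym; apply/biproduct_daddP; constructor; exists 0, 1%:M, 0, 1%:M.
split; first by split; try exact: dhom0; apply: dhom1.
  by split; rewrite ?mulmx1 ?mulmx0 //; apply/matrixP=> - [].
by rewrite mulmx0 add0r mulmx1.
Qed.

Lemma daddd0 A : diso (dadd A (dzero k n)) A.
Proof. exact: diso_trans (daddC _ _) (dadd0d _). Qed.

Lemma ddim0_iso A : ddim A = 0%N -> diso A (dzero k n).
Proof.
move=> e; exists 0, 0; split; try exact: dhom0; apply/matrixP=> i; first by case: i.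
by have := ltn_ord i; rewrite [X in (_ < X)%N]e.
Qed.

Lemma daddCA A B C : diso (dadd A (dadd B C)) (dadd B (dadd A C)).
Proof.
apply: diso_trans (daddA _ _ _) _.
by apply: diso_trans (diso_daddl _ (daddC _ _)) _; apply: diso_sym (daddA _ _ _).
Qed.

Lemma daddACA A B C D : diso (dadd (dadd A B) (dadd C D)) (dadd (dadd A C) (dadd B D)).
Proof.
apply: diso_trans (diso_sym (daddA _ _ _)) _; apply: diso_trans (daddA A C _).
by apply: diso_daddr; apply: daddCA.
Qed.

Lemma dsum_cat (s t : seq (dmod k n)) : diso (dsum (s ++ t)) (dadd (dsum s) (dsum t)).
Proof.
elim: s => [|A s IH] /=; first exact: diso_sym (dadd0d _).
by apply: diso_trans (diso_daddr _ IH) _; apply: daddA.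
Qed.

Lemma dsum_nth_rem A0 (s : seq (dmod k n)) i : (i < size s)%N ->
  diso (dsum s) (dadd (nth A0 s i) (dsum (take i s ++ drop i.+1 s))).
Proof.
elim: s i => [|A s IH] [|i] //= lt; first by rewrite drop0; apply: diso_refl.
by apply: diso_trans (diso_daddr _ (IH _ lt)) _; apply: daddCA.
Qed.

Lemma dsum_perm (I : eqType) (f : I -> dmod k n) (s t : seq I) :
  perm_eq s t -> diso (dsum (map f s)) (dsum (map f t)).
Proof.
elim: s t => [|x s IH] t; first by rewrite perm_sym => /perm_nilP ->; apply: diso_refl.
move=> pst; have xt : x \in t by rewrite -(perm_mem pst) mem_head.
have := perm_trans pst (perm_to_rem xt); rewrite perm_cons => /IH is_.
have it : (index x t < size (map f t))%N by rewrite size_map index_mem.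
apply: diso_sym; apply: diso_trans (dsum_nth_rem (f x) it) _.
rewrite (nth_map x) ?index_mem // nth_index // -map_take -map_drop -map_cat.
by rewrite /=; apply: diso_daddr; apply: diso_sym; rewrite remE in is_.
Qed.

Lemma eq_dsum (I : eqType) (f g : I -> dmod k n) (s : seq I) :
  (forall x, x \in s -> diso (f x) (g x)) -> diso (dsum (map f s)) (dsum (map g s)).
Proof.
elim: s => [|x s IH] h /=; first exact: diso_refl.
apply: diso_dadd; first by apply: h; rewrite mem_head.
by apply: IH => y ys; apply: h; rewrite inE ys orbT.
Qed.

Lemma dzero_dmod : is_dmod d q (dzero k n).
Proof. by split=> *; apply/matrixP=> - []. Qed.

Lemma dadd_dmod A B : is_dmod d q A -> is_dmod d q B -> is_dmod d q (dadd A B).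
Proof.
move=> dA dB.
apply: (@jointly_mono_dmod bool _ (fun c => if c then A else B)
  (fun c => if c return 'M_(ddim (if c then A else B), _) then prl_mx A B else prr_mx A B)).
- by case.
- by case; [apply: dhom_prl|apply: dhom_prr].
move=> m U V h; move: (h true) (h false) => /= e e'.
by rewrite -[U]mul1mx -[V]mul1mx -(dadd_id A B) !mulmxDl -!mulmxA e e'.
Qed.

Lemma dsum_dmod (s : seq (dmod k n)) : List.Forall (is_dmod d q) s -> is_dmod d q (dsum s).
Proof. by elim=> [|A t dA _ dt]; [apply: dzero_dmod|apply: dadd_dmod]. Qed.

End Modules.

(** * Krull-Schmidt, projectives, cores and stable isomorphism *)

Section KrullSchmidt.
Variables (k : fieldType) (n d : nat) (q : k).
Implicit Types M N P A B C S : dmod k n.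
Implicit Types s t : seq (dmod k n).

(** The rank factorisation e = a a' has a left-invertible and a' right-invertible, so e e = e forces
    a' a = 1. The image of e then carries the compressed action a' x a. *)
Lemma idempotent_split M (e : 'M_(ddim M)) : dhom M M e -> e *m e = e ->
  exists A (a : 'M_(ddim M, ddim A)) (a' : 'M_(ddim A, ddim M)),
    [/\ dhom A M a, dhom M A a', a' *m a = 1%:M & a *m a' = e].
Proof.
move=> /dhomP he ee.
have [a [a' [l [r [la ar aa']]]]] : exists (a : 'M_(_, \rank e)) (a' : 'M_(\rank e, _)) l r,
    [/\ l *m a = 1%:M, a' *m r = 1%:M & a *m a' = e].
  have /row_fullP[l la] := col_base_full e; have /row_freeP[r ar] := row_base_free e.
  by exists (col_base e), (row_base e), l, r; rewrite mulmx_base.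
have a'a : a' *m a = 1%:M.
  have : l *m (a *m a' *m (a *m a')) *m r = l *m (a *m a') *m r by rewrite aa' ee.
  by rewrite !mulmxA la !mul1mx -!mulmxA ar !mulmx1.
pose A := DMod (fun i => a' *m actE M i *m a) (fun i => a' *m actA M i *m a)
  (a' *m actG M *m a) (a' *m actX M *m a).
have actAE o : act A o = a' *m act M o *m a by case: o.
exists A, a, a'; split=> //; apply/dhomP=> o; rewrite actAE ?mulmxA.
  by rewrite aa' he -aa' -!mulmxA a'a mulmx1.
by rewrite -!mulmxA aa' -he -aa' !mulmxA a'a mul1mx.
Qed.

Lemma idempotent_biproduct M (e : 'M_(ddim M)) : is_dmod d q M -> dhom M M e -> e *m e = e ->
  exists A B, [/\ is_dmod d q A, is_dmod d q B &
  exists a b a' b', @biproduct_maps _ _ M A B a b a' b' /\ a *m a' = e].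
Proof.
move=> dM he ee; have [A [a [a' [ha ha' a'a aa']]]] := idempotent_split he ee.
have he1 : dhom M M (1%:M - e) by apply: dhomB => //; apply: dhom1.
have ee1 : (1%:M - e) *m (1%:M - e) = 1%:M - e.
  by rewrite mulmxBr mulmx1 mulmxBl mul1mx ee subrr subr0.
have [B [b [b' [hb hb' b'b bb']]]] := idempotent_split he1 ee1.
exists A, B; split; [exact: left_inv_dmod dM ha a'a|exact: left_inv_dmod dM hb b'b|].
exists a, b, a', b'; split=> //; split=> //; last by rewrite aa' bb' addrC subrK.
split=> //.
  have -> : a' *m b = a' *m (e *m (1%:M - e)) *m b.
    by rewrite -bb' -aa' !mulmxA a'a mul1mx -(mulmxA _ b' b) b'b mulmx1.
  by rewrite mulmxBr ee mulmx1 subrr mulmx0 mul0mx.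
have -> : b' *m a = b' *m ((1%:M - e) *m e) *m a.
  by rewrite -bb' -aa' !mulmxA b'b mul1mx -(mulmxA _ a' a) a'a mulmx1.
by rewrite mulmxBl ee mul1mx subrr mulmx0 mul0mx.
Qed.

Lemma mulmx_nonzero_dim m (f g : 'M[k]_m) : (0 < m)%N -> f *m g = 1%:M -> f != 0.
Proof.
move=> m0 fg; apply/eqP=> f0; have := congr1 (fun A : 'M_m => A (Ordinal m0) (Ordinal m0)) fg.
by rewrite f0 mul0mx !mxE eqxx => /esym/eqP; rewrite oner_eq0.
Qed.

Lemma dindec_idempotent M (e : 'M_(ddim M)) : dindec d q M -> dhom M M e -> e *m e = e ->
  e = 0 \/ e = 1%:M.
Proof.
case=> dM M0 indM he ee.
have [A [B [dA dB [a [b [a' [b' [h aa']]]]]]]] := idempotent_biproduct dM he ee.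
have i : diso M (dadd A B) by apply/biproduct_daddP; constructor; exists a, b, a', b'.
case: h => _ _; rewrite aa' => eb.
have z m p (U : 'M[k]_(m, p)) (V : 'M[k]_(p, m)) : p = 0%N -> U *m V = 0.
  by move=> p0; move: U V; rewrite p0 => U V; rewrite thinmx0 mul0mx.
case: (indM A B dA dB i) => [A0|B0]; [left|right].
  by rewrite -aa' (z _ _ a a' A0).
by rewrite -eb (z _ _ b b' B0) addr0.
Qed.

(** Write the characteristic polynomial of f as g X^a with g(0) nonzero, and u X^(a+1) + v g = 1 by
    Bezout. The values at f of u X^(a+1) and u X^a are e and h. The exponent a+1 makes e a multiple
    of f even when a = 0. Being polynomials in f, both commute with whatever commutes with f, so
    they are module endomorphisms when f is. *)
Lemma fitting_idempotent m (f : 'M[k]_m) : exists e h (r : nat),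
  [/\ e *m e = e, e = f *m h, (1%:M - e) *m f ^+ r = 0
    & forall X : 'M_m, X *m f = f *m X -> X *m h = h *m X].
Proof.
case: m f => [|m] f.
  by exists 0, 0, 0%N; split=> *; apply/matrixP=> - [].
have [a [g g0 cp]] := multiplicity_XsubC (char_poly f) 0.
move: g0 cp; rewrite monic_neq0 ?char_poly_monic //= subr0 => g0 cp.
have [u [v uv]] : exists u v : {poly k}, u * 'X^(a.+1) + v * g = 1.
  have /Bezout_eq1_coprimepP[[u v] /= uv] : coprimep ('X ^+ a.+1) g.
    by rewrite coprimep_expl // coprimep_sym coprimepX.
  by exists u, v.
have ch : horner_mx f (g * 'X ^+ a) = 0 by rewrite -cp Cayley_Hamilton.
have XE b : horner_mx f ('X ^+ b) = f ^+ b by rewrite rmorphXn /= horner_mx_X.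
exists (horner_mx f (u * 'X^(a.+1))), (horner_mx f (u * 'X^a)), a.+1.
have e1 : 1%:M - horner_mx f (u * 'X^(a.+1)) = horner_mx f (v * g).
  by rewrite -[1%:M](rmorph1 (horner_mx f)) -uv -rmorphB /= addrC addKr.
split.
- apply/eqP; rewrite -subr_eq0 -[X in _ - X]mulmx1 -mulmxBr -opprB mulmxN e1 oppr_eq0.
  rewrite !mulmxE -rmorphM /=.
  have -> : u * 'X^(a.+1) * (v * g) = g * 'X ^+ a * (u * 'X * v) by rewrite exprS; ring.
  by rewrite rmorphM /= ch mul0r.
- by rewrite -{2}[f]horner_mx_X !mulmxE -rmorphM /= exprS mulrCA.
- rewrite e1 -XE !mulmxE -rmorphM /=.
  have -> : v * g * 'X^(a.+1) = g * 'X ^+ a * ('X * v) by rewrite exprS; ring.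
  by rewrite rmorphM /= ch mul0r.
by move=> X Xf; apply: comm_mx_horner.
Qed.

Lemma dindec_fitting S (f : 'M_(ddim S)) : dindec d q S -> dhom S S f ->
  (exists2 g, dhom S S g & f *m g = 1%:M) \/ exists p : nat, f ^+ p = 0.
Proof.
move=> iS hf; have [e [h [N [ee eh eN hX]]]] := fitting_idempotent f.
have hh : dhom S S h.
  by move/dhomP: hf => hf; apply/dhomP=> o; apply/esym/hX/esym/hf.
have he : dhom S S e by rewrite eh; apply: dhomM.
case: (dindec_idempotent iS he ee) => e0.
  by right; exists N; rewrite -eN e0 subr0 mul1mx.
by left; exists h; rewrite // -eh.
Qed.

(** The endomorphism ring of an indecomposable is local: by Fitting, f u is invertible or nilpotent,
    and in the second case a geometric series inverts g u = 1 - f u. *)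
Lemma dindec_local S (f g u : 'M_(ddim S)) : dindec d q S ->
  dhom S S f -> dhom S S g -> dhom S S u -> (f + g) *m u = 1%:M ->
  (exists2 h, dhom S S h & f *m h = 1%:M) \/ (exists2 h, dhom S S h & g *m h = 1%:M).
Proof.
move=> iS hf hg hu fgu.
case: (dindec_fitting iS (dhomM hf hu)) => [[h hh e]|[N nil]].
  by left; exists (u *m h); [apply: dhomM|rewrite mulmxA].
right; have guE : g *m u = 1%:M - f *m u by rewrite -fgu mulmxDl addrC addKr.
pose r := \sum_(i < N) (f *m u) ^+ i.
have hr : dhom S S r.
  rewrite /r; apply: (big_ind (fun x => dhom S S x)) => [|x y|i _]; first exact: dhom0.
    exact: dhomD.
  by elim: (nat_of_ord i) => [|j IH]; [apply: dhom1|rewrite exprS; apply: dhomM (dhomM hf hu) IH].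
exists (u *m r); first exact: dhomM.
rewrite mulmxA guE /r.
have := subrX1 (f *m u) N; rewrite nil sub0r -[1]/1%:M => /(congr1 -%R).
by rewrite opprK -mulNr opprB -mulmxE => /esym.
Qed.

(** If the component c' a : S -> N is invertible, both R and T are complements of the image of a,
    hence isomorphic. *)
Lemma complement_unique M S R N T a b a' b' c e c' e' (w : 'M_(ddim S, ddim N)) :
  @biproduct_maps _ _ M S R a b a' b' -> @biproduct_maps _ _ M N T c e c' e' ->
  dhom N S w -> c' *m a *m w = 1%:M -> w *m (c' *m a) = 1%:M -> diso R T.
Proof.
case=> [[ha hb ha' hb'] [aa bb ab ba] eM] [[hc he hc' he'] [cc ee ce ec] eM'] hw uw wu.
have bbE : b *m b' = 1%:M - a *m a' by rewrite -eM addrC addKr.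
have eeE : e *m e' = 1%:M - c *m c' by rewrite -eM' addrC addKr.
(* The map 1 - a w c' is the projection onto ker c', which is the image of e, along the image of
   a. *)
exists (e' *m (1%:M - a *m w *m c') *m b), (b' *m e); split.
- apply: dhomM hb; apply: dhomM he' _; apply: dhomB; first exact: dhom1.
  by apply: dhomM hc'; apply: dhomM.
- exact: dhomM.
- have E : (1%:M - a *m w *m c') *m (b *m b') = 1%:M - a *m w *m c'.
    rewrite bbE mulmxBr mulmx1 (mulmxA _ a) mulmxBl mul1mx -!mulmxA wu mulmx1.
    by rewrite subrr mul0mx subr0.
  rewrite mulmxA -(mulmxA _ b b') -(mulmxA e') E mulmxBr mulmxBl mulmx1 ee.
  by rewrite -!mulmxA ce !mulmx0 subr0.
have E : (e *m e') *m (1%:M - a *m w *m c') = 1%:M - a *m w *m c'.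
  rewrite eeE mulmxBr mulmx1 mulmxBl mul1mx -!mulmxA (mulmxA c' a) (mulmxA (c' *m a) w) uw mul1mx.
  by rewrite opprB addrA subrK.
rewrite !mulmxA -(mulmxA b') -(mulmxA b' _ (_ - _)) E mulmxBr mulmxBl mulmx1 bb.
by rewrite !mulmxA ba !mul0mx subr0.
Qed.

(** The invertible endomorphism a' a of S is a sum of endomorphisms factoring through the individual
    summands. Locality makes one of them invertible. *)
Lemma exchange_unit S s (a : 'M_(ddim (dsum s), ddim S)) (a' : 'M_(ddim S, ddim (dsum s))) u :
  dindec d q S -> dhom S (dsum s) a -> dhom (dsum s) S a' -> dhom S S u ->
  a' *m a *m u = 1%:M ->
  exists2 i, (i < size s)%N & exists c e c' e' v,
    [/\ @biproduct_maps _ _ (dsum s) (nth (dzero k n) s i) (dsum (take i s ++ drop i.+1 s)) c e c' e',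
        dhom S S v & a' *m c *m (c' *m a) *m v = 1%:M].
Proof.
move=> iS; elim: s a a' u => [|N s IH] a a' u ha ha' hu e /=.
  have [_ S0 _] := iS; case/eqP: (mulmx_nonzero_dim S0 e).
  by apply/matrixP=> i j; rewrite !mxE big_ord0.
have e2 : (a' *m inl_mx N (dsum s) *m (prl_mx N (dsum s) *m a)
    + a' *m inr_mx N (dsum s) *m (prr_mx N (dsum s) *m a)) *m u = 1%:M.
  rewrite !mulmxA -(mulmxA a' (inl_mx _ _)) -(mulmxA a' (inr_mx _ _)).
  by rewrite -mulmxDl -mulmxDr dadd_id mulmx1.
have hl := dhomM ha' (dhom_inl N (dsum s)); have hr := dhomM ha' (dhom_inr N (dsum s)).
have hl' := dhomM (dhom_prl N (dsum s)) ha; have hr' := dhomM (dhom_prr N (dsum s)) ha.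
have [[v hv ev]|[v hv ev]] := dindec_local iS (dhomM hl hl') (dhomM hr hr') hu e2.
  exists 0%N; rewrite //= drop0.
  exists (inl_mx N (dsum s)), (inr_mx N (dsum s)), (prl_mx N (dsum s)), (prr_mx N (dsum s)), v.
  by split=> //; apply: biproduct_maps_dadd.
have [i lti [c [f [c' [f' [w [b hw ew]]]]]]] := IH _ _ _ hr' hr hv ev.
exists i.+1 => //=.
have := biproduct_mapsC (biproduct_mapsA (biproduct_maps_dadd N (dsum s)) (biproduct_mapsC b)).
move=> bb; do 4!eexists; exists w; split; first exact: bb.
  by [].
by rewrite !mulmxA in ew *.
Qed.

Lemma Forall_nth (T : Type) (P : T -> Prop) x0 (s : seq T) i :
  List.Forall P s -> (i < size s)%N -> P (nth x0 s i).
Proof. by move=> h; elim: h i => [|x t Px _ IH] [|i] //=; apply: IH. Qed.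

Lemma Forall_cat (T : Type) (P : T -> Prop) (s t : seq T) :
  List.Forall P (s ++ t) <-> List.Forall P s /\ List.Forall P t.
Proof. exact: List.Forall_app. Qed.

Lemma Forall_rem (T : Type) (P : T -> Prop) (s : seq T) i :
  List.Forall P s -> List.Forall P (take i s ++ drop i.+1 s).
Proof.
move=> h; apply/Forall_cat; split.
  by move: h; rewrite -{1}(cat_take_drop i s) => /Forall_cat[].
by move: h; rewrite -{1}(cat_take_drop i.+1 s) => /Forall_cat[].
Qed.

(** Exchange property: an indecomposable summand S matches some term of any decomposition into
    indecomposables, and the remaining parts match as well. *)
Lemma exchange S R s : dindec d q S -> List.Forall (dindec d q) s ->
  diso (dadd S R) (dsum s) ->
  exists2 i, (i < size s)%N &
    diso S (nth (dzero k n) s i) /\ diso R (dsum (take i s ++ drop i.+1 s)).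
Proof.
move=> iS is_ /diso_sym/biproduct_daddP[[a [b [a' [b' h]]]]].
have [[ha hb ha' hb'] [aa _ _ _] _] := h.
have [i lti [c [f [c' [f' [v [h2 hv ev]]]]]]] : exists2 i, (i < size s)%N & exists c e c' e' v,
    [/\ @biproduct_maps _ _ (dsum s) (nth (dzero k n) s i) (dsum (take i s ++ drop i.+1 s)) c e c' e',
        dhom S S v & a' *m c *m (c' *m a) *m v = 1%:M].
  by apply: (@exchange_unit _ _ a a' 1%:M) => //; rewrite ?aa ?mulmx1 //; apply: dhom1.
exists i => //; have [[hc hf hc' hf'] _ _] := h2.
have iN : dindec d q (nth (dzero k n) s i) by apply: Forall_nth.
have hw : dhom (nth (dzero k n) s i) S (v *m (a' *m c)) by do 2?apply: dhomM.
have hp := dhomM hc' ha.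
have wu : v *m (a' *m c) *m (c' *m a) = 1%:M.
  by rewrite -mulmxA; apply: mulmx1C.
(* Since N -> S -> N is idempotent and N is indecomposable, it is 0 or 1. It is not 0, because S ->
   N -> S is the identity and S is nonzero. *)
have [E0|uw] : c' *m a *m (v *m (a' *m c)) = 0 \/ c' *m a *m (v *m (a' *m c)) = 1%:M.
  apply: (dindec_idempotent iN); first exact: dhomM.
  by rewrite mulmxA -(mulmxA (c' *m a)) wu mulmx1.
- have [_ S0 _] := iS; case/eqP: (mulmx_nonzero_dim S0 (mulmx1 1%:M)).
  rewrite -[1%:M]mulmx1 -{1}wu -wu -mulmxA (mulmxA (c' *m a)) E0 mul0mx mulmx0 //.
split; last exact: complement_unique h h2 hw uw wu.
by exists (c' *m a), (v *m (a' *m c)).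
Qed.

Lemma dproj_iso P M : diso P M -> dproj d q P -> dproj d q M.
Proof.
move=> i [dP lP]; split; first exact: diso_dmod i dP.
case: i => f [g [hf hg fg gf]] A B p r dA dB hp sp hr.
have [h hh e] := lP A B p (r *m f) dA dB hp sp (dhomM hr hf).
by exists (h *m g); [apply: dhomM|rewrite mulmxA e -mulmxA fg mulmx1].
Qed.

Lemma dproj_summand P M (a : 'M_(ddim P, ddim M)) (a' : 'M_(ddim M, ddim P)) :
  dproj d q P -> dhom M P a -> dhom P M a' -> a' *m a = 1%:M -> dproj d q M.
Proof.
move=> [dP lP] ha ha' aa; split; first exact: left_inv_dmod dP ha aa.
move=> A B p r dA dB hp sp hr.
have [h hh e] := lP A B p (r *m a') dA dB hp sp (dhomM hr ha').
by exists (h *m a); [apply: dhomM|rewrite mulmxA e -mulmxA aa mulmx1].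
Qed.

Lemma dproj_dadd A B : dproj d q A -> dproj d q B -> dproj d q (dadd A B).
Proof.
move=> [dA lA] [dB lB]; split; first exact: dadd_dmod.
move=> M N p r dM dN hp sp hr.
have [h hh e] := lA M N p (r *m inl_mx A B) dM dN hp sp (dhomM hr (dhom_inl A B)).
have [h' hh' e'] := lB M N p (r *m inr_mx A B) dM dN hp sp (dhomM hr (dhom_inr A B)).
exists (h *m prl_mx A B + h' *m prr_mx A B).
  by apply: dhomD; apply: dhomM => //; [apply: dhom_prl|apply: dhom_prr].
by rewrite mulmxDr !mulmxA e e' -!(mulmxA r) -mulmxDr dadd_id mulmx1.
Qed.

Lemma dproj_daddl A B : dproj d q (dadd A B) -> dproj d q A.
Proof. move=> h; exact: dproj_summand h (dhom_inl A B) (dhom_prl A B) (prl_inl A B). Qed.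

Lemma dproj_daddr A B : dproj d q (dadd A B) -> dproj d q B.
Proof. move=> h; exact: dproj_summand h (dhom_inr A B) (dhom_prr A B) (prr_inr A B). Qed.

Lemma dproj_dzero : dproj d q (dzero k n).
Proof.
split=> [|M N p r dM dN hp sp hr]; first exact: dzero_dmod.
by exists 0; [apply: dhom0|apply/matrixP=> i []].
Qed.

Lemma dproj_dsum s : List.Forall (dproj d q) s -> dproj d q (dsum s).
Proof. by elim=> [|A t pA _ pt]; [apply: dproj_dzero|apply: dproj_dadd]. Qed.

(** A non-projective S exchanges with a term of [s'], never with one of [t'], as projectivity is
    invariant under isomorphism. When [s] is exhausted, a remaining term of [s'] would be a summand
    of a projective. *)
Lemma krull_schmidt_core s t s' t' :
  List.Forall (fun S => dindec d q S /\ ~ dproj d q S) s ->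
  List.Forall (fun S => dindec d q S /\ dproj d q S) t ->
  List.Forall (fun S => dindec d q S /\ ~ dproj d q S) s' ->
  List.Forall (fun S => dindec d q S /\ dproj d q S) t' ->
  diso (dsum (s ++ t)) (dsum (s' ++ t')) -> diso (dsum s) (dsum s').
Proof.
move=> hs ht hs' ht'; have impl := List.Forall_impl.
elim: hs s' hs' => {s} [|S s [iS npS] hs IH] s' hs' /= i.
  case: hs' i => [|S' s1 [_ np] _]; first by move=> _; apply: diso_refl.
  move=> /= i; case: np; apply: dproj_daddl (dproj_iso i _).
  by apply: dproj_dsum; apply: impl ht => ? [].
have it : List.Forall (dindec d q) (s' ++ t').
  by apply/Forall_cat; split; [apply: impl hs' => ? []|apply: impl ht' => ? []].
have [j ltj [iS' ir]] := exchange iS it i.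
have ltj' : (j < size s')%N.
  rewrite ltnNge; apply/negP=> le; apply: npS; apply: dproj_iso (diso_sym iS') _.
  rewrite nth_cat ltnNge le /=; move: ltj; rewrite size_cat -ltn_subLR // => ltj.
  by have [] := Forall_nth (dzero k n) ht' ltj.
apply: diso_trans _ (diso_sym (dsum_nth_rem (dzero k n) ltj')).
apply: diso_dadd; first by rewrite nth_cat ltj' in iS'.
apply: IH; first exact: Forall_rem.
move: ir; rewrite take_cat drop_cat ltj' -catA; case: ltnP => // le.
have -> : j.+1 = size s' by apply/eqP; rewrite eqn_leq le ltj'.
by rewrite subnn drop0 drop_size.
Qed.

(** If S exchanges with the first term, the remainders agree at once. If it exchanges with another
    term, that term is isomorphic to S, and trading the two gives the same conclusion. *)
Lemma krull_schmidt_cancel S R s : dindec d q S -> List.Forall (dindec d q) s ->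
  diso (dadd S R) (dadd S (dsum s)) -> diso R (dsum s).
Proof.
move=> iS is_ i.
have [[|j] /= ltj [iS' ir]] := exchange iS (List.Forall_cons S iS is_) i.
  by rewrite drop0 in ir.
apply: diso_trans ir _; apply: diso_trans (diso_daddl _ iS') _.
exact: diso_sym (dsum_nth_rem (dzero k n) ltj).
Qed.

Lemma dindec_decomposition M : is_dmod d q M ->
  exists2 s, List.Forall (dindec d q) s & diso M (dsum s).
Proof.
have [m le] := ubnP (ddim M); elim: m M le => // m IH M le dM.
have [M0|M0] := posnP (ddim M); first by exists [::] => //; apply: ddim0_iso.
case: (excluded_middle_informative (dindec d q M)) => [iM|niM].
  by exists [:: M]; [constructor|apply: diso_sym (daddd0 _)].
have [A [B [dA dB iAB [A0 B0]]]] : exists A B, [/\ is_dmod d q A, is_dmod d q B,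
    diso M (dadd A B) & (0 < ddim A)%N /\ (0 < ddim B)%N].
  apply: NNPP => nh; case: niM; split=> // A B dA dB iAB.
  have [|A0] := posnP (ddim A); first by left.
  have [|B0] := posnP (ddim B); first by right.
  by case: nh; exists A, B.
have dimM : ddim M = (ddim A + ddim B)%N by rewrite (diso_dim iAB).
have [|s hs is1] := IH A _ dA; first by lia.
have [|t ht it1] := IH B _ dB; first by lia.
exists (s ++ t); first by apply/Forall_cat.
apply: diso_trans iAB _; apply: diso_trans (diso_dadd is1 it1) _.
exact: diso_sym (dsum_cat _ _).
Qed.

Lemma core_exists M : is_dmod d q M -> exists K, is_core d q M K.
Proof.
case/dindec_decomposition => r hr ir.
have [s [t [hs ht i]]] : exists s t, [/\ List.Forall (fun S => dindec d q S /\ ~ dproj d q S) s,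
    List.Forall (fun S => dindec d q S /\ dproj d q S) t & diso (dsum r) (dsum (s ++ t))].
  elim: hr {ir} => [|A r' iA _ [s [t [hs ht i]]]]; first by exists [::], [::]; split=> //; apply: diso_refl.
  case: (excluded_middle_informative (dproj d q A)) => pA.
    exists s, (A :: t); split=> //; first by constructor.
    apply: diso_trans (diso_daddr _ i) _; apply: diso_sym; apply: diso_trans (dsum_cat _ _) _.
    apply: diso_trans (daddCA _ _ _) _; apply: diso_daddr; apply: diso_sym; exact: dsum_cat.
  by exists (A :: s), t; split=> //=; [constructor|apply: diso_daddr].
by exists (dsum s), s, t; split=> //; [apply: diso_trans ir i|apply: diso_refl].
Qed.

Lemma coreP M : is_dmod d q M -> is_core d q M (core d q M).
Proof. by move=> /core_exists; apply: epsilon_spec. Qed.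

Definition stable M N := exists P Q,
  [/\ dproj d q P, dproj d q Q & diso (dadd M P) (dadd N Q)].

Lemma diso_stable M N : diso M N -> stable M N.
Proof.
by exists (dzero k n), (dzero k n); split; try exact: dproj_dzero; apply: diso_daddl.
Qed.

Lemma stable_refl M : stable M M.
Proof. exact/diso_stable/diso_refl. Qed.

Lemma stable_sym M N : stable M N -> stable N M.
Proof. by case=> P [Q [pP pQ i]]; exists Q, P; split=> //; apply: diso_sym. Qed.

Lemma stable_trans N M R : stable M N -> stable N R -> stable M R.
Proof.
case=> P [Q [pP pQ i]] [P' [Q' [pP' pQ' i']]].
exists (dadd P P'), (dadd Q' Q); split; try exact: dproj_dadd.
apply: diso_trans (daddA _ _ _) _; apply: diso_trans (diso_daddl _ i) _.
apply: diso_trans (diso_sym (daddA _ _ _)) _; apply: diso_trans (diso_daddr _ (daddC _ _)) _.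
apply: diso_trans (daddA _ _ _) _; apply: diso_trans (diso_daddl _ i') _.
exact: diso_sym (daddA _ _ _).
Qed.

Lemma stable_dadd A A' B B' : stable A A' -> stable B B' -> stable (dadd A B) (dadd A' B').
Proof.
case=> P [Q [pP pQ i]] [P' [Q' [pP' pQ' i']]].
exists (dadd P P'), (dadd Q Q'); split; try exact: dproj_dadd.
apply: diso_trans (daddACA _ _ _ _) _; apply: diso_trans (diso_dadd i i') _.
exact: daddACA.
Qed.

Lemma stable_daddr_proj M P : dproj d q P -> stable (dadd M P) M.
Proof.
move=> pP; exists (dzero k n), P; split=> //; first exact: dproj_dzero.
exact: daddd0.
Qed.

Lemma core_stable M K : is_core d q M K -> stable M K.
Proof.
case=> s [t [hs ht iM iK]]; apply: (stable_trans (diso_stable iM)).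
apply: (stable_trans (diso_stable (dsum_cat _ _))).
apply: stable_trans (diso_stable (diso_sym iK)); apply: stable_daddr_proj.
by apply: dproj_dsum; apply: List.Forall_impl ht => ? [].
Qed.

Lemma core_dmod M K : is_core d q M K -> is_dmod d q K.
Proof.
case=> s [t [hs ht iM iK]]; apply: diso_dmod (diso_sym iK) _; apply: dsum_dmod.
by apply: List.Forall_impl hs => ? [[]].
Qed.

Lemma dproj_decomposition P : dproj d q P ->
  exists2 t, List.Forall (fun S => dindec d q S /\ dproj d q S) t & diso P (dsum t).
Proof.
move=> pP; have [t ht i] := dindec_decomposition pP.1; exists t => //.
have {pP i} := dproj_iso i pP.
elim: ht => [|A s iA hs IH] //= pP; constructor; first by split=> //; apply: dproj_daddl pP.
exact: IH (dproj_daddr pP).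
Qed.

(** This is how isomorphisms between cores are obtained below: a stable isomorphism is enough, the
    added projectives being absorbed into the projective parts of the decompositions. *)
Lemma stable_core M N K K' : stable M N -> is_core d q M K -> is_core d q N K' -> diso K K'.
Proof.
case=> P [Q [pP pQ i]] [s [t [hs ht iM iK]]] [s' [t' [hs' ht' iM' iK']]].
have [r hr ir] := dproj_decomposition pP; have [r' hr' ir'] := dproj_decomposition pQ.
apply: diso_trans iK _; apply: diso_trans _ (diso_sym iK').
apply: (@krull_schmidt_core s (t ++ r) s' (t' ++ r')) => //; try by apply/Forall_cat.
rewrite !catA; apply: diso_trans (dsum_cat _ _) _.
apply: diso_trans (diso_dadd (diso_sym iM) (diso_sym ir)) _.
apply: diso_trans i _; apply: diso_trans (diso_dadd iM' ir') _.
exact: diso_sym (dsum_cat _ _).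
Qed.

Lemma core_dadd A B K K' : is_core d q A K -> is_core d q B K' -> is_core d q (dadd A B) (dadd K K').
Proof.
case=> [s [t [hs ht iM iK]]] [s' [t' [hs' ht' iM' iK']]].
exists (s ++ s'), (t ++ t'); split; try by apply/Forall_cat.
  apply: diso_trans (diso_dadd iM iM') _.
  apply: diso_trans (diso_dadd (dsum_cat _ _) (dsum_cat _ _)) _.
  apply: diso_trans (daddACA _ _ _ _) _; apply: diso_sym; apply: diso_trans (dsum_cat _ _) _.
  by apply: diso_dadd; apply: dsum_cat.
apply: diso_trans (diso_dadd iK iK') _; exact: diso_sym (dsum_cat _ _).
Qed.

(** Decompose A and cancel its indecomposable summands one by one. *)
Lemma dadd_cancel A B C : is_dmod d q A -> is_dmod d q C ->
  diso (dadd A B) (dadd A C) -> diso B C.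
Proof.
move=> dA dC; have [s hs is_] := dindec_decomposition dA.
have [t ht it] := dindec_decomposition dC => i.
apply: diso_trans _ (diso_sym it).
have {i} : diso (dadd (dsum s) B) (dadd (dsum s) (dsum t)).
  apply: diso_trans (diso_daddl _ (diso_sym is_)) _; apply: diso_trans i _.
  exact: diso_dadd.
elim: hs {is_} => [|S s' iS hs' IH] /= i.
  by apply: diso_trans (diso_sym (dadd0d _)) _; apply: diso_trans i _; apply: dadd0d.
apply: IH; apply: diso_trans _ (dsum_cat _ _).
apply: (krull_schmidt_cancel iS); first by apply/Forall_cat.
apply: diso_trans (daddA _ _ _) _; apply: diso_trans i _.
apply: diso_trans (diso_sym (daddA _ _ _)) _; apply: diso_daddr.
exact: diso_sym (dsum_cat _ _).
Qed.

Lemma stable_cancel A B C : is_dmod d q A -> is_dmod d q C ->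
  stable (dadd A B) (dadd A C) -> stable B C.
Proof.
move=> dA dC [P [Q [pP pQ i]]]; exists P, Q; split=> //.
apply: (dadd_cancel dA); first exact: dadd_dmod dC pQ.1.
apply: diso_trans (daddA _ _ _) _; apply: diso_trans i _.
exact: diso_sym (daddA _ _ _).
Qed.

End KrullSchmidt.

(** * Bilinearity of the Kronecker product *)

Section TensorMatrices.
Variable R : comPzRingType.

Lemma tensmxDl m p r s (A B : 'M[R]_(m, p)) (C : 'M[R]_(r, s)) :
  (A + B) *t C = A *t C + B *t C.
Proof. by apply/matrixP=> i j; rewrite !mxE mulrDl. Qed.

Lemma tensmxDr m p r s (A : 'M[R]_(m, p)) (B C : 'M[R]_(r, s)) :
  A *t (B + C) = A *t B + A *t C.
Proof. by apply/matrixP=> i j; rewrite !mxE mulrDr. Qed.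

Lemma tensmxZl m p r s a (A : 'M[R]_(m, p)) (C : 'M[R]_(r, s)) :
  (a *: A) *t C = a *: (A *t C).
Proof. by apply/matrixP=> i j; rewrite !mxE mulrA. Qed.

Lemma tensmxZr m p r s a (A : 'M[R]_(m, p)) (C : 'M[R]_(r, s)) :
  A *t (a *: C) = a *: (A *t C).
Proof. by apply/matrixP=> i j; rewrite !mxE mulrCA. Qed.

Lemma tensmxNl m p r s (A : 'M[R]_(m, p)) (C : 'M[R]_(r, s)) :
  (- A) *t C = - (A *t C).
Proof. by rewrite -scaleN1r tensmxZl scaleN1r. Qed.

Lemma tensmxNr m p r s (A : 'M[R]_(m, p)) (C : 'M[R]_(r, s)) :
  A *t (- C) = - (A *t C).
Proof. by rewrite -scaleN1r tensmxZr scaleN1r. Qed.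

Lemma tensmx_suml m p r s I (t : seq I) (P : pred I) (F : I -> 'M[R]_(m, p)) (C : 'M[R]_(r, s)) :
  (\sum_(i <- t | P i) F i) *t C = \sum_(i <- t | P i) F i *t C.
Proof.
by elim/big_rec2: _ => [|i A B _ <-]; rewrite ?tens0mx ?tensmxDl.
Qed.

Lemma tensmx_sumr m p r s I (t : seq I) (P : pred I) (F : I -> 'M[R]_(m, p)) (C : 'M[R]_(r, s)) :
  C *t (\sum_(i <- t | P i) F i) = \sum_(i <- t | P i) C *t F i.
Proof.
by elim/big_rec2: _ => [|i A B _ <-]; rewrite ?tensmx0 ?tensmxDr.
Qed.

Lemma tensmx11 m p : (1%:M : 'M[R]_m) *t (1%:M : 'M[R]_p) = 1%:M.
Proof.
apply/matrixP=> i j; case: (mxtens_indexP i) => a b; case: (mxtens_indexP j) => c e.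
rewrite tensmxE !mxE -natrM mulnb; congr (_%:R); rewrite (inj_eq (can_inj (@mxtens_indexK _ _))).
by rewrite xpair_eqE.
Qed.

Lemma tensmxX m p (A : 'M[R]_m) (B : 'M[R]_p) r : (A *t B) ^+ r = A ^+ r *t B ^+ r.
Proof.
elim: r => [|r IH]; first by rewrite !expr0 -[1]/1%:M tensmx11.
by rewrite !exprS IH -mulmxE tensmx_mul.
Qed.

End TensorMatrices.

(** * Gaussian binomials and nilpotent q-commuting matrices *)

Section GaussianBinomials.
Variables (k : fieldType) (q : k).

(** The Gaussian binomial coefficient at q, by the q-Pascal rule, which involves no division and so
    makes sense at roots of unity. *)
Fixpoint qbin (m j : nat) : k :=
  match m, j with
  | _, 0 => 1
  | 0, j'.+1 => 0
  | m'.+1, j'.+1 => qbin m' j' + q ^+ j'.+1 * qbin m' j'.+1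
  end.

Lemma qbinn0 m : qbin m 0 = 1. Proof. by case: m. Qed.

Lemma qbin_small m j : (m < j)%N -> qbin m j = 0.
Proof.
elim: m j => [|m IH] [|j] //= lt; rewrite !IH ?mulr0 ?addr0 //.
exact: leqW.
Qed.

Lemma qbin_absorb m j : (1 - q ^+ j.+1) * qbin m.+1 j.+1 = (1 - q ^+ m.+1) * qbin m j.
Proof.
elim: m j => [|m IH] [|j] /=.
- by rewrite mulr0 addr0.
- by rewrite mulr0 addr0 !mulr0.
- by have := IH 0%N; rewrite /= !qbinn0 => e; rewrite mulrDr mulrCA e !exprS; ring.
have e1 := IH j; have e2 := IH j.+1.
rewrite -[qbin m j + _]/(qbin m.+1 j.+1) -[qbin m j.+1 + _]/(qbin m.+1 j.+2).
rewrite mulrDr mulrCA e2.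
apply/eqP; rewrite -subr_eq0; apply/eqP.
(* What remains is q times the absorption identity for the preceding index [j]. *)
transitivity (q * ((1 - q ^+ j.+1) * qbin m.+1 j.+1 - (1 - q ^+ m.+1) * qbin m j)).
  by rewrite /= !exprS; ring.
by rewrite e1 subrr mulr0.
Qed.

(** Absorption with upper index d has the factor 1 - q^d = 0 on one side and a nonzero factor 1 -
    q^j on the other. *)
Lemma qbin_prim d j : d.-primitive_root q -> (0 < j < d)%N -> qbin d j = 0.
Proof.
move=> qp /andP[]; case: j => // j _ ltj; case: d qp ltj => // d qp ltj.
have := qbin_absorb d j; rewrite (prim_expr_order qp) subrr mul0r => /eqP.
rewrite mulf_eq0 => /orP[|/eqP //]; rewrite subr_eq0 eq_sym.
by rewrite -(prim_order_dvd qp) gtnNdvd.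
Qed.

Lemma qbinomial m (x y : 'M[k]_m) r : y *m x = q *: (x *m y) ->
  (x + y) ^+ r = \sum_(j < r.+1) qbin r j *: (x ^+ j *m y ^+ (r - j)).
Proof.
move=> yx; have yxj j : y *m x ^+ j = q ^+ j *: (x ^+ j *m y).
  elim: j => [|j IH]; first by rewrite !expr0 scale1r -[1]/1%:M mulmx1 mul1mx.
  rewrite exprSr -mulmxE mulmxA IH -scalemxAl -mulmxA yx -scalemxAr scalerA -exprSr mulmxA.
  by rewrite exprSr.
elim: r => [|r IH]; first by rewrite big_ord1 /= scale1r !expr0 -[1]/1%:M mulmx1.
rewrite exprS IH mulrDl !mulr_sumr [in RHS]big_ord_recl /= big_ord_recr /= addrC.
rewrite big_ord_recl /= qbinn0 !scale1r subn0 !expr0 -![1]/1%:M -!mulmxE !mul1mx -[y *m y ^+ r]/(y * y ^+ r) -exprS.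
rewrite subn0 addrCA; congr (_ + _).
rewrite [in RHS]big_ord_recr /= [qbin r (0 + r).+1]qbin_small ?ltnS // mulr0 addr0.
rewrite -addrA -big_split addrC /=.
congr (_ + _); last by rewrite /bump /= add0n add1n !subnn -!scalemxAr mulmxA mulmxE -exprS.
apply: eq_bigr => j _; rewrite /bump /= add1n add0n.
rewrite subSS -!scalemxAr !mulmxA yxj -scalemxAl scalerA [RHS]scalerDl.
rewrite -[x *m x ^+ j]/(x * x ^+ j) -exprS; congr (_ + _).
by rewrite -[x ^+ _ *m y *m _]mulmxA mulmxE -exprS subnSK // mulrC.
Qed.

(** All middle terms of the q-binomial expansion vanish. Applied to the two terms of the coproducts
    of A and X, this shows that their d-th powers act by zero on tensor products. *)
Lemma q_commuting_nilpotent d m (x y : 'M[k]_m) : d.-primitive_root q ->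
  y *m x = q *: (x *m y) -> x ^+ d = 0 -> y ^+ d = 0 -> (x + y) ^+ d = 0.
Proof.
move=> qp yx xd yd; rewrite (qbinomial _ yx) big1 // => - [j] /=; rewrite ltnS leq_eqVlt.
case/orP=> [/eqP ->|lt _]; first by rewrite xd mul0mx scaler0.
case: j lt => [|j] lt; first by rewrite subn0 yd mulmx0 scaler0.
by rewrite (qbin_prim qp) ?scale0r.
Qed.

End GaussianBinomials.

(** * Presentation of D by the e_i, the sum A of the a_i, G and X *)

Section TotalForm.
Variables (k : fieldType) (n d : nat) (q : k).
Hypotheses (n_gt0 : (0 < n)%N) (d_dvd_n : (d %| n)%N) (q_prim : d.-primitive_root q).
Implicit Types M N P : dmod k n.

Lemma q_neq0 : q != 0.
Proof.
apply/eqP=> q0; have := prim_expr_order q_prim; rewrite q0 expr0n => /eqP.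
by rewrite -[d == 0]negbK -lt0n (prim_order_gt0 q_prim) /= eq_sym oner_eq0.
Qed.

Lemma q_exp_mod m : q ^+ (m %% n.-1.+1) = q ^+ m.
Proof. by rewrite prednK //; apply: expr_mod; apply/eqP; rewrite -(prim_order_dvd q_prim). Qed.

Lemma q_exp_inZp m : q ^+ (inZp m : Zmod n) = q ^+ m.
Proof. exact: q_exp_mod. Qed.

Lemma q_expD (i j : Zmod n) : q ^+ (i + j : Zmod n)%R = q ^+ i * q ^+ j.
Proof. by rewrite /= q_exp_mod exprD. Qed.

Lemma q_expS (i : Zmod n) : q ^+ (i + Zp1)%R = q ^+ i.+1.
Proof. by rewrite q_expD -[X in _ * X]/(q ^+ (1 %% n.-1.+1)) q_exp_mod -exprD addn1. Qed.

Lemma q_exp_neq0 m : q ^+ m != 0.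
Proof. by rewrite expf_neq0 // q_neq0. Qed.

Lemma q_exp0 : q ^+ (0%R : Zmod n) = 1.
Proof. by []. Qed.

(** The element K, a second group-like element beside G: compare [dtens_weight]. The parameter [q]
    is kept free because the same sum with q^-1 is the inverse of K. *)
Definition weight_mx m (E : Zmod n -> 'M[k]_m) : 'M[k]_m := \sum_(i : Zmod n) q ^+ i *: E i.

(* The relations of D in terms of [A], the sum of the [a_i]. *)
Record total_relations m (E : Zmod n -> 'M[k]_m) (A G X : 'M[k]_m) : Prop := TotalRelations {
  totEE : forall i j, E i *m E j = (i == j)%:R *: E i;
  totE1 : \sum_i E i = 1%:M;
  totAE : forall i, A *m E i = E (i + Zp1) *m A;
  totAd : A ^+ d = 0;
  totGn : G ^+ n = 1%:M;
  totXd : X ^+ d = 0;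
  totGX : G *m X = q^-1 *: (X *m G);
  totGE : forall i, G *m E i = E i *m G;
  totGA : G *m A = q *: (A *m G);
  totEX : forall i, E i *m X = X *m E (i + Zp1);
  totXA : X *m A = q *: (A *m X) + 1%:M - G *m weight_mx E }.

Lemma weight_mxE m (E : Zmod n -> 'M[k]_m) i : (forall i j, E i *m E j = (i == j)%:R *: E i) ->
  weight_mx E *m E i = q ^+ i *: E i.
Proof.
move=> EE; rewrite mulmx_suml (bigD1 i) //= -scalemxAl EE eqxx scale1r big1 ?addr0 // => j ji.
by rewrite -scalemxAl EE (negPf ji) scale0r scaler0.
Qed.

Lemma E_decompositionr m p (E : Zmod n -> 'M[k]_m) (Y Z : 'M[k]_(p, m)) : \sum_i E i = 1%:M ->
  (forall i, Y *m E i = Z *m E i) -> Y = Z.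
Proof. by move=> E1 h; rewrite -[Y]mulmx1 -[Z]mulmx1 -E1 !mulmx_sumr; apply: eq_bigr. Qed.

Lemma total_dmod M (A : 'M_(ddim M)) : (forall i, actA M i = A *m actE M i) ->
  total_relations (actE M) A (actG M) (actX M) -> is_dmod d q M.
Proof.
move=> AE [EE E1 cAE Ad Gn Xd GX GE GA EX XA].
have AEm i j : A ^+ j *m actE M i = actE M (i + inZp j) *m A ^+ j.
  elim: j => [|j IH].
    rewrite expr0 -[1]/1%:M mulmx1 mul1mx; congr actE.
    by rewrite -[i in LHS]addr0; congr (_ + _); apply: val_inj; rewrite /= mod0n.
  rewrite exprS -!mulmxE -mulmxA IH !mulmxA cAE; congr (actE _ _ *m _ *m _).
  by rewrite -addrA; congr (_ + _); apply: val_inj; rewrite /= modnDm addn1.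
(* Only from length 1 on: the empty product [gamma M i 0] is 1 and not e_i. *)
have gam i m : gamma M i m.+1 = A ^+ m.+1 *m actE M i.
  elim: m => [|m IH].
    rewrite /= mulr1 expr1 AE; congr (_ *m actE _ _).
    by rewrite -[i in RHS]addr0; congr (_ + _); apply: val_inj; rewrite /= mod0n.
  rewrite -[LHS]/(actA M (i + inZp m.+1) * gamma M i m.+1) IH AE -mulmxE AEm mulmxA -(mulmxA A) EE eqxx scale1r -mulmxA -AEm mulmxA.
  by rewrite [in RHS]exprS mulmxE.
have AEs i : actE M (i + Zp1) *m A *m actE M i = A *m actE M i.
  by rewrite -cAE -mulmxA EE eqxx scale1r.
split=> [i j||i|i||||i|i|i|i]; rewrite -?mulmxE.
- exact: EE.
- exact: E1.
- by rewrite AE !mulmxA AEs -mulmxA EE eqxx scale1r.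
- by case: d q_prim Ad gam => [/prim_order_gt0//|d' _ Ad gam]; rewrite gam Ad mul0mx.
- exact: Gn.
- exact: Xd.
- exact: GX.
- exact: GE.
- rewrite AE -mulmxA -GE !mulmxA GA -scalemxAl scalerA mulVf ?q_neq0 // scale1r //.
- exact: EX.
rewrite !AE -mulmxA EX !mulmxA XA mulmxBl mulmxDl -scalemxAl mul1mx -(mulmxA (actG M)) weight_mxE //.
rewrite -scalemxAr q_expS addrAC subrK addrK scalerA mulVf ?q_neq0 // scale1r //.
Qed.

Definition total_A M : 'M_(ddim M) := \sum_(i : Zmod n) actA M i.

Lemma dmod_actA M : is_dmod d q M -> forall i, actA M i = total_A M *m actE M i.
Proof.
move=> dM i.
have AEE j : actA M j *m actE M i = (j == i)%:R *: actA M j.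
  rewrite (relA dM) -!mulmxE -mulmxA [actE M j *m actE M i](relEE dM).
  by rewrite scalemxAr; case: eqP => [->|]; rewrite ?scale1r ?scale0r ?mulmx0.
rewrite /total_A mulmx_suml (bigD1 i) //= big1 => [|j ji]; rewrite AEE.
  by rewrite eqxx scale1r addr0.
by rewrite (negPf ji) scale0r.
Qed.

Lemma Zmod_reindexS (V : zmodType) (F : Zmod n -> V) : \sum_i F i = \sum_i F (i + Zp1).
Proof.
by rewrite (reindex_inj (addIr Zp1)).
Qed.

Lemma dmod_total M : is_dmod d q M -> total_relations (actE M) (total_A M) (actG M) (actX M).
Proof.
move=> dM; have EE i j : actE M i *m actE M j = (i == j)%:R *: actE M i := relEE dM i j.
have E1 : \sum_i actE M i = 1%:M := relE1 dM.
have AE := dmod_actA dM.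
have cAE i : total_A M *m actE M i = actE M (i + Zp1) *m total_A M.
  rewrite -AE /total_A mulmx_sumr (bigD1 i) //= big1 => [|j ji].
    by rewrite addr0 (relA dM) -!mulmxE !mulmxA EE eqxx scale1r.
  by rewrite (relA dM) -!mulmxE !mulmxA EE (inj_eq (addIr _)) eq_sym (negPf ji) scale0r !mul0mx.
have AEm i j : total_A M ^+ j *m actE M i = actE M (i + inZp j) *m total_A M ^+ j.
  elim: j => [|j IH].
    rewrite expr0 -[1]/1%:M mulmx1 mul1mx; congr actE.
    by rewrite -[i in LHS]addr0; congr (_ + _); apply: val_inj; rewrite /= mod0n.
  rewrite exprS -!mulmxE -mulmxA IH !mulmxA cAE; congr (actE _ _ *m _ *m _).
  by rewrite -addrA; congr (_ + _); apply: val_inj; rewrite /= modnDm addn1.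
have gam i m : gamma M i m *m actE M i = total_A M ^+ m *m actE M i.
  elim: m => [|m IH] //=; rewrite exprS -!mulmxE -!mulmxA IH AEm !mulmxA AE.
  by rewrite -(mulmxA (total_A M)) EE eqxx scale1r.
split=> // [||||i||i|].
- by apply: (E_decompositionr E1) => i; rewrite -gam (relAd dM) !mul0mx.
- exact: relGn dM.
- exact: relXd dM.
- exact: relGX dM.
- exact: (relGE dM i).
- rewrite /total_A mulmx_sumr mulmx_suml scaler_sumr; apply: eq_bigr => i _.
  by rewrite [actA M i *m _](relAG dM) scalerA divff ?q_neq0 // scale1r.
- exact: (relEX dM i).
(* Sum the relations for a_i X over i and shift the index on the right by one. *)
have -> : total_A M *m actX M = q^-1 *: (actX M *m total_A M - 1%:M + actG M *m weight_mx (actE M)).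
  rewrite {1}/total_A mulmx_suml.
  under eq_bigr do rewrite [_ *m actX M](relAX dM).
  rewrite -scaler_sumr; congr (_ *: _); rewrite big_split sumrB /= -E1; congr (_ - _ + _).
  - by rewrite -mulr_sumr mulmxE [total_A M]Zmod_reindexS.
  - by rewrite [RHS]Zmod_reindexS.
  rewrite mulmx_sumr [RHS]Zmod_reindexS; apply: eq_bigr => i _.
  by rewrite -scalemxAr q_expS.
rewrite scalerA divff ?q_neq0 // scale1r.
by rewrite addrAC addrK subrK.
Qed.

Lemma dhom_total M N (f : 'M_(ddim N, ddim M)) : is_dmod d q M -> is_dmod d q N ->
  (forall i, f *m actE M i = actE N i *m f) -> f *m total_A M = total_A N *m f ->
  f *m actG M = actG N *m f -> f *m actX M = actX N *m f -> dhom M N f.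
Proof.
move=> dM dN hE hA hG hX; split=> // i.
by rewrite !dmod_actA // mulmxA hA -!mulmxA hE.
Qed.

Lemma dhom_total_A M N (f : 'M_(ddim N, ddim M)) : dhom M N f -> f *m total_A M = total_A N *m f.
Proof. by case=> _ hA _ _; rewrite mulmx_sumr mulmx_suml; apply: eq_bigr. Qed.

Lemma dhom_weight M N (f : 'M_(ddim N, ddim M)) : dhom M N f ->
  f *m weight_mx (actE M) = weight_mx (actE N) *m f.
Proof.
case=> hE _ _ _; rewrite mulmx_sumr mulmx_suml; apply: eq_bigr => i _.
by rewrite -scalemxAr hE scalemxAl.
Qed.

Lemma total_A_unique M (A : 'M_(ddim M)) : \sum_i actE M i = 1%:M ->
  (forall i, actA M i = A *m actE M i) -> total_A M = A.
Proof. by move=> E1 AE; rewrite /total_A (eq_bigr _ (fun i _ => AE i)) -mulmx_sumr E1 mulmx1. Qed.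

Section WeightRelations.
Variables (m : nat) (E : Zmod n -> 'M[k]_m) (A G X : 'M[k]_m).
Hypothesis rel : total_relations E A G X.
Let K := weight_mx E.

Lemma weight_mxC i : K *m E i = E i *m K.
Proof.
rewrite weight_mxE; last exact: totEE rel.
rewrite /K /weight_mx mulmx_sumr (bigD1 i) //= -scalemxAr (totEE rel) eqxx scale1r big1 ?addr0 //.
by move=> j ji; rewrite -scalemxAr (totEE rel) eq_sym (negPf ji) scale0r scaler0.
Qed.

Lemma weight_mxG : K *m G = G *m K.
Proof.
rewrite mulmx_sumr mulmx_suml; apply: eq_bigr => i _.
by rewrite -scalemxAr (totGE rel) scalemxAl.
Qed.

Lemma weight_mxA : K *m A = q *: (A *m K).
Proof.
rewrite mulmx_sumr mulmx_suml scaler_sumr [LHS]Zmod_reindexS; apply: eq_bigr => i _.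
by rewrite -scalemxAr (totAE rel) -scalemxAl q_expS exprS scalerA.
Qed.

Lemma weight_mxX : X *m K = q *: (K *m X).
Proof.
rewrite mulmx_sumr mulmx_suml scaler_sumr [LHS]Zmod_reindexS; apply: eq_bigr => i _.
by rewrite -scalemxAr -(totEX rel) -scalemxAl q_expS exprS scalerA.
Qed.

End WeightRelations.

End TotalForm.

(** * Tensor products: modules, functoriality, additivity, associativity *)

Section TensorProducts.
Variables (k : fieldType) (n d : nat) (q : k).
Hypotheses (n_gt0 : (0 < n)%N) (d_dvd_n : (d %| n)%N) (q_prim : d.-primitive_root q).
Implicit Types M N P A B C : dmod k n.
Let K M := weight_mx q (actE M).
Let tot M (dM : is_dmod d q M) := dmod_total n_gt0 d_dvd_n q_prim dM.

Lemma dtensE M N i : actE (dtens q M N) i = \sum_j actE M j *t actE N (i - j).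
Proof.
rewrite /=; apply: eq_bigr => j _; rewrite (big_pred1 (i - j)) // => l.
by rewrite [RHS]eq_sym subr_eq addrC eq_sym.
Qed.

(** In total form the coproduct of the a_i becomes 1 (x) A + A (x) K. *)
Lemma dtens_totalA M N : is_dmod d q M -> is_dmod d q N -> forall i,
  actA (dtens q M N) i = (1%:M *t total_A N + total_A M *t K N) *m actE (dtens q M N) i.
Proof.
move=> dM dN i /=; rewrite mulmx_sumr; apply: eq_bigr => j _.
rewrite mulmx_sumr; apply: eq_bigr => l _.
have EE := totEE (tot dN).
rewrite mulmxDl !tensmx_mul mul1mx weight_mxE // -(dmod_actA dN) -(dmod_actA dM) tensmxZr.
by [].
Qed.

Lemma dtens_E1 M N : is_dmod d q M -> is_dmod d q N -> \sum_i actE (dtens q M N) i = 1%:M.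
Proof.
move=> dM dN; under eq_bigr do rewrite dtensE; rewrite exchange_big /= -[RHS]tensmx11.
rewrite -(totE1 (tot dM)) -(totE1 (tot dN)) tensmx_suml; apply: eq_bigr => j _.
by rewrite -tensmx_sumr [in RHS](reindex_inj (addIr (- j))).
Qed.

Lemma dtens_EE M N : is_dmod d q M -> is_dmod d q N -> forall i j,
  actE (dtens q M N) i *m actE (dtens q M N) j = (i == j)%:R *: actE (dtens q M N) j.
Proof.
move=> dM dN i j; rewrite !dtensE mulmx_sumr scaler_sumr; apply: eq_bigr => a _.
rewrite mulmx_suml (bigD1 a) //= big1 => [|b ba]; rewrite tensmx_mul.
  rewrite addr0 ?(totEE (tot dM)) ?(totEE (tot dN)) eqxx scale1r.
  by rewrite (inj_eq (addIr _)) tensmxZr; case: eqP => [->|]; rewrite // !scale0r.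
by rewrite (totEE (tot dM)) (negPf ba) scale0r tens0mx.
Qed.

Lemma dtens_weight M N : is_dmod d q M -> is_dmod d q N -> K (dtens q M N) = K M *t K N.
Proof.
move=> dM dN; rewrite /K /weight_mx tensmx_suml.
under eq_bigr do rewrite dtensE scaler_sumr.
rewrite exchange_big; apply: eq_bigr => a _; rewrite tensmxZl tensmx_sumr scaler_sumr.
rewrite (reindex_inj (addIr a)); apply: eq_bigr => b _ /=.
by rewrite addrK tensmxZr scalerA -(q_expD n_gt0 d_dvd_n q_prim) addrC.
Qed.

(** The coproduct respects the relations. Nilpotency of A and X follows from the q-binomial theorem,
    and the degree relations by reindexing the sums over pairs of degrees. *)
Lemma dtens_dmod M N : is_dmod d q M -> is_dmod d q N -> is_dmod d q (dtens q M N).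
Proof.
move=> dM dN; apply: (total_dmod n_gt0 d_dvd_n q_prim (dtens_totalA dM dN)).
have tM := tot dM; have tN := tot dN.
have q0 := q_neq0 q_prim.
have KA := weight_mxA n_gt0 d_dvd_n q_prim tN; have XK := weight_mxX n_gt0 d_dvd_n q_prim tN.
have KG := weight_mxG tN; have KC := weight_mxC tN.
rewrite -/(K N) in KA XK KG KC.
split.
- move=> i j; rewrite dtens_EE //.
  by case: eqP => [->|]; rewrite // !scale0r.
- exact: dtens_E1.
- move=> i; rewrite !dtensE /= mulmxDl mulmxDr !mulmx_suml !mulmx_sumr.
  congr (_ + _).
    apply: eq_bigr => j _.
    by rewrite !tensmx_mul mul1mx mulmx1 (totAE tN) addrAC.
  rewrite [RHS](Zmod_reindexS); apply: eq_bigr => j _.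
  rewrite !tensmx_mul (totAE tM) KC; congr (_ *t (actE N _ *m _)).
  by rewrite opprD addrACA subrr addr0.
- apply: (q_commuting_nilpotent q_prim); rewrite ?tensmxX ?(totAd tM) ?(totAd tN) ?tensmx0 ?tens0mx //.
  by rewrite !tensmx_mul mul1mx mulmx1 KA tensmxZr.
- by rewrite /= tensmxX (totGn tM) (totGn tN) tensmx11.
- rewrite /=; apply: (q_commuting_nilpotent q_prim); rewrite ?tensmxX ?(totXd tM) ?(totXd tN) ?tensmx0 ?tens0mx //.
  by rewrite !tensmx_mul mul1mx mulmx1 (totGX tN) tensmxZr scalerA divff // scale1r.
- rewrite /= mulmxDl mulmxDr !tensmx_mul (totGX tM) (totGX tN) mul1mx mulmx1.
  by rewrite tensmxZl tensmxZr -scalerDr.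
- move=> i; rewrite !dtensE /= mulmx_suml mulmx_sumr; apply: eq_bigr => j _.
  by rewrite !tensmx_mul (totGE tM) (totGE tN).
- rewrite /= mulmxDl mulmxDr !tensmx_mul (totGA tM) (totGA tN) mul1mx mulmx1 KG.
  by rewrite tensmxZl tensmxZr -scalerDr.
- move=> i; rewrite !dtensE /= mulmxDl mulmxDr !mulmx_suml !mulmx_sumr.
  congr (_ + _); last first.
    apply: eq_bigr => j _.
    by rewrite !tensmx_mul mul1mx mulmx1 (totEX tN) addrAC.
  rewrite [RHS](Zmod_reindexS); apply: eq_bigr => j _.
  rewrite !tensmx_mul (totEX tM) (totGE tN); congr (_ *t (actE N _ *m _)).
  by rewrite opprD addrACA subrr addr0.
(* In XA - qAX the cross terms X (x) GA and A (x) XK cancel by GA = qAG and XK = qKX. What is left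
   is (1 - GK) (x) GK + 1 (x) (1 - GK) = 1 - GK (x) GK. *)
rewrite -/(K (dtens q M N)) dtens_weight //= !(mulmxDl, mulmxDr) !tensmx_mul !mul1mx !mulmx1.
rewrite (totXA tM) (totXA tN) (totGA tN) XK KG !(tensmxDl, tensmxDr, tensmxNl, tensmxNr, tensmxZl, tensmxZr).
rewrite tensmx11 -/(K M) -/(K N) !scalerDr.
set a := q *: (actX M *t _); set b := q *: (_ *t (K N *m _)).
set c := q *: (_ *t (actG N *m K N)); set e := q *: (1%:M *t _).
set u := 1%:M *t (actG N *m K N); set v := _ *t (actG N *m K N); clearbody a b c e u v.
move: (1%:M : 'M[k]_(ddim M * ddim N)) => w. apply/matrixP=> i j; rewrite !mxE; ring.
Qed.

Lemma dhom_tens M M' N N' (f : 'M_(ddim M', ddim M)) (g : 'M_(ddim N', ddim N)) :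
  dhom M M' f -> dhom N N' g -> dhom (dtens q M N) (dtens q M' N') (f *t g).
Proof.
move=> [fE fA fG fX] [gE gA gG gX]; split=> [i|i||] /=.
- rewrite mulmx_sumr mulmx_suml; apply: eq_bigr => j _.
  rewrite mulmx_sumr mulmx_suml; apply: eq_bigr => l _.
  by rewrite !tensmx_mul fE gE.
- rewrite mulmx_sumr mulmx_suml; apply: eq_bigr => j _.
  rewrite mulmx_sumr mulmx_suml; apply: eq_bigr => l _.
  by rewrite mulmxDl mulmxDr -scalemxAl -scalemxAr !tensmx_mul fE fA gE gA.
- by rewrite !tensmx_mul fG gG.
by rewrite mulmxDl mulmxDr !tensmx_mul fX gG gX mul1mx mulmx1.
Qed.

Lemma diso_dtens M M' N N' : diso M M' -> diso N N' -> diso (dtens q M N) (dtens q M' N').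
Proof.
case=> f [g [hf hg fg gf]] [f' [g' [hf' hg' fg' gf']]].
exists (f *t f'), (g *t g'); split; try exact: dhom_tens.
  by rewrite tensmx_mul fg fg' tensmx11.
by rewrite tensmx_mul gf gf' tensmx11.
Qed.

Lemma dtens_addl A B C : diso (dtens q (dadd A B) C) (dadd (dtens q A C) (dtens q B C)).
Proof.
apply/biproduct_daddP.
case: (biproduct_dadd A B) => [[a [b [a' [b' [[ha hb ha' hb'] [aa bb ab ba] e]]]]]].
constructor; exists (a *t 1%:M), (b *t 1%:M), (a' *t 1%:M), (b' *t 1%:M).
have h1 := dhom1 C.
split; first by split; apply: dhom_tens.
  by split; rewrite tensmx_mul mulmx1 ?aa ?bb ?ab ?ba ?tensmx11 ?tens0mx.
by rewrite !tensmx_mul mulmx1 -tensmxDl e tensmx11.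
Qed.

Lemma dtens_addr A B C : diso (dtens q C (dadd A B)) (dadd (dtens q C A) (dtens q C B)).
Proof.
apply/biproduct_daddP.
case: (biproduct_dadd A B) => [[a [b [a' [b' [[ha hb ha' hb'] [aa bb ab ba] e]]]]]].
constructor; exists (1%:M *t a), (1%:M *t b), (1%:M *t a'), (1%:M *t b').
have h1 := dhom1 C.
split; first by split; apply: dhom_tens.
  by split; rewrite tensmx_mul mulmx1 ?aa ?bb ?ab ?ba ?tensmx11 ?tensmx0.
by rewrite !tensmx_mul mulmx1 -tensmxDr e tensmx11.
Qed.

Lemma dtens_0r C : diso (dtens q C (dzero k n)) (dzero k n).
Proof. by apply: ddim0_iso; rewrite /= muln0. Qed.

Lemma dtens_dsumr C (s : seq (dmod k n)) : diso (dtens q C (dsum s)) (dsum (map (dtens q C) s)).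
Proof.
elim: s => [|A s IH] /=; first exact: dtens_0r.
by apply: diso_trans (dtens_addr _ _ _) _; apply: diso_daddr.
Qed.

Section Associativity.
Variables a b c : nat.

Definition assoc_index (i : 'I_(a * b * c)) : 'I_(a * (b * c)) :=
  let: (xy, z) := mxtens_unindex i in let: (x, y) := mxtens_unindex xy in
  mxtens_index (x, mxtens_index (y, z)).

(** The index types of (a b) c and a (b c) are not convertible, so the associator is an explicit
    permutation matrix. *)
Definition assoc_mx : 'M[k]_(a * (b * c), a * b * c) := \matrix_(i, j) (i == assoc_index j)%:R.

Lemma assoc_indexE x y z : assoc_index (mxtens_index (mxtens_index (x, y), z)) =
  mxtens_index (x, mxtens_index (y, z)).
Proof. by rewrite /assoc_index !mxtens_indexK. Qed.

Lemma assoc_mxE x y z x' y' z' :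
  assoc_mx (mxtens_index (x, mxtens_index (y, z))) (mxtens_index (mxtens_index (x', y'), z'))
  = [&& x == x', y == y' & z == z']%:R.
Proof.
rewrite mxE assoc_indexE; do 2!rewrite (inj_eq (can_inj (@mxtens_indexK _ _))) xpair_eqE.
by [].
Qed.

Lemma sum_mxtens_index m p (F : 'I_(m * p) -> k) :
  \sum_i F i = \sum_i \sum_j F (mxtens_index (i, j)).
Proof.
rewrite pair_big (reindex (@mxtens_index m p)) /=; first by apply: eq_bigr => - [].
by exists (@mxtens_unindex m p) => i _; rewrite ?mxtens_indexK ?mxtens_unindexK.
Qed.

Lemma assoc_mx_l m (Y : 'M[k]_(a * b * c, m)) x y z j :
  (assoc_mx *m Y) (mxtens_index (x, mxtens_index (y, z))) j = Y (mxtens_index (mxtens_index (x, y), z)) j.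
Proof.
rewrite mxE (bigD1 (mxtens_index (mxtens_index (x, y), z))) //= assoc_mxE !eqxx mul1r big1 ?addr0 //.
move=> i; case: (mxtens_indexP i) => xy z'; case: (mxtens_indexP xy) => x' y'.
do 2!rewrite (inj_eq (can_inj (@mxtens_indexK _ _))) xpair_eqE; rewrite assoc_mxE.
rewrite (eq_sym x) (eq_sym y) (eq_sym z) andbA => /negPf ->; by rewrite mul0r.
Qed.

Lemma assoc_mx_r m (Y : 'M[k]_(m, a * (b * c))) x y z j :
  (Y *m assoc_mx) j (mxtens_index (mxtens_index (x, y), z)) = Y j (mxtens_index (x, mxtens_index (y, z))).
Proof.
rewrite mxE (bigD1 (mxtens_index (x, mxtens_index (y, z)))) //= assoc_mxE !eqxx mulr1 big1 ?addr0 //.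
move=> i; case: (mxtens_indexP i) => x' yz; case: (mxtens_indexP yz) => y' z'.
do 2!rewrite (inj_eq (can_inj (@mxtens_indexK _ _))) xpair_eqE; rewrite assoc_mxE.
by move=> /negPf ->; rewrite mulr0.
Qed.

End Associativity.

Lemma mxtens_eq3 a b c m (Y Z : 'M[k]_(a * (b * c), m)) :
  (forall x y z j, Y (mxtens_index (x, mxtens_index (y, z))) j = Z (mxtens_index (x, mxtens_index (y, z))) j) ->
  Y = Z.
Proof.
move=> h; apply/matrixP => i j; case: (mxtens_indexP i) => x yz.
by case: (mxtens_indexP yz) => y z; apply: h.
Qed.

Lemma assoc_mx_tens a b c a' b' c' (Y : 'M[k]_(a, a')) (Z : 'M_(b, b')) (W : 'M_(c, c')) :
  assoc_mx a b c *m (Y *t Z *t W) = Y *t (Z *t W) *m assoc_mx a' b' c'.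
Proof.
apply: mxtens_eq3 => x y z j; case: (mxtens_indexP j) => xy z'; case: (mxtens_indexP xy) => x' y'.
by rewrite assoc_mx_l assoc_mx_r !tensmxE mulrA.
Qed.

Lemma assoc_mxK a b c : assoc_mx a b c *m (assoc_mx a b c)^T = 1%:M.
Proof.
apply: mxtens_eq3 => x y z j; case: (mxtens_indexP j) => x' yz'; case: (mxtens_indexP yz') => y' z'.
rewrite assoc_mx_l mxE assoc_mxE mxE.
do 2!rewrite (inj_eq (can_inj (@mxtens_indexK _ _))) xpair_eqE.
by rewrite (eq_sym x) (eq_sym y) (eq_sym z).
Qed.

Lemma assoc_mxVK a b c : (assoc_mx a b c)^T *m assoc_mx a b c = 1%:M.
Proof.
have := assoc_mxK a b c; move: (assoc_mx a b c) (assoc_mx a b c)^T => f g.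
move: f g; rewrite mulnA => f g; exact: mulmx1C.
Qed.

Lemma total_A_dtens M N : is_dmod d q M -> is_dmod d q N ->
  total_A (dtens q M N) = 1%:M *t total_A N + total_A M *t K N.
Proof. by move=> dM dN; apply: total_A_unique (dtens_E1 dM dN) (dtens_totalA dM dN). Qed.

Lemma dtensA M N P : is_dmod d q M -> is_dmod d q N -> is_dmod d q P ->
  diso (dtens q (dtens q M N) P) (dtens q M (dtens q N P)).
Proof.
move=> dM dN dP; have [dMN dNP] := (dtens_dmod dM dN, dtens_dmod dN dP).
have hf : dhom (dtens q (dtens q M N) P) (dtens q M (dtens q N P)) (assoc_mx (ddim M) (ddim N) (ddim P)).
  apply: (dhom_total (dtens_dmod dMN dP) (dtens_dmod dM dNP)).
  - move=> i; rewrite !dtensE mulmx_sumr mulmx_suml.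
    under eq_bigr do rewrite dtensE tensmx_suml mulmx_sumr.
    rewrite exchange_big; apply: eq_bigr => a _.
    rewrite dtensE tensmx_sumr mulmx_suml (reindex_inj (addIr a)); apply: eq_bigr => b _ /=.
    by rewrite assoc_mx_tens addrK opprD addrA (addrAC i).
  - rewrite !total_A_dtens // dtens_weight // -tensmx11 mulmxDr mulmxDl assoc_mx_tens.
    by rewrite tensmxDl tensmxDr mulmxDr mulmxDl !assoc_mx_tens addrA.
  - by rewrite /= assoc_mx_tens.
  rewrite /= mulmxDr mulmxDl tensmxDl tensmxDr mulmxDr mulmxDl -!tensmx11 !assoc_mx_tens addrA.
  by [].
exists (assoc_mx (ddim M) (ddim N) (ddim P)), (assoc_mx (ddim M) (ddim N) (ddim P))^T.
have [fg gf] := (assoc_mxK (ddim M) (ddim N) (ddim P), assoc_mxVK (ddim M) (ddim N) (ddim P)).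
by split=> //; apply: (dhom_inv hf).
Qed.

End TensorProducts.

(** * Dual modules and currying of linear maps *)

Section Duals.
Variables (k : fieldType) (n d : nat) (q : k).
Hypotheses (n_gt0 : (0 < n)%N) (d_dvd_n : (d %| n)%N) (q_prim : d.-primitive_root q).
Implicit Types M N P A B C : dmod k n.
Let tot M (dM : is_dmod d q M) := dmod_total n_gt0 d_dvd_n q_prim dM.
Let K M := weight_mx q (actE M).
Let Kv M := weight_mx q^-1 (actE M).
Let Gv M := actG M ^+ n.-1.

Lemma weight_mxV M : is_dmod d q M -> K M *m Kv M = 1%:M.
Proof.
move=> dM; have EE := totEE (tot dM); apply: (E_decompositionr (totE1 (tot dM))) => i.
rewrite -mulmxA weight_mxE // -scalemxAr weight_mxE // scalerA mul1mx exprVn.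
by rewrite mulVf ?scale1r // expf_neq0 // (q_neq0 q_prim).
Qed.

Lemma actG_inv M : is_dmod d q M -> actG M *m Gv M = 1%:M.
Proof. by move=> dM; rewrite mulmxE -exprS prednK // (relGn dM). Qed.

Lemma inv_commute m (Y Z W : 'M[k]_m) s : s != 0 -> Y *m Z = 1%:M ->
  Y *m W = s *: (W *m Y) -> Z *m W = s^-1 *: (W *m Z).
Proof.
move=> s0 YZ e; have ZY := mulmx1C YZ.
rewrite -[W in LHS]mulmx1 -YZ [W *m _]mulmxA -[W *m Y]scale1r -(mulVf s0) -scalerA -e.
by rewrite -!scalemxAl -scalemxAr !mulmxA ZY mul1mx.
Qed.

Lemma inv_commute1 m (Y Z W : 'M[k]_m) : Y *m Z = 1%:M ->
  Y *m W = W *m Y -> Z *m W = W *m Z.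
Proof.
move=> YZ e; rewrite (@inv_commute _ Y Z W 1) ?oner_eq0 ?invr1 ?scale1r //.
Qed.

(** Transfers nilpotency from A to A K^-1 and from X to X G^-1, which are the antipodes of A and X
    up to scalars. *)
Lemma q_commuting_expM m (x y : 'M[k]_m) s r : y *m x = s *: (x *m y) ->
  exists c, (x *m y) ^+ r = c *: (x ^+ r *m y ^+ r).
Proof.
move=> yx; have yxj j : y *m x ^+ j = s ^+ j *: (x ^+ j *m y).
  elim: j => [|j IH]; first by rewrite !expr0 scale1r -[1]/1%:M mulmx1 mul1mx.
  rewrite exprSr -mulmxE mulmxA IH -scalemxAl -mulmxA yx -scalemxAr scalerA -exprSr mulmxA.
  by rewrite exprSr.
elim: r => [|r [c IH]]; first by exists 1; rewrite !expr0 scale1r -[1]/1%:M mulmx1.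
exists (c * s ^+ r); rewrite [LHS]exprS IH -mulmxE -scalemxAr -mulmxA (mulmxA y) yxj.
by rewrite -scalemxAl -scalemxAr scalerA !exprS -!mulmxE !mulmxA.
Qed.

Lemma trmxX m (Y : 'M[k]_m) r : Y^T ^+ r = (Y ^+ r)^T.
Proof.
elim: r => [|r IH]; first by rewrite !expr0 -[1]/1%:M trmx1.
by rewrite exprSr IH -mulmxE -trmx_mul exprS.
Qed.

Lemma scalemxX m a (Y : 'M[k]_m) r : (a *: Y) ^+ r = a ^+ r *: Y ^+ r.
Proof.
elim: r => [|r IH]; first by rewrite !expr0 scale1r.
by rewrite !exprS IH -!mulmxE -scalemxAl -scalemxAr scalerA.
Qed.

Lemma q_expN (i : Zmod n) : q ^+ (- i : Zmod n)%R = q^-1 ^+ i.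
Proof.
have nz := q_exp_neq0 q_prim i; apply: (mulfI nz).
by rewrite -(q_expD n_gt0 d_dvd_n q_prim) subrr q_exp0 exprVn divff.
Qed.

(** The antipode reverses products and transposition reverses them back, so the transposes satisfy
    the original relation. *)
Lemma trmx_relXA m (x a g h : 'M[k]_m) : a *m x = q *: (x *m a) + 1%:M - h *m g ->
  x^T *m a^T = q *: (a^T *m x^T) + 1%:M - g^T *m h^T.
Proof. by move=> /(congr1 trmx); rewrite linearB linearD linearZ /= !trmx_mul trmx1. Qed.

(* The dual for the antipode when [c = 1] and for its inverse when [c = q]. *)
Definition ddual (c : k) M : dmod k n :=
  DMod (fun i => (actE M (- i))^T)
    (fun i => (- c^-1 *: (total_A M *m Kv M))^T *m (actE M (- i))^T)
    (Gv M)^T (- c *: (actX M *m Gv M))^T.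

Lemma ddual_weight c M : weight_mx q (actE (ddual c M)) = (Kv M)^T.
Proof.
rewrite /weight_mx linear_sum [LHS](reindex_inj oppr_inj); apply: eq_bigr => i _.
by rewrite q_expN linearZ /= opprK.
Qed.

(** The constant c rescales A by c^-1 and X by c. The other relations are homogeneous in A and in X,
    and in the relation for XA the two factors cancel, so one computation covers both duals. *)
Lemma ddual_dmod c M : c != 0 -> is_dmod d q M -> is_dmod d q (ddual c M).
Proof.
move=> c0 dM; have t := tot dM; have q0 := q_neq0 q_prim.
have KA := weight_mxA n_gt0 d_dvd_n q_prim t; have XK := weight_mxX n_gt0 d_dvd_n q_prim t.
have KG := weight_mxG t; have KC := weight_mxC t.
rewrite -/(K M) in KA XK KG KC.
have KKv := weight_mxV dM; have GGv := actG_inv dM.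
have KvA := inv_commute q0 KKv KA.
have GvA := inv_commute q0 GGv (totGA t).
have qv0 : q^-1 != 0 by rewrite invr_neq0.
have GvX := inv_commute qv0 GGv (totGX t); rewrite invrK in GvX.
have KX : K M *m actX M = q^-1 *: (actX M *m K M) by rewrite XK scalerA mulVf // scale1r.
have KvX := inv_commute qv0 KKv KX; rewrite invrK in KvX.
have GvE i := inv_commute1 GGv (totGE t i).
have KvE i : Kv M *m actE M i = actE M i *m Kv M := inv_commute1 KKv (KC i).
have KvG : Kv M *m actG M = actG M *m Kv M := inv_commute1 KKv KG.
have GvKv : Gv M *m Kv M = Kv M *m Gv M by apply: inv_commute1 GGv (esym KvG).
apply: (@total_dmod _ _ _ _ n_gt0 d_dvd_n q_prim (ddual c M) (- c^-1 *: (total_A M *m Kv M))^T) => //.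
split; rewrite ?ddual_weight /=.
- move=> i j; rewrite -trmx_mul (totEE t) linearZ /= (inj_eq oppr_inj) eq_sym.
  by case: eqP => [->|] //; rewrite !scale0r.
- by rewrite -[RHS]trmx1 -(totE1 t) linear_sum /= (reindex_inj oppr_inj); apply: eq_bigr => i _; rewrite opprK.
- move=> i; rewrite -!trmx_mul -scalemxAr -scalemxAl; congr (_ *: _)^T.
  by rewrite -mulmxA KvE !mulmxA (totAE t) opprD subrK.
- have [s e] : exists s, (total_A M *m Kv M) ^+ d = s *: (total_A M ^+ d *m Kv M ^+ d).
    exact: q_commuting_expM KvA.
  by rewrite trmxX scalemxX e (totAd t) mul0mx !scaler0 trmx0.
- by rewrite trmxX /Gv -exprM mulnC exprM (totGn t) -[1%:M]/1 expr1n trmx1.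
- have [s e] : exists s, (actX M *m Gv M) ^+ d = s *: (actX M ^+ d *m Gv M ^+ d).
    exact: q_commuting_expM GvX.
  by rewrite trmxX scalemxX e (totXd t) mul0mx !scaler0 trmx0.
- rewrite -!trmx_mul -[RHS]linearZ; congr (_^T).
  rewrite -scalemxAl -scalemxAr !scalerA; rewrite mulmxA GvX -scalemxAl scalerA.
  by rewrite mulrAC mulVf // mul1r.
- by move=> i; rewrite -!trmx_mul GvE.
- rewrite -!trmx_mul -[RHS]linearZ; congr (_^T).
  rewrite -scalemxAl -scalemxAr !scalerA; rewrite mulmxA GvA -scalemxAl scalerA -mulmxA -GvKv mulmxA.
  by rewrite mulrAC divff // mul1r.
- move=> i; rewrite -!trmx_mul -scalemxAr -scalemxAl; congr (_ *: _)^T.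
  by rewrite -mulmxA GvE !mulmxA (totEX t) opprD subrK.
apply: trmx_relXA.
have e1 : - c^-1 * - c = 1 by rewrite mulrNN mulVf.
have e2 : q * - c * - c^-1 = q by rewrite -mulrA mulrNN divff ?mulr1.
rewrite -!scalemxAl -!scalemxAr !scalerA e1 e2 scale1r.
rewrite -!mulmxA (mulmxA (Kv M)) KvX (mulmxA (Gv M)) GvA -!scalemxAl -!scalemxAr !mulmxA.
rewrite (totXA t) scalerA mulfV // scale1r.
have -> : Kv M *m Gv M = Gv M *m Kv M by [].
rewrite !(mulmxBl, mulmxDl) mul1mx -!scalemxAl addrAC -addrA.
have KGv : Gv M *m K M = K M *m Gv M by apply: inv_commute1 GGv (esym KG).
have -> : actG M *m weight_mx q (actE M) *m Gv M *m Kv M = 1%:M.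
  by rewrite -!mulmxA (mulmxA (K M)) -KGv -mulmxA KKv mulmx1 GGv.
by rewrite -(mulmxA _ (Kv M)) -GvKv mulmxA [- _ + _]addrC addrA subrK addrK.
Qed.

Lemma total_A_ddual c M : c != 0 -> is_dmod d q M ->
  total_A (ddual c M) = - c^-1 *: (total_A M *m Kv M)^T.
Proof.
move=> c0 dM; have dD := ddual_dmod c0 dM.
rewrite -[RHS]linearZ; apply: total_A_unique => //=.
exact: totE1 (tot dD).
Qed.

Section Flips.
Variables m p b : nat.

(** Currying Hom(M (x) P, B) = Hom(P, M^ (x) B), with M^ the dual, as a rearrangement of matrix
    entries; [flipr] does the same for Hom(P (x) M, B) = Hom(P, B (x) M^). *)
Definition flipl (g : 'M[k]_(b, m * p)) : 'M[k]_(m * b, p) :=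
  \matrix_(i, z) g (mxtens_unindex i).2 (mxtens_index ((mxtens_unindex i).1, z)).

Definition flipr (g : 'M[k]_(b, p * m)) : 'M[k]_(b * m, p) :=
  \matrix_(i, z) g (mxtens_unindex i).1 (mxtens_index (z, (mxtens_unindex i).2)).

Definition unflipl (h : 'M[k]_(m * b, p)) : 'M[k]_(b, m * p) :=
  \matrix_(y, j) h (mxtens_index ((mxtens_unindex j).1, y)) (mxtens_unindex j).2.

Definition unflipr (h : 'M[k]_(b * m, p)) : 'M[k]_(b, p * m) :=
  \matrix_(y, j) h (mxtens_index (y, (mxtens_unindex j).2)) (mxtens_unindex j).1.

Lemma unfliplK h : flipl (unflipl h) = h.
Proof. by apply/matrixP=> i j; case: (mxtens_indexP i) => x y; rewrite !mxE !mxtens_indexK. Qed.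

Lemma unfliprK h : flipr (unflipr h) = h.
Proof. by apply/matrixP=> i j; case: (mxtens_indexP i) => x y; rewrite !mxE !mxtens_indexK. Qed.

Lemma flipl_inj : injective flipl.
Proof.
move=> g g' e; apply/matrixP=> y j; case: (mxtens_indexP j) => x z.
by have := congr1 (fun u : 'M_(_, _) => u (mxtens_index (x, y)) z) e; rewrite !mxE !mxtens_indexK.
Qed.

Lemma flipr_inj : injective flipr.
Proof.
move=> g g' e; apply/matrixP=> y j; case: (mxtens_indexP j) => z x.
by have := congr1 (fun u : 'M_(_, _) => u (mxtens_index (y, x)) z) e; rewrite !mxE !mxtens_indexK.
Qed.

Lemma fliplD g g' : flipl (g + g') = flipl g + flipl g'.
Proof. by apply/matrixP=> i j; rewrite !mxE. Qed.

Lemma fliprD g g' : flipr (g + g') = flipr g + flipr g'.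
Proof. by apply/matrixP=> i j; rewrite !mxE. Qed.

Lemma flipl_sum I (r : seq I) (P : pred I) F :
  flipl (\sum_(i <- r | P i) F i) = \sum_(i <- r | P i) flipl (F i).
Proof.
elim/big_rec2: _ => [|i A B _ <-]; last by rewrite fliplD.
by apply/matrixP=> i j; rewrite !mxE.
Qed.

Lemma flipr_sum I (r : seq I) (P : pred I) F :
  flipr (\sum_(i <- r | P i) F i) = \sum_(i <- r | P i) flipr (F i).
Proof.
elim/big_rec2: _ => [|i A B _ <-]; last by rewrite fliprD.
by apply/matrixP=> i j; rewrite !mxE.
Qed.

End Flips.

Lemma flipl_nat m p b b' (Y : 'M[k]_m) (Z : 'M[k]_(b', b)) (g : 'M[k]_(b, m * p)) :
  (Y^T *t Z) *m flipl g = flipl (Z *m g *m (Y *t 1%:M)).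
Proof.
apply/matrixP=> i z; case: (mxtens_indexP i) => x y.
rewrite !mxE !mxtens_indexK !sum_mxtens_index; apply: eq_bigr => x' _ /=.
rewrite [RHS](bigD1 z) //= [X in _ + X]big1 ?addr0 => [|z' nz]; last first.
  by rewrite tensmxE [1%:M _ _]mxE (negPf nz) !mulr0.
rewrite tensmxE [1%:M _ _]mxE eqxx mulr1 mxE mulr_suml; apply: eq_bigr => y' _.
by rewrite tensmxE !mxE !mxtens_indexK /= -mulrA mulrC.
Qed.

Lemma flipl_natr m p p' b (W : 'M[k]_(p, p')) (g : 'M[k]_(b, m * p)) :
  flipl g *m W = flipl (g *m (1%:M *t W)).
Proof.
apply/matrixP=> i z; case: (mxtens_indexP i) => x y.
rewrite !mxE !mxtens_indexK sum_mxtens_index [RHS](bigD1 x) //= [X in _ + X]big1 ?addr0 => [|x' nx].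
  by apply: eq_bigr => z' _; rewrite tensmxE !mxE !mxtens_indexK eqxx mul1r.
by apply: big1 => z' _; rewrite tensmxE [1%:M _ _]mxE (negPf nx) mul0r mulr0.
Qed.

Lemma flipr_nat m p b b' (Y : 'M[k]_m) (Z : 'M[k]_(b', b)) (g : 'M[k]_(b, p * m)) :
  (Z *t Y^T) *m flipr g = flipr (Z *m g *m (1%:M *t Y)).
Proof.
apply/matrixP=> i z; case: (mxtens_indexP i) => y x.
rewrite !mxE !mxtens_indexK !sum_mxtens_index [RHS](bigD1 z) //= [X in _ + X]big1 ?addr0 => [|z' nz]; last first.
  by apply: big1 => x' _; rewrite tensmxE [1%:M _ _]mxE (negPf nz) mul0r mulr0.
rewrite exchange_big; apply: eq_bigr => x' _ /=.
rewrite tensmxE [1%:M _ _]mxE eqxx mul1r mxE mulr_suml; apply: eq_bigr => y' _.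
by rewrite tensmxE !mxE !mxtens_indexK /= mulrAC.
Qed.

Lemma flipr_natr m p p' b (W : 'M[k]_(p, p')) (g : 'M[k]_(b, p * m)) :
  flipr g *m W = flipr (g *m (W *t 1%:M)).
Proof.
apply/matrixP=> i z; case: (mxtens_indexP i) => y x.
rewrite !mxE !mxtens_indexK sum_mxtens_index; apply: eq_bigr => z' _.
rewrite [RHS](bigD1 x) //= [X in _ + X]big1 ?addr0 => [|x' nx].
  by rewrite tensmxE !mxE !mxtens_indexK eqxx mulr1.
by rewrite tensmxE [1%:M _ _]mxE (negPf nx) !mulr0.
Qed.

End Duals.

(** * Tensor-hom adjunctions; tensoring preserves projectives *)

Section ProjectiveTensors.
Variables (k : fieldType) (n d : nat) (q : k).
Hypotheses (n_gt0 : (0 < n)%N) (d_dvd_n : (d %| n)%N) (q_prim : d.-primitive_root q).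
Implicit Types M N P A B C : dmod k n.
Let tot M (dM : is_dmod d q M) := dmod_total n_gt0 d_dvd_n q_prim dM.
Let K M := weight_mx q (actE M).
Let Kv M := weight_mx q^-1 (actE M).

Lemma dtens_E_l M N i j : is_dmod d q M ->
  actE (dtens q M N) i *m (actE M j *t 1%:M) = actE M j *t actE N (i - j).
Proof.
move=> dM; rewrite dtensE mulmx_suml (bigD1 j) //= big1 => [|a aj]; rewrite tensmx_mul (totEE (tot dM)).
  by rewrite eqxx scale1r mulmx1 addr0.
by rewrite (negPf aj) scale0r tens0mx.
Qed.

Lemma dtens_E_r M N i j : is_dmod d q N ->
  actE (dtens q M N) i *m (1%:M *t actE N j) = actE M (i - j) *t actE N j.
Proof.
move=> dN; rewrite dtensE mulmx_suml (bigD1 (i - j)) //= big1 => [|a aj];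
  rewrite tensmx_mul (totEE (tot dN)) mulmx1.
  by rewrite subKr eqxx scale1r addr0.
suff /negPf -> : i - a != j by rewrite scale0r tensmx0.
by apply: contraNneq aj => <-; rewrite subKr.
Qed.

Section Left.
Variables (M P B : dmod k n) (g : 'M[k]_(ddim B, ddim M * ddim P)).
Hypotheses (dM : is_dmod d q M) (dP : is_dmod d q P) (dB : is_dmod d q B).
Let D := ddual q q M.

(** Both conditions say that g maps the part of degrees (a, l) to degree a + l. The sums over
    degrees are separated by composing with the idempotents of M. *)
Lemma flipl_E : (forall i, g *m actE (dtens q M P) i = actE B i *m g) <->
  (forall i, flipl g *m actE P i = actE (dtens q D B) i *m flipl g).
Proof.
have Eq i : actE (dtens q D B) i *m flipl g = flipl (\sum_j actE B (i - j) *m g *m (actE M (- j) *t 1%:M)).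
  rewrite dtensE mulmx_suml flipl_sum; apply: eq_bigr => j _; exact: flipl_nat.
split=> h i.
  rewrite Eq flipl_natr; congr flipl; rewrite -(totE1 (tot dM)) tensmx_suml mulmx_sumr.
  rewrite [LHS](reindex_inj oppr_inj); apply: eq_bigr => j _.
  by rewrite -h -mulmxA dtens_E_l // opprK subrK.
have {}h l : g *m (1%:M *t actE P l) = \sum_j actE B (l - j) *m g *m (actE M (- j) *t 1%:M).
  by apply: flipl_inj; rewrite -Eq -h flipl_natr.
have gE a l : g *m (actE M a *t actE P l) = actE B (l + a) *m g *m (actE M a *t 1%:M).
  have -> : actE M a *t actE P l = (1%:M *t actE P l) *m (actE M a *t 1%:M).
    by rewrite tensmx_mul mul1mx mulmx1.
  rewrite mulmxA h mulmx_suml (bigD1 (- a)) //= big1 => [|j ja];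
    rewrite -(mulmxA (_ *m g)) tensmx_mul (totEE (tot dM)) mulmx1.
    by rewrite !opprK eqxx scale1r addr0.
  by rewrite -{1}[a]opprK (inj_eq oppr_inj) (negPf ja) scale0r tens0mx mulmx0.
rewrite dtensE mulmx_sumr; under eq_bigr do rewrite gE subrK.
by rewrite -mulmx_sumr -tensmx_suml (totE1 (tot dM)) tensmx11 mulmx1.
Qed.

(** The adjunction for a left factor, with the dual for the inverse antipode. The comparison for A
    uses that g commutes with K, the one for X that it commutes with G, as these elements occur in
    the coproducts; hence the order of the checks. *)
Lemma flipl_dhom : dhom (dtens q M P) B g <-> dhom P (dtens q D B) (flipl g).
Proof.
have q0 := q_neq0 q_prim.
have dD : is_dmod d q D by apply: (ddual_dmod n_gt0 d_dvd_n q_prim).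
have dMP := dtens_dmod n_gt0 d_dvd_n q_prim dM dP.
have dDB := dtens_dmod n_gt0 d_dvd_n q_prim dD dB.
have weightK : (forall i, g *m actE (dtens q M P) i = actE B i *m g) ->
    K B *m g = g *m (K M *t K P).
  move=> hE; rewrite -(dtens_weight n_gt0 d_dvd_n q_prim dM dP) mulmx_suml mulmx_sumr.
  by apply: eq_bigr => i _; rewrite -scalemxAl -hE scalemxAr.
have AE : (forall i, g *m actE (dtens q M P) i = actE B i *m g) ->
    (g *m total_A (dtens q M P) = total_A B *m g <->
     flipl g *m total_A P = total_A (dtens q D B) *m flipl g).
  move=> /weightK Kg.
  rewrite !(total_A_dtens n_gt0 d_dvd_n q_prim) // (total_A_ddual n_gt0 d_dvd_n q_prim) // -[_ *: _^T]linearZ /=.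
  rewrite mulmxDl -(trmx1 k (ddim M)) !flipl_nat flipl_natr trmx1 tensmx11 mulmx1 -fliplD mulmxDr.
  rewrite -/(K B) -/(Kv M) Kg -mulmxA tensmx_mul mulmx1 -scalemxAr mulmxA.
  rewrite (weight_mxA n_gt0 d_dvd_n q_prim (tot dM)) -scalemxAl scalerA mulNr mulVf //.
  rewrite scaleN1r -mulmxA (weight_mxV n_gt0 d_dvd_n q_prim) // mulmx1 tensmxNl mulmxN -/(K P).
  split=> [<-|/flipl_inj ->]; first by rewrite addrK.
  by rewrite subrK.
have GE : g *m actG (dtens q M P) = actG B *m g <->
     flipl g *m actG P = actG (dtens q D B) *m flipl g.
  rewrite /= flipl_nat flipl_natr; split=> [<-|/flipl_inj].
    by congr flipl; rewrite -mulmxA tensmx_mul (actG_inv n_gt0 dM) mulmx1.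
  move=> e; have -> : actG M *t actG P = (1%:M *t actG P) *m (actG M *t 1%:M).
    by rewrite tensmx_mul mul1mx mulmx1.
  by rewrite mulmxA e -mulmxA tensmx_mul mulmx1 (mulmx1C (actG_inv n_gt0 dM)) tensmx11 mulmx1.
have XE : g *m actG (dtens q M P) = actG B *m g ->
    (g *m actX (dtens q M P) = actX B *m g <->
     flipl g *m actX P = actX (dtens q D B) *m flipl g).
  move=> /= Gg; rewrite mulmxDl -(trmx1 k (ddim M)) !flipl_nat flipl_natr trmx1 tensmx11 mulmx1 -fliplD mulmxDr.
  rewrite -Gg -mulmxA tensmx_mul mulmx1 -scalemxAr mulmxA (totGX (tot dM)) -scalemxAl scalerA mulNr divff //.
  rewrite scaleN1r -mulmxA (actG_inv n_gt0 dM) mulmx1 tensmxNl mulmxN.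
  split=> [<-|/flipl_inj ->]; first by rewrite addKr.
  by rewrite addNKr.
split=> hg.
  have [hE _ hG hX] := hg; have hA := dhom_total_A hg.
  by apply: (dhom_total dP dDB); [apply/flipl_E|apply/AE|apply/GE|apply/XE].
have [/flipl_E hE _ /GE hG hX] := hg; have /AE hA := dhom_total_A hg.
by apply: (dhom_total dMP dB) => //; [apply: hA|apply/XE].
Qed.

End Left.

Section Right.
Variables (M P B : dmod k n) (g : 'M[k]_(ddim B, ddim P * ddim M)).
Hypotheses (dM : is_dmod d q M) (dP : is_dmod d q P) (dB : is_dmod d q B).
Let D := ddual q 1 M.

Lemma flipr_E : (forall i, g *m actE (dtens q P M) i = actE B i *m g) <->
  (forall i, flipr g *m actE P i = actE (dtens q B D) i *m flipr g).
Proof.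
have Eq i : actE (dtens q B D) i *m flipr g = flipr (\sum_j actE B j *m g *m (1%:M *t actE M (- (i - j)))).
  rewrite dtensE mulmx_suml flipr_sum; apply: eq_bigr => j _; exact: flipr_nat.
split=> h i.
  rewrite Eq flipr_natr; congr flipr; rewrite -(totE1 (tot dM)) tensmx_sumr mulmx_sumr.
  rewrite [LHS](reindex_inj (addIr (- i))); apply: eq_bigr => j _.
  by rewrite -h -mulmxA dtens_E_r // opprB subKr.
have {}h l : g *m (actE P l *t 1%:M) = \sum_j actE B j *m g *m (1%:M *t actE M (- (l - j))).
  by apply: flipr_inj; rewrite -Eq -h flipr_natr.
have gE a l : g *m (actE P a *t actE M l) = actE B (l + a) *m g *m (1%:M *t actE M l).
  have -> : actE P a *t actE M l = (actE P a *t 1%:M) *m (1%:M *t actE M l).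
    by rewrite tensmx_mul mul1mx mulmx1.
  rewrite mulmxA h mulmx_suml (bigD1 (l + a)) //= big1 => [|j ja];
    rewrite -(mulmxA (_ *m g)) tensmx_mul (totEE (tot dM)) mulmx1 opprB.
    by rewrite addrK eqxx scale1r addr0.
  suff /negPf -> : j - a != l by rewrite scale0r tensmx0 mulmx0.
  by apply: contraNneq ja => <-; rewrite subrK.
rewrite dtensE mulmx_sumr; under eq_bigr do rewrite gE subrK.
rewrite -mulmx_sumr -tensmx_sumr; have -> : \sum_j actE M (i - j) = 1%:M.
  rewrite -(totE1 (tot dM)) [RHS](reindex_inj (inv_inj (subKr i))).
  by [].
by rewrite tensmx11 mulmx1.
Qed.

(** The same for a right factor, with the dual for the antipode itself; here each generator can be
    compared separately, since the factors K and G act on M and are invertible. *)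
Lemma flipr_dhom : dhom (dtens q P M) B g <-> dhom P (dtens q B D) (flipr g).
Proof.
have q0 := q_neq0 q_prim; have n10 : (1 : k) != 0 := oner_neq0 k.
have dD : is_dmod d q D by apply: (ddual_dmod n_gt0 d_dvd_n q_prim).
have dPM := dtens_dmod n_gt0 d_dvd_n q_prim dP dM.
have dBD := dtens_dmod n_gt0 d_dvd_n q_prim dB dD.
have AE : g *m total_A (dtens q P M) = total_A B *m g <->
     flipr g *m total_A P = total_A (dtens q B D) *m flipr g.
  rewrite !(total_A_dtens n_gt0 d_dvd_n q_prim) // (total_A_ddual n_gt0 d_dvd_n q_prim) // -[_ *: _^T]linearZ /=.
  rewrite (ddual_weight n_gt0 d_dvd_n q_prim 1).
  rewrite mulmxDl !flipr_nat flipr_natr mul1mx -fliprD mulmxDr invr1 scaleN1r tensmxNr mulmxN.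
  split=> [<-|/flipr_inj e].
    congr flipr; rewrite mulmxDl -!mulmxA !tensmx_mul !mul1mx !mulmx1 (weight_mxV n_gt0 d_dvd_n q_prim) //.
    by rewrite addKr.
  have -> : total_A P *t weight_mx q (actE M) = (total_A P *t 1%:M) *m (1%:M *t K M).
    by rewrite tensmx_mul mulmx1 mul1mx.
  have KvK := mulmx1C (weight_mxV n_gt0 d_dvd_n q_prim dM).
  rewrite mulmxA e mulmxDl mulNmx -!mulmxA !tensmx_mul !mul1mx -mulmxA KvK mulmx1 tensmx11 mulmx1.
  by rewrite addNKr.
have GE : g *m actG (dtens q P M) = actG B *m g <->
     flipr g *m actG P = actG (dtens q B D) *m flipr g.
  rewrite /= flipr_nat flipr_natr; split=> [<-|/flipr_inj].
    by congr flipr; rewrite -mulmxA tensmx_mul (actG_inv n_gt0 dM) mulmx1.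
  move=> e; have -> : actG P *t actG M = (actG P *t 1%:M) *m (1%:M *t actG M).
    by rewrite tensmx_mul mul1mx mulmx1.
  by rewrite mulmxA e -mulmxA tensmx_mul mulmx1 (mulmx1C (actG_inv n_gt0 dM)) tensmx11 mulmx1.
have XE : g *m actX (dtens q P M) = actX B *m g <->
     flipr g *m actX P = actX (dtens q B D) *m flipr g.
  rewrite /= mulmxDl !flipr_nat flipr_natr mul1mx -fliprD mulmxDr scaleN1r tensmxNr mulmxN.
  split=> [<-|/flipr_inj e].
    congr flipr; rewrite mulmxDl -!mulmxA !tensmx_mul !mul1mx !mulmx1 (actG_inv n_gt0 dM).
    by rewrite addrK.
  have -> : actX P *t actG M = (actX P *t 1%:M) *m (1%:M *t actG M).
    by rewrite tensmx_mul mulmx1 mul1mx.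
  have GvG := mulmx1C (actG_inv n_gt0 dM).
  rewrite mulmxA e mulmxDl mulNmx -!mulmxA !tensmx_mul !mul1mx -mulmxA GvG mulmx1 tensmx11 mulmx1.
  by rewrite subrK.
split=> hg.
  have [hE _ hG hX] := hg; have hA := dhom_total_A hg.
  by apply: (dhom_total dP dBD); [apply/flipr_E|apply/AE|apply/GE|apply/XE].
have [/flipr_E hE _ /GE hG /XE hX] := hg; have /AE hA := dhom_total_A hg.
exact: (dhom_total dPM dB).
Qed.

End Right.

Lemma mx_surj_right_inv m p (f : 'M[k]_(m, p)) : mx_surj f -> exists r, f *m r = 1%:M.
Proof.
move=> sf; have /fin_all_exists[v fv] : forall j : 'I_m, exists v : 'cV[k]_p, f *m v = col j 1%:M.
  by move=> j; apply: sf.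
exists (\matrix_(i, j) v j i 0); apply/matrixP=> i j.
have := congr1 (fun u : 'cV_m => u i 0) (fv j); rewrite !mxE => <-.
by apply: eq_bigr => a _; rewrite !mxE.
Qed.

Lemma right_inv_mx_surj m p (f : 'M[k]_(m, p)) r : f *m r = 1%:M -> mx_surj f.
Proof. by move=> fr w; exists (r *m w); rewrite mulmxA fr mul1mx. Qed.

(** By adjunction, a lifting problem for M (x) P against f becomes one for P against 1 (x) f, which
    is surjective again. *)
Lemma dproj_dtensr M P : is_dmod d q M -> dproj d q P -> dproj d q (dtens q M P).
Proof.
move=> dM [dP lP]; split=> [|A B f g dA dB hf sf hg]; first exact: (dtens_dmod n_gt0 d_dvd_n q_prim).
have dD : is_dmod d q (ddual q q M) by apply: (ddual_dmod n_gt0 d_dvd_n q_prim) => //; apply: q_neq0 q_prim.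
have sf' : mx_surj ((1%:M : 'M_(ddim M)) *t f).
  have [r fr] := mx_surj_right_inv sf; apply: (@right_inv_mx_surj _ _ _ (1%:M *t r)).
  by rewrite tensmx_mul fr mulmx1 tensmx11.
have hg' : dhom P (dtens q (ddual q q M) B) (flipl g) by apply/flipl_dhom.
have [h hh e] := lP _ _ _ _ (dtens_dmod n_gt0 d_dvd_n q_prim dD dA)
  (dtens_dmod n_gt0 d_dvd_n q_prim dD dB) (dhom_tens q (dhom1 _) hf) sf' hg'.
exists (unflipl h); first by apply/flipl_dhom; rewrite ?unfliplK.
apply: flipl_inj; rewrite -e -[h in RHS]unfliplK -[1%:M]trmx1 flipl_nat tensmx11 mulmx1.
by [].
Qed.

Lemma dproj_dtensl M P : is_dmod d q M -> dproj d q P -> dproj d q (dtens q P M).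
Proof.
move=> dM [dP lP]; split=> [|A B f g dA dB hf sf hg]; first exact: (dtens_dmod n_gt0 d_dvd_n q_prim).
have dD : is_dmod d q (ddual q 1 M) by apply: (ddual_dmod n_gt0 d_dvd_n q_prim) => //; apply: oner_neq0.
have sf' : mx_surj (f *t (1%:M : 'M_(ddim M))).
  have [r fr] := mx_surj_right_inv sf; apply: (@right_inv_mx_surj _ _ _ (r *t 1%:M)).
  by rewrite tensmx_mul fr mulmx1 tensmx11.
have hg' : dhom P (dtens q B (ddual q 1 M)) (flipr g) by apply/flipr_dhom.
have [h hh e] := lP _ _ _ _ (dtens_dmod n_gt0 d_dvd_n q_prim dA dD)
  (dtens_dmod n_gt0 d_dvd_n q_prim dB dD) (dhom_tens q hf (dhom1 _)) sf' hg'.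
exists (unflipr h); first by apply/flipr_dhom; rewrite ?unfliprK.
apply: flipr_inj; rewrite -e -[h in RHS]unfliprK -[1%:M]trmx1 flipr_nat tensmx11 mulmx1.
by [].
Qed.

Lemma stable_dtensl M N C : is_dmod d q C -> stable d q M N -> stable d q (dtens q M C) (dtens q N C).
Proof.
move=> dC [P [Q [pP pQ i]]]; exists (dtens q P C), (dtens q Q C).
split; [exact: dproj_dtensl dC pP|exact: dproj_dtensl dC pQ|].
apply: diso_trans (diso_sym (dtens_addl q M P C)) _.
apply: diso_trans _ (dtens_addl q N Q C); exact: (diso_dtens q i (diso_refl C)).
Qed.

Lemma stable_dtensr M N C : is_dmod d q C -> stable d q M N -> stable d q (dtens q C M) (dtens q C N).
Proof.
move=> dC [P [Q [pP pQ i]]]; exists (dtens q C P), (dtens q C Q).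
split; [exact: dproj_dtensr dC pP|exact: dproj_dtensr dC pQ|].
apply: diso_trans (diso_sym (dtens_addr q M P C)) _.
apply: diso_trans _ (dtens_addr q N Q C); exact: (diso_dtens q (diso_refl C) i).
Qed.

End ProjectiveTensors.

(** * String modules *)

Section StringModules.
Variables (k : fieldType) (n d : nat) (q : k).
Hypotheses (n_gt0 : (0 < n)%N) (d_dvd_n : (d %| n)%N) (q_prim : d.-primitive_root q).
Implicit Types (M W : dmod k n) (i : Zmod n) (N t s : nat).
Let tot M (dM : is_dmod d q M) := dmod_total n_gt0 d_dvd_n q_prim dM.

Lemma mul_expr0 m p (Y : 'M[k]_m) (Z : 'M[k]_(m, p)) : Y ^+ 0 *m Z = Z.
Proof. exact: mul1mx. Qed.

Definition unit_col N t : 'cV[k]_N := \col_s ((s : nat) == t)%:R.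

Lemma unit_col_ge N t : (N <= t)%N -> unit_col N t = 0.
Proof.
by move=> le; apply/colP=> s; rewrite !mxE; case: eqP => // e; have := ltn_ord s; rewrite e ltnNge le.
Qed.

Lemma mul_unit_col m N (Y : 'M[k]_(m, N)) (s : 'I_N) : Y *m unit_col N s = col s Y.
Proof.
apply/colP=> r; rewrite !mxE (bigD1 s) //= mxE eqxx mulr1 big1 ?addr0 // => j js.
by rewrite mxE (inj_eq val_inj) (negPf js) mulr0.
Qed.

Lemma unit_col_ext m N (Y Z : 'M[k]_(m, N)) :
  (forall t, (t < N)%N -> Y *m unit_col N t = Z *m unit_col N t) -> Y = Z.
Proof.
move=> h; apply/matrixP=> r s; have := h s (ltn_ord s); rewrite !mul_unit_col.
by move=> /colP/(_ r); rewrite !mxE.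
Qed.

Lemma unit_col_neq0 N t : (t < N)%N -> unit_col N t != 0.
Proof.
move=> lt; apply/eqP=> /colP/(_ (Ordinal lt)); rewrite !mxE eqxx => /eqP.
by rewrite oner_eq0.
Qed.

(* [X] maps [A^t v] to [xcoef N t A^(t-1) v], for [v] of degree [i] killed by [X] *)
(* on which [G] acts by [q^(1-N-i)].                                             *)
Definition xcoef N t : k := (\sum_(s < t) q ^+ s) * (1 - q ^+ t * q^-1 ^+ N).
Definition gcoef i N : k := q * q^-1 ^+ (N + i).

Lemma xcoef0 N : xcoef N 0 = 0.
Proof. by rewrite /xcoef big_ord0 mul0r. Qed.

Lemma q_exprVK m : q ^+ m * q^-1 ^+ m = 1.
Proof. by rewrite exprVn divff // expf_neq0 // (q_neq0 q_prim). Qed.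

Lemma xcoefN N : xcoef N N = 0.
Proof. by rewrite /xcoef q_exprVK subrr mulr0. Qed.

(** The recursion forced by XA = qAX + 1 - GK; the subtracted term is the eigenvalue of GK on A^t
    v. *)
Lemma xcoefS i N t : xcoef N t.+1 = q * xcoef N t + 1 - q ^+ t * gcoef i N * (q ^+ i * q ^+ t).
Proof.
have -> : q ^+ t * gcoef i N * (q ^+ i * q ^+ t) = q ^+ t * q * q^-1 ^+ N * q ^+ t.
  rewrite /gcoef [q^-1 ^+ (_ + _)]exprD -[X in _ = X]mulr1 -[X in _ = _ * X](q_exprVK i); ring.
have e : \sum_(s < t.+1) q ^+ s = 1 + q * \sum_(s < t) q ^+ s.
  rewrite big_ord_recl expr0 mulr_sumr; congr (_ + _); apply: eq_bigr => s _.
  by rewrite /= /bump /= add1n exprS.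
have e' : \sum_(s < t.+1) q ^+ s = \sum_(s < t) q ^+ s + q ^+ t by rewrite big_ord_recr.
rewrite /xcoef mulrBr mulr1 {1}e e' exprS; ring.
Qed.

Lemma qnumber_neq0 t : (0 < t < d)%N -> \sum_(s < t) q ^+ s != 0.
Proof.
move=> /andP[t0 td]; apply/eqP=> e; have := subrX1 q t; rewrite e mulr0 => /eqP.
by rewrite subr_eq0 -(prim_order_dvd q_prim) gtnNdvd.
Qed.

(** The q-number of t is nonzero as 0 < t < d, and q^t differs from q^N as 0 < N - t < d. *)
Lemma xcoef_neq0 N t : (N <= d)%N -> (0 < t < N)%N -> xcoef N t != 0.
Proof.
move=> Nd /andP[t0 tN]; rewrite mulf_neq0 ?qnumber_neq0 ?t0 ?(leq_trans tN) //.
rewrite subr_eq0; apply/eqP=> e.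
have := prim_order_dvd q_prim (N - t); rewrite gtnNdvd; [|lia..] => /esym/eqP[].
have := q_exprVK N; rewrite -{1}(subnK (ltnW tN)) exprD -mulrA -e mulr1 //.
Qed.

Definition string_deg i t : Zmod n := i + inZp t.

Lemma string_degS i t : string_deg i t.+1 = string_deg i t + Zp1.
Proof. by rewrite /string_deg -addrA; congr (_ + _); apply: val_inj; rewrite /= modnDm addn1. Qed.

Lemma string_deg0 i : string_deg i 0 = i.
Proof. by rewrite /string_deg -[RHS]addr0; congr (_ + _); apply: val_inj; rewrite /= mod0n. Qed.

Lemma q_string_deg i t : q ^+ string_deg i t = q ^+ i * q ^+ t.
Proof. by rewrite (q_expD n_gt0 d_dvd_n q_prim) (q_exp_inZp n_gt0 d_dvd_n q_prim). Qed.

Section StringRelations.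
Variables (M : dmod k n) (i : Zmod n) (N : nat) (v : 'cV[k]_(ddim M)).
Hypotheses (dM : is_dmod d q M) (Ev : actE M i *m v = v) (Xv : actX M *m v = 0)
  (Gv : actG M *m v = gcoef i N *: v).

Lemma string_E j t : actE M j *m (total_A M ^+ t *m v) =
  (j == string_deg i t)%:R *: (total_A M ^+ t *m v).
Proof.
elim: t j => [|t IH] j.
  by rewrite mul_expr0 -{1}Ev mulmxA (totEE (tot dM)) -scalemxAl string_deg0;
    case: eqP => [->|_]; rewrite ?scale0r ?Ev.
rewrite exprS -mulmxE -!mulmxA -[j in LHS](subrK Zp1) mulmxA -(totAE (tot dM)) -mulmxA IH.
by rewrite -scalemxAr string_degS -(inj_eq (addIr Zp1)) subrK.
Qed.

Lemma string_weight t : weight_mx q (actE M) *m (total_A M ^+ t *m v) =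
  (q ^+ i * q ^+ t) *: (total_A M ^+ t *m v).
Proof.
rewrite mulmx_suml (bigD1 (string_deg i t)) //= big1 => [|j ji]; rewrite -scalemxAl string_E.
  by rewrite eqxx scale1r addr0 q_string_deg.
by rewrite (negPf ji) scale0r scaler0.
Qed.

Lemma string_G t : actG M *m (total_A M ^+ t *m v) = (q ^+ t * gcoef i N) *: (total_A M ^+ t *m v).
Proof.
elim: t => [|t IH]; first by rewrite mul_expr0 Gv !mul1r.
rewrite exprS -mulmxE -!mulmxA mulmxA (totGA (tot dM)) -scalemxAl -mulmxA IH -scalemxAr.
by rewrite scalerA exprS mulrA.
Qed.

Lemma string_X t : actX M *m (total_A M ^+ t *m v) = xcoef N t *: (total_A M ^+ t.-1 *m v).
Proof.
elim: t => [|t IH]; first by rewrite xcoef0 scale0r mul_expr0.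
rewrite exprS -mulmxE -!mulmxA mulmxA (totXA (tot dM)) mulmxBl mulmxDl mul1mx -scalemxAl -!mulmxA.
rewrite IH string_weight -!scalemxAr string_G.
have -> : xcoef N t *: (total_A M *m (total_A M ^+ t.-1 *m v)) = xcoef N t *: (total_A M ^+ t *m v).
  case: t {IH} => [|t]; first by rewrite xcoef0 !scale0r.
  by rewrite exprS -mulmxE -mulmxA.
rewrite !scalerA -[X in _ + X - _]scale1r -scalerDl -scalerBl (xcoefS i).
by rewrite [q ^+ i * q ^+ t * _]mulrC.
Qed.

End StringRelations.

Definition string_A N : 'M[k]_N := \matrix_(s, t) ((s : nat) == t.+1)%:R.

(** The module S(i,N) on the basis v, Av, ..., A^(N-1) v. Cutting at A^N v = 0 is consistent because
    [xcoef N N] is 0. *)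
Definition string_mod i N : dmod k n :=
  DMod (fun j => \matrix_(s, t) ((s == t) && (j == string_deg i t))%:R)
    (fun j => string_A N *m \matrix_(s, t) ((s == t) && (j == string_deg i t))%:R)
    (\matrix_(s, t) (q ^+ t * gcoef i N *+ (s == t)))
    (\matrix_(s, t) (xcoef N t *+ (s.+1 == t)%N)).

Section StringModule.
Variables (i : Zmod n) (N : nat).
Let S := string_mod i N.
Let w := unit_col N.

Lemma string_modE j t : actE S j *m w t = (j == string_deg i t)%:R *: w t.
Proof.
have [le|lt] := leqP N t; first by rewrite /w unit_col_ge // mulmx0 scaler0.
rewrite (mul_unit_col _ (Ordinal lt)); apply/colP=> s; rewrite !mxE /=.
rewrite -(inj_eq val_inj) /=; case: eqP => _ /=; last by rewrite mulr0.
by rewrite mulr1.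
Qed.

Lemma string_modA t : string_A N *m w t = w t.+1.
Proof.
have [le|lt] := leqP N t; first by rewrite /w !unit_col_ge ?mulmx0 // leqW.
by rewrite (mul_unit_col _ (Ordinal lt)); apply/colP=> s; rewrite !mxE.
Qed.

Lemma string_modG t : actG S *m w t = (q ^+ t * gcoef i N) *: w t.
Proof.
have [le|lt] := leqP N t; first by rewrite /w unit_col_ge // mulmx0 scaler0.
rewrite (mul_unit_col _ (Ordinal lt)); apply/colP=> s; rewrite !mxE /=.
by rewrite -(inj_eq val_inj) /=; case: eqP => _ /=; rewrite ?mulr0 ?mulr1.
Qed.

Lemma string_modX t : actX S *m w t = xcoef N t *: w t.-1.
Proof.
case: (ltngtP N t) => [lt|lt|<-].
- rewrite /w !unit_col_ge ?mulmx0 ?scaler0 //; first by lia.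
  exact: ltnW.
- rewrite (mul_unit_col _ (Ordinal lt)); apply/colP=> s; rewrite !mxE /=.
  case: t lt => [|t] lt /=; first by rewrite xcoef0 mul0r.
  by rewrite eqSS; case: eqP => _; rewrite ?mulr0 ?mulr1.
(* At t = N the vector w N is 0 but w (N - 1) need not be, so the formula relies on the vanishing of
   [xcoef N N]. *)
by rewrite xcoefN scale0r /w unit_col_ge // mulmx0.
Qed.

Lemma string_A_exp m t : string_A N ^+ m *m w t = w (m + t)%N.
Proof.
elim: m t => [|m IH] t; first by rewrite mul_expr0.
by rewrite exprSr -mulmxE -mulmxA string_modA IH addnS.
Qed.

Lemma string_X_exp m t : (t < m)%N -> actX S ^+ m *m w t = 0.
Proof.
elim: m t => // m IH [|t] lt; rewrite exprSr -mulmxE -mulmxA string_modX.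
  by rewrite xcoef0 scale0r mulmx0.
by rewrite -scalemxAr IH ?scaler0.
Qed.

Lemma string_weightE t : weight_mx q (actE S) *m w t = (q ^+ i * q ^+ t) *: w t.
Proof.
rewrite mulmx_suml (bigD1 (string_deg i t)) //= big1 => [|j ji]; rewrite -scalemxAl string_modE.
  by rewrite eqxx scale1r addr0 q_string_deg.
by rewrite (negPf ji) scale0r scaler0.
Qed.

Lemma string_mod_dmod : (N <= d)%N -> is_dmod d q S.
Proof.
move=> Nd; apply: (@total_dmod _ _ _ _ n_gt0 d_dvd_n q_prim S (string_A N)) => //.
have q0 := q_neq0 q_prim.
split.
- move=> j j'; apply: unit_col_ext => t _; rewrite -mulmxA -scalemxAl !string_modE -scalemxAr string_modE !scalerA.
  by case: (j =P string_deg i t) => [->|_]; [rewrite eq_sym|rewrite !mulr0].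
- apply: unit_col_ext => t _; rewrite mul1mx mulmx_suml (bigD1 (string_deg i t)) //= big1 => [|j ji]; rewrite string_modE.
    by rewrite eqxx scale1r addr0.
  by rewrite (negPf ji) scale0r.
- move=> j; apply: unit_col_ext => t _.
  rewrite -!mulmxA string_modE -scalemxAr string_modA string_modE string_degS.
  by rewrite (inj_eq (addIr _)).
- apply: unit_col_ext => t lt; rewrite string_A_exp mul0mx.
  by rewrite /w unit_col_ge //; lia.
- apply: unit_col_ext => t lt; rewrite mul1mx.
  have Gm m : actG S ^+ m *m w t = (q ^+ t * gcoef i N) ^+ m *: w t.
    elim: m => [|m IH]; first by rewrite mul_expr0 scale1r.
    by rewrite exprS -mulmxE -mulmxA IH -scalemxAr string_modG scalerA -exprSr.
  rewrite Gm.
  have qn : q ^+ n = 1 by apply/eqP; rewrite -(prim_order_dvd q_prim).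
  rewrite !exprMn -!exprM ![(_ * n)%N]mulnC !exprM [q^-1 ^+ n]exprVn qn invr1 !expr1n !mulr1.
  exact: scale1r.
- by apply: unit_col_ext => t lt; rewrite string_X_exp ?mul0mx // (leq_trans lt Nd).
- apply: unit_col_ext => t lt; rewrite -scalemxAl -!mulmxA string_modX string_modG -!scalemxAr.
  rewrite string_modX string_modG !scalerA; congr (_ *: _).
  case: t lt => [|t] lt /=; first by rewrite xcoef0 ?(mul0r, mulr0).
  by rewrite exprS; field.
- by move=> j; apply: unit_col_ext => t lt; rewrite -!mulmxA string_modE string_modG -!scalemxAr string_modG string_modE !scalerA mulrC.
- apply: unit_col_ext => t lt; rewrite -scalemxAl -!mulmxA string_modA !string_modG -!scalemxAr string_modA scalerA.
  by rewrite exprS mulrA.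
- move=> j; apply: unit_col_ext => t lt; rewrite -!mulmxA string_modE string_modX -!scalemxAr string_modX string_modE !scalerA.
  case: t lt => [|t] lt /=; first by rewrite xcoef0 ?(mul0r, mulr0).
  by rewrite string_degS (inj_eq (addIr _)) mulrC.
apply: unit_col_ext => t lt; rewrite mulmxBl mulmxDl mul1mx -scalemxAl -!mulmxA string_modA string_weightE.
rewrite !string_modX -!scalemxAr string_modG string_modA /=.
have -> : xcoef N t *: w t.-1.+1 = xcoef N t *: w t.
  by case: t lt => // lt; rewrite xcoef0 !scale0r.
rewrite !scalerA -[X in _ + X - _]scale1r -scalerDl -scalerBl (xcoefS i).
by rewrite [q ^+ i * q ^+ t * _]mulrC.
Qed.

(** X sends each basis vector except the first to a nonzero multiple of its predecessor. *)
Lemma string_ker_X y : (N <= d)%N -> actX S *m y = 0 -> exists a, y = a *: w 0.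
Proof.
move=> Nd Xy; have z (s : 'I_N) : (0 < s)%N -> y s 0 = 0.
  case: s => [[|s] //= lt] _; set r := Ordinal lt.
  have := congr1 (fun u : 'cV_N => u (Ordinal (ltnW lt)) 0) Xy; rewrite !mxE (bigD1 r) //= big1 => [|t tr].
    rewrite addr0 mxE /= eqxx mulr1n => /eqP; rewrite mulf_eq0 (negPf (xcoef_neq0 Nd _)) //.
    by move=> /eqP.
  rewrite mxE /=; suff -> : (s.+1 == t)%N = false by rewrite mul0r.
  by apply: contraNF tr => /eqP e; apply/eqP/val_inj.
have [N0|N0] := posnP N.
  by exists 0; apply/colP=> s; have := ltn_ord s; rewrite [X in (_ < X)%N]N0.
exists (y (Ordinal N0) 0); apply/colP=> s; rewrite !mxE.
have [s0|s0] := posnP s; last by rewrite z // mulr0.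
by rewrite mulr1; congr (y _ _); apply: val_inj.
Qed.

End StringModule.
End StringModules.

(** * Maps out of strings, simple modules as strings, projectivity *)

Section StringModuleTheory.
Variables (k : fieldType) (n d : nat) (q : k).
Hypotheses (n_gt0 : (0 < n)%N) (d_dvd_n : (d %| n)%N) (q_prim : d.-primitive_root q).
Implicit Types (M W : dmod k n) (i j : Zmod n) (N t s : nat).
Let tot M (dM : is_dmod d q M) := dmod_total n_gt0 d_dvd_n q_prim dM.
Let S i N := string_mod q i N.

Lemma string_mod_totalA i N : (N <= d)%N -> total_A (S i N) = string_A k N.
Proof.
move=> Nd; apply: total_A_unique => //.
exact: totE1 (tot (string_mod_dmod n_gt0 d_dvd_n q_prim i Nd)).
Qed.

(* A vector generating a quotient of [string_mod i N]. *)
Record string_vector M i N (v : 'cV[k]_(ddim M)) : Prop := StringVector {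
  svE : actE M i *m v = v;
  svX : actX M *m v = 0;
  svG : actG M *m v = gcoef q i N *: v;
  svA : total_A M ^+ N *m v = 0 }.

(** Universal property of S(i,N): the commutation relations determine the action on all A^t v from
    the data at v. *)
Lemma string_hom M i N v : (N <= d)%N -> is_dmod d q M -> string_vector i N v ->
  exists2 f, dhom (S i N) M f & forall t, f *m unit_col k N t = total_A M ^+ t *m v.
Proof.
move=> Nd dM [Ev Xv Gv Av].
have dS := string_mod_dmod n_gt0 d_dvd_n q_prim i Nd.
pose f : 'M_(ddim M, N) := \matrix_(r, t) (total_A M ^+ t *m v) r 0.
have fw t : f *m unit_col k N t = total_A M ^+ t *m v.
  have [le|lt] := leqP N t.
    by rewrite unit_col_ge // mulmx0 -(subnK le) exprD -mulmxE -mulmxA Av mulmx0.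
  by rewrite (mul_unit_col _ (Ordinal lt)); apply/colP=> r; rewrite !mxE.
exists f => //; apply: (dhom_total dS dM).
- move=> j; apply: unit_col_ext => t _; rewrite -!mulmxA fw string_modE // -scalemxAr fw.
  by rewrite (string_E n_gt0 d_dvd_n q_prim dM Ev).
- rewrite string_mod_totalA //; apply: unit_col_ext => t _; rewrite -!mulmxA string_modA !fw.
  by rewrite exprS -mulmxE -mulmxA.
- apply: unit_col_ext => t _; rewrite -!mulmxA string_modG -scalemxAr !fw.
  by rewrite (string_G n_gt0 d_dvd_n q_prim dM Gv).
apply: unit_col_ext => t _; rewrite -!mulmxA (string_modX n_gt0 d_dvd_n q_prim) -scalemxAr !fw.
by rewrite (string_X n_gt0 d_dvd_n q_prim dM Ev Xv Gv).
Qed.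

(** As X is nilpotent, a nonzero submodule, in particular a nonzero kernel, contains a nonzero
    vector killed by X. For strings this reduces injectivity to the image of the generator. *)
Lemma mx_inj_ker_X M W (f : 'M_(ddim W, ddim M)) : is_dmod d q M -> dhom M W f ->
  (forall y : 'cV_(ddim M), actX M *m y = 0 -> f *m y = 0 -> y = 0) -> mx_inj f.
Proof.
move=> dM hf h y; have : actX M ^+ d *m y = 0 by rewrite (relXd dM) mul0mx.
elim: d y => [|m IH] y; first by rewrite mul_expr0.
rewrite exprSr -mulmxE -mulmxA => /IH Xy fy; apply: h => //; apply: Xy.
by rewrite mulmxA (homX hf) -mulmxA fy mulmx0.
Qed.

Lemma string_mod_gen M i N (f g : 'M_(ddim M, ddim (S i N))) : (N <= d)%N ->
  dhom (S i N) M f -> dhom (S i N) M g ->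
  f *m unit_col k N 0 = g *m unit_col k N 0 -> f = g.
Proof.
move=> Nd hf hg e; apply: unit_col_ext => t _.
have w : unit_col k N t = total_A (S i N) ^+ t *m unit_col k N 0.
  by rewrite string_mod_totalA // string_A_exp addn0.
have c (h : 'M_(ddim M, ddim (S i N))) : dhom (S i N) M h ->
    h *m total_A (S i N) ^+ t = total_A M ^+ t *m h.
  move=> /dhom_total_A hh; elim: t {w} => [|t IH]; first by rewrite expr0 mulmx1 mul_expr0.
  by rewrite !exprS -!mulmxE mulmxA hh -mulmxA IH mulmxA.
by rewrite w !mulmxA !c // -!mulmxA e.
Qed.

Lemma gcoefX i N : gcoef q i N ^+ n = 1.
Proof.
have qn : q ^+ n = 1 by apply/eqP; rewrite -(prim_order_dvd q_prim).
by rewrite exprMn qn mul1r -exprM mulnC exprM [q^-1 ^+ n]exprVn qn invr1 expr1n.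
Qed.

Lemma gcoef_neq0 i N : gcoef q i N != 0.
Proof. by rewrite mulf_neq0 ?expf_neq0 ?invr_neq0 // (q_neq0 q_prim). Qed.

(** The dimension N lies strictly between 0 and d and satisfies N = 1 - u - 2i modulo d, written
    here through powers of q. These two facts determine it. *)
Lemma is_L_dim u i L : nonproj_index d u i -> is_L d q u i L ->
  (0 < ddim L < d)%N /\ q ^+ u * q ^+ i * q ^+ i * q ^+ ddim L = q.
Proof.
move=> np /L_dim dimL; have d0 := prim_order_gt0 q_prim.
have [h0 h1] : (0 <= (weight u i %% d%:Z)%Z)%R /\ ((weight u i %% d%:Z)%Z < d%:Z)%R.
  by rewrite modz_ge0 ?ltz_pmod //; lia.
have h2 : (weight u i %% d%:Z)%Z <> 0 by move/dvdz_mod0P; apply/negP.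
have lt : (0 < ddim L < d)%N.
  rewrite dimL /bracket; case: eqP => e; lia.
split=> //; rewrite -!exprD.
have dv : (d %| (u + i + i + ddim L).-1)%N.
  suff : (d%:Z %| ((u + i + i + ddim L).-1)%:Z)%Z by [].
  apply/dvdzP; exists ((weight u i %/ d%:Z)%Z + 1).
  have := divz_eq (weight u i) d%:Z; move: lt; rewrite dimL /bracket.
  rewrite mulrDl mul1r; move: h0 h1 h2.
  move: ((weight u i %/ d%:Z)%Z * d%:Z) (weight u i %% d%:Z)%Z => Qd m h0 h1 h2.
  by rewrite /weight; case: eqP => e; lia.
have -> : (u + i + i + ddim L = (u + i + i + ddim L).-1 + 1)%N by lia.
rewrite exprD expr1; move: dv; rewrite (prim_order_dvd q_prim) => /eqP ->.
by rewrite mul1r.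
Qed.

(** The line killed by X generates a string: G acts on it by q^(u+i) = q^(1-N-i). The resulting map
    from S(i,N) is injective because ker X in the string is spanned by the generator, and the
    dimensions agree. *)
Lemma is_L_string u i L : nonproj_index d u i -> is_L d q u i L -> diso (string_mod q i (ddim L)) L.
Proof.
move=> np isL; have [/andP[L0 Ld] qu] := is_L_dim np isL.
have [[dL _ _] _ hG [v [v0 Ev Xv]]] := isL.
have Nd := ltnW Ld.
have Xv0 : actX L *m v = 0 by apply/Xv; exists 1; rewrite scale1r.
have Gv : actG L *m v = gcoef q i (ddim L) *: v.
  rewrite -{1}Ev mulmxA [actG L *m _](hG i) -scalemxAl Ev; congr (_ *: _).
  apply: (mulIf (q_exp_neq0 q_prim (ddim L + i))); rewrite -mulrA exprVn mulVf ?(q_exp_neq0 q_prim) //.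
  rewrite mulr1 -[RHS]qu !exprD; ring.
(* X kills A^N v since [xcoef N N] is 0, so A^N v = c v; nilpotency of A forces c = 0. *)
have Av : total_A L ^+ ddim L *m v = 0.
  have [c cE] : exists c, total_A L ^+ ddim L *m v = c *: v.
    apply/Xv; rewrite (string_X n_gt0 d_dvd_n q_prim dL Ev Xv0 Gv).
    by rewrite (xcoefN q_prim) scale0r.
  have AmE m : (total_A L ^+ ddim L) ^+ m *m v = c ^+ m *: v.
    elim: m => [|m IH]; first by rewrite mul_expr0 scale1r.
    by rewrite exprSr -mulmxE -mulmxA cE -scalemxAr IH scalerA -exprS.
  have := AmE d; rewrite -exprM mulnC exprM (totAd (tot dL)) expr0n.
  rewrite (gtn_eqF L0) mul0mx => /esym/eqP; rewrite scaler_eq0 (negPf v0) orbF.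
  by rewrite expf_eq0 => /andP[_ /eqP c0]; rewrite cE c0 scale0r.
have [f hf fw] := string_hom Nd dL (StringVector Ev Xv0 Gv Av).
have dS := string_mod_dmod n_gt0 d_dvd_n q_prim i Nd.
apply: (dhom_inj_diso hf) => //; apply: (mx_inj_ker_X dS hf) => y.
move=> /(string_ker_X n_gt0 d_dvd_n q_prim Nd) [a ->]; rewrite -scalemxAr fw mul_expr0 => /eqP.
by rewrite scaler_eq0 (negPf v0) orbF => /eqP ->; rewrite scale0r.
Qed.

Lemma string_vector_gen i N : (N <= d)%N -> @string_vector (S i N) i N (unit_col k N 0).
Proof.
move=> Nd; split.
- by rewrite string_modE // string_deg0 eqxx scale1r.
- by rewrite (string_modX n_gt0 d_dvd_n q_prim) xcoef0 scale0r.
- by rewrite string_modG mul1r.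
by rewrite string_mod_totalA // string_A_exp addn0 unit_col_ge.
Qed.

Lemma string_vector_dhom M W i N f v : dhom M W f -> @string_vector M i N v ->
  @string_vector W i N (f *m v).
Proof.
move=> hf [Ev Xv Gv Av]; split.
- by rewrite mulmxA -(homE hf) -mulmxA Ev.
- by rewrite mulmxA -(homX hf) -mulmxA Xv mulmx0.
- by rewrite mulmxA -(homG hf) -mulmxA Gv scalemxAr.
have c m : f *m total_A M ^+ m = total_A W ^+ m *m f.
  elim: m => [|m IH]; first by rewrite expr0 mulmx1 mul_expr0.
  by rewrite !exprS -!mulmxE mulmxA (dhom_total_A hf) -mulmxA IH mulmxA.
by rewrite mulmxA -c -mulmxA Av mulmx0.
Qed.

(** As G^n = g^n = 1, averaging the powers of g^-1 G over n terms projects onto the g-eigenspace of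
    G. This division is where n must be nonzero in k. Applying e_i as well puts the lift in degree
    i. *)
Lemma lift_eigenvector M W (f : 'M_(ddim W, ddim M)) i N (v : 'cV_(ddim W)) : n%:R != 0 :> k -> is_dmod d q M -> is_dmod d q W ->
  dhom M W f -> mx_surj f -> actE W i *m v = v -> actG W *m v = gcoef q i N *: v ->
  exists m : 'cV_(ddim M), [/\ f *m m = v, actE M i *m m = m & actG M *m m = gcoef q i N *: m].
Proof.
move=> n0 dM dW hf sf Ev Gv; have [m0 fm0] := sf v; set g := gcoef q i N.
have g0 : g != 0 by apply: gcoef_neq0.
pose R := \sum_(s < n) (g^-1 *: actG M) ^+ s; pose R' := \sum_(s < n) (g^-1 *: actG W) ^+ s.
have fh : f *m (g^-1 *: actG M) = (g^-1 *: actG W) *m f.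
  by rewrite -scalemxAr (homG hf) scalemxAl.
have Eh : actE M i *m (g^-1 *: actG M) = (g^-1 *: actG M) *m actE M i.
  by rewrite -scalemxAr -(totGE (tot dM)) scalemxAl.
have fR : f *m R = R' *m f.
  rewrite mulmx_sumr mulmx_suml; apply: eq_bigr => s _.
  elim: (nat_of_ord s) => [|t IH]; first by rewrite mul_expr0 expr0 mulmx1.
  by rewrite !exprS -!mulmxE mulmxA fh -[LHS]mulmxA IH mulmxA.
have R'v : R' *m v = n%:R *: v.
  rewrite mulmx_suml (eq_bigr (fun=> v)); first by rewrite sumr_const card_ord scaler_nat.
  move=> s _; elim: (nat_of_ord s) => [|t IH]; first by rewrite mul_expr0.
  by rewrite exprSr -mulmxE -mulmxA -scalemxAl Gv scalerA mulVf // scale1r.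
have GR : actG M *m R = g *: R.
  have := subrX1 (g^-1 *: actG M) n; rewrite -/R scalemxX (relGn dM) exprVn gcoefX invr1 scale1r.
  rewrite subrr => /esym; rewrite mulrBl mul1r => /eqP; rewrite subr_eq0 => /eqP.
  rewrite -mulmxE -scalemxAl => /(congr1 (fun Y => g *: Y)); rewrite scalerA divff // scale1r.
  by [].
have ER : actE M i *m R = R *m actE M i.
  rewrite mulmx_sumr mulmx_suml; apply: eq_bigr => s _.
  elim: (nat_of_ord s) => [|t IH]; first by rewrite mul_expr0 expr0 mulmx1.
  by rewrite !exprS -!mulmxE mulmxA Eh -[LHS]mulmxA IH mulmxA.
exists (n%:R^-1 *: (R *m (actE M i *m m0))); split.
- rewrite -scalemxAr mulmxA fR -mulmxA (mulmxA f) (homE hf) -mulmxA fm0 Ev R'v scalerA.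
  by rewrite mulVf // scale1r.
- by rewrite -scalemxAr mulmxA ER -!mulmxA (mulmxA (actE M i)) (totEE (tot dM)) eqxx scale1r.
by rewrite -scalemxAr mulmxA GR -scalemxAl !scalerA mulrC.
Qed.

Lemma string_X_lower M i N (y : 'cV_(ddim M)) t : is_dmod d q M -> actE M (string_deg i t) *m y = y ->
  actG M *m y = (q ^+ t * gcoef q i N) *: y ->
  actE M i *m (actX M ^+ t *m y) = actX M ^+ t *m y /\
  actG M *m (actX M ^+ t *m y) = gcoef q i N *: (actX M ^+ t *m y).
Proof.
move=> dM; elim: t y => [|t IH] y.
  by rewrite string_deg0 mul1r !mul_expr0.
rewrite string_degS => Ey Gy.
have -> : actX M ^+ t.+1 *m y = actX M ^+ t *m (actX M *m y) by rewrite exprSr -mulmxE mulmxA.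
apply: IH.
  by rewrite mulmxA (totEX (tot dM)) -mulmxA Ey.
rewrite mulmxA (totGX (tot dM)) -scalemxAl -mulmxA Gy -scalemxAr scalerA exprS; congr (_ *: _).
by rewrite !mulrA mulVf ?mul1r // (q_neq0 q_prim).
Qed.

Lemma string_XA M i N (v : 'cV_(ddim M)) t : is_dmod d q M -> actE M i *m v = v -> actX M *m v = 0 ->
  actG M *m v = gcoef q i N *: v ->
  actX M ^+ t *m (total_A M ^+ t *m v) = (\prod_(s < t) xcoef q N s.+1) *: v.
Proof.
move=> dM Ev Xv Gv; elim: t => [|t IH]; first by rewrite big_ord0 scale1r !mul_expr0.
rewrite exprSr -mulmxE -mulmxA (string_X n_gt0 d_dvd_n q_prim dM Ev Xv Gv) -scalemxAr IH.
by rewrite scalerA big_ord_recr mulrC.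
Qed.

(* Lifting the generator [w] against a surjection: as [w] is a multiple of         *)
(* [X^(d-1) A^(d-1) w], any lift of [w] that is an eigenvector of [e_i] and [G]     *)
(* can be corrected to one killed by [X].                                          *)
Lemma steinberg_projective i : n%:R != 0 :> k -> dproj d q (S i d).
Proof.
move=> n0; have d0 := prim_order_gt0 q_prim; have dS := string_mod_dmod n_gt0 d_dvd_n q_prim i (leqnn d).
split=> // M W f g dM dW hf sf hg.
have [Ev Xv Gv _] := string_vector_dhom hg (string_vector_gen i (leqnn d)).
have [m [fm Em Gm]] := lift_eigenvector n0 dM dW hf sf Ev Gv.
pose c := \prod_(s < d.-1) xcoef q d s.+1.
have c0 : c != 0.
  by apply/prodf_neq0 => s _; apply: (xcoef_neq0 n_gt0 d_dvd_n q_prim) => //; have := ltn_ord s; lia.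
set m' := c^-1 *: (actX M ^+ d.-1 *m (total_A M ^+ d.-1 *m m)).
have [Em' Gm'] : actE M i *m m' = m' /\ actG M *m m' = gcoef q i d *: m'.
  have [] := @string_X_lower M i d (total_A M ^+ d.-1 *m m) d.-1 dM.
  - by rewrite (string_E n_gt0 d_dvd_n q_prim dM Em) eqxx scale1r.
  - exact: (string_G n_gt0 d_dvd_n q_prim dM Gm).
  by move=> e e'; rewrite /m' -!scalemxAr e e' !scalerA mulrC.
have Xm' : actX M *m m' = 0.
  by rewrite -scalemxAr !mulmxA -[actX M *m actX M ^+ _]exprS prednK // (relXd dM) !mul0mx scaler0.
have Am' : total_A M ^+ d *m m' = 0 by rewrite (totAd (tot dM)) mul0mx.
have [h hh hw] := string_hom (leqnn d) dM (StringVector Em' Xm' Gm' Am').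
exists h => //; apply: (string_mod_gen (leqnn d)) => //; first exact: dhomM hf hh.
rewrite -mulmxA hw mul_expr0.
have fX t (y : 'cV_(ddim M)) : f *m (actX M ^+ t *m y) = actX W ^+ t *m (f *m y).
  elim: t => [|t IH]; first by rewrite !mul_expr0.
  by rewrite !exprS -!mulmxE -!mulmxA mulmxA (homX hf) -mulmxA IH.
have fA t (y : 'cV_(ddim M)) : f *m (total_A M ^+ t *m y) = total_A W ^+ t *m (f *m y).
  elim: t => [|t IH]; first by rewrite !mul_expr0.
  by rewrite !exprS -!mulmxE -!mulmxA mulmxA (dhom_total_A hf) -mulmxA IH.
rewrite -scalemxAr fX fA fm (string_XA _ dW Ev Xv Gv) scalerA mulVf // scale1r //.
Qed.

End StringModuleTheory.

(** * Products with strings of length 1 and 2 *)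

Section StringTensors.
Variables (k : fieldType) (n d : nat) (q : k).
Hypotheses (n_gt0 : (0 < n)%N) (d_dvd_n : (d %| n)%N) (q_prim : d.-primitive_root q).
Implicit Types (M W : dmod k n) (i j : Zmod n) (N t s m : nat).
Let tot M (dM : is_dmod d q M) := dmod_total n_gt0 d_dvd_n q_prim dM.
Let S i N := string_mod q i N.
Let dS i N := @string_mod_dmod k n d q n_gt0 d_dvd_n q_prim i N.

(** The product of two columns has [1 * 1] columns; the definition fixes the convertible type with a
    single column. *)
Definition tens_col m p (x : 'cV[k]_m) (y : 'cV[k]_p) : 'cV[k]_(m * p) := x *t y.

Lemma mul_tens_col m m' p p' (A : 'M[k]_(m', m)) (B : 'M_(p', p)) x y :
  (A *t B) *m tens_col x y = tens_col (A *m x) (B *m y).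
Proof. exact: (tensmx_mul A B x y). Qed.

Lemma tens_colZl m p a (x : 'cV[k]_m) (y : 'cV[k]_p) : tens_col (a *: x) y = a *: tens_col x y.
Proof. exact: (tensmxZl a x y). Qed.

Lemma tens_colZr m p a (x : 'cV[k]_m) (y : 'cV[k]_p) : tens_col x (a *: y) = a *: tens_col x y.
Proof. exact: (tensmxZr a x y). Qed.

Lemma tens_col0l m p (y : 'cV[k]_p) : tens_col (0 : 'cV[k]_m) y = 0.
Proof. exact: (@tens0mx k m 1 p 1 y). Qed.

Lemma tens_col0r m p (x : 'cV[k]_m) : tens_col x (0 : 'cV[k]_p) = 0.
Proof. exact: (@tensmx0 k m 1 p 1 x). Qed.

Lemma tens_colE m p (x : 'cV[k]_m) (y : 'cV[k]_p) a b :
  tens_col x y (mxtens_index (a, b)) 0 = x a 0 * y b 0.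
Proof.
have := tensmxE x y a b 0 0; rewrite /tens_col => <-; congr (_ _ _).
by apply: val_inj.
Qed.

Section TensorVectors.
Variables (M W : dmod k n).
Hypotheses (dM : is_dmod d q M) (dW : is_dmod d q W).
Implicit Types (x : 'cV[k]_(ddim M)) (y : 'cV[k]_(ddim W)).

Lemma tens_col_E i j x y : actE M i *m x = x -> actE W j *m y = y ->
  actE (dtens q M W) (i + j) *m tens_col x y = tens_col x y.
Proof.
move=> Ex Ey; have -> : tens_col x y = (actE M i *t 1%:M) *m tens_col x y.
  by rewrite mul_tens_col Ex mul1mx.
rewrite mulmxA (dtens_E_l n_gt0 d_dvd_n q_prim _ _ _ dM) !mul_tens_col mul1mx.
by rewrite [i + j]addrC addrK Ey.
Qed.

Lemma weight_eigen j y : actE W j *m y = y -> weight_mx q (actE W) *m y = q ^+ j *: y.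
Proof.
move=> Ey; rewrite -{1}Ey mulmxA weight_mxE; last exact: (totEE (tot dW)).
by rewrite -scalemxAl Ey.
Qed.

Lemma tens_col_A j x y : actE W j *m y = y ->
  total_A (dtens q M W) *m tens_col x y =
  tens_col x (total_A W *m y) + q ^+ j *: tens_col (total_A M *m x) y.
Proof.
move=> Ey; rewrite (total_A_dtens n_gt0 d_dvd_n q_prim) // mulmxDl !mul_tens_col mul1mx.
by rewrite (weight_eigen Ey) tens_colZr.
Qed.

Lemma tens_col_G x y : actG (dtens q M W) *m tens_col x y = tens_col (actG M *m x) (actG W *m y).
Proof. exact: mul_tens_col. Qed.

Lemma tens_col_X x y : actX (dtens q M W) *m tens_col x y =
  tens_col (actX M *m x) (actG W *m y) + tens_col x (actX W *m y).
Proof. by rewrite mulmxDl !mul_tens_col mul1mx. Qed.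

End TensorVectors.

Lemma string_vec_E i N t : actE (S i N) (string_deg i t) *m unit_col k N t = unit_col k N t.
Proof. by rewrite string_modE eqxx scale1r. Qed.

Lemma q_expVD i j : q^-1 ^+ (i + j : Zmod n)%R = q^-1 ^+ i * q^-1 ^+ j.
Proof. by rewrite !exprVn (q_expD n_gt0 d_dvd_n q_prim) invfM. Qed.

Lemma gcoefM i j N N' : gcoef q i N * gcoef q j N' = q * gcoef q (i + j) (N + N').
Proof. by rewrite /gcoef !exprD q_expVD; ring. Qed.

Lemma gcoefSr i N : q * gcoef q i N.+1 = gcoef q i N.
Proof. by rewrite /gcoef addSn exprS; field; apply: q_neq0 q_prim. Qed.

Lemma gcoefSl i N : gcoef q (i + Zp1) N = gcoef q i N.+1.
Proof.
have e : q^-1 ^+ (i + Zp1 : Zmod n)%R = q^-1 ^+ i.+1.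
  by rewrite !exprVn (q_expS n_gt0 d_dvd_n q_prim).
by rewrite /gcoef exprD e -exprD addnS addSn.
Qed.

(** Tensoring with the one-dimensional S(i,1) only shifts degrees: the product of the two generators
    is again a string vector. This is the base case of the fusion rule. *)
Lemma string_mod1_tens i j N : (0 < N <= d)%N ->
  diso (S (i + j) N) (dtens q (S i 1) (S j N)).
Proof.
move=> /andP[N0 Nd]; have d1 : (1 <= d)%N by apply: leq_trans Nd.
have d1M := dS i d1; have dN := dS j Nd.
have dT := dtens_dmod n_gt0 d_dvd_n q_prim d1M dN.
pose v t : 'cV_(1 * N) := tens_col (unit_col k 1 0) (unit_col k N t).
have Av t : total_A (dtens q (S i 1) (S j N)) *m v t = v t.+1.
  rewrite (tens_col_A d1M dN (unit_col k 1 0) (string_vec_E j N t)).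
  rewrite !(string_mod_totalA n_gt0 d_dvd_n q_prim) // !string_modA.
  by rewrite [unit_col _ 1 1]unit_col_ge // tens_col0l scaler0 addr0.
have Amv m : total_A (dtens q (S i 1) (S j N)) ^+ m *m v 0%N = v m.
  by elim: m => [|m IH]; rewrite ?mul_expr0 // exprS -mulmxE -mulmxA IH Av.
have sv : @string_vector k n q (dtens q (S i 1) (S j N)) (i + j) N (v 0%N).
  split.
  - by apply: (tens_col_E d1M); rewrite -[X in actE _ X]string_deg0 string_vec_E.
  - rewrite (@tens_col_X (S i 1) (S j N)) !(string_modX n_gt0 d_dvd_n q_prim) !xcoef0 !scale0r.
    by rewrite tens_col0l tens_col0r addr0.
  - rewrite (@tens_col_G (S i 1) (S j N)) !string_modG tens_colZl tens_colZr scalerA !mul1r.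
    by rewrite gcoefM gcoefSr.
  by rewrite Amv /v [unit_col k N N]unit_col_ge // tens_col0r.
have [f hf fw] := string_hom n_gt0 d_dvd_n q_prim Nd dT sv.
apply: (dhom_inj_diso hf); last by rewrite /= mul1n.
apply: (mx_inj_ker_X (dS _ Nd) hf) => y /(string_ker_X n_gt0 d_dvd_n q_prim Nd) [a ->].
rewrite -scalemxAr fw mul_expr0 => /(congr1 (fun u : 'cV_(1 * N) => u (mxtens_index (ord0, Ordinal N0)) 0)).
by rewrite mxE tens_colE !mxE /= !mulr1 => ->; rewrite scale0r.
Qed.

(** Clebsch-Gordan for the two-dimensional string: the product contains string vectors in degrees i
    and i + 1. The map they define is injective, being so on ker X, and both sides have dimension
    2N. *)
Lemma string_mod2_tens i N : (0 < N < d)%N ->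
  diso (dadd (S i N.+1) (S (i + Zp1) N.-1)) (dtens q (S 0 2) (S i N)).
Proof.
move=> /andP[N0 ltN]; have d2 : (2 <= d)%N by apply: leq_trans ltN.
have Nd := ltnW ltN; have d2M := dS 0 d2; have dN := dS i Nd.
have q0 := q_neq0 q_prim.
set T := dtens q (S 0 2) (S i N); have dT : is_dmod d q T by apply: dtens_dmod.
pose x s t : 'cV_(2 * N) := tens_col (unit_col k 2 s) (unit_col k N t).
have Ax0 t : total_A T *m x 0%N t = x 0%N t.+1 + (q ^+ i * q ^+ t) *: x 1%N t.
  rewrite (tens_col_A d2M dN (unit_col k 2 0) (string_vec_E i N t)) (q_string_deg n_gt0 d_dvd_n q_prim).
  by rewrite !(string_mod_totalA n_gt0 d_dvd_n q_prim) // !string_modA.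
have Ax1 t : total_A T *m x 1%N t = x 1%N t.+1.
  rewrite (tens_col_A d2M dN (unit_col k 2 1) (string_vec_E i N t)).
  rewrite !(string_mod_totalA n_gt0 d_dvd_n q_prim) // !string_modA.
  by rewrite [unit_col k 2 2]unit_col_ge // tens_col0l scaler0 addr0.
have Amx1 m s : total_A T ^+ m *m x 1%N s = x 1%N (s + m)%N.
  elim: m => [|m IH]; first by rewrite mul_expr0 addn0.
  by rewrite exprS -mulmxE -mulmxA IH Ax1 addnS.
have Amx0 m s : total_A T ^+ m *m x 0%N s =
    x 0%N (s + m)%N + (q ^+ i * q ^+ s * \sum_(r < m) q ^+ r) *: x 1%N (s + m).-1.
  elim: m => [|m IH]; first by rewrite mul_expr0 addn0 big_ord0 mulr0 scale0r addr0.
  rewrite exprS -mulmxE -mulmxA IH mulmxDr Ax0 -scalemxAr Ax1 addnS /= -addrA; congr (_ + _).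
  have -> : (q ^+ i * q ^+ s * \sum_(r < m) q ^+ r) *: x 1%N (s + m).-1.+1 =
      (q ^+ i * q ^+ s * \sum_(r < m) q ^+ r) *: x 1%N (s + m)%N.
    case: m {IH} => [|m]; first by rewrite big_ord0 mulr0 !scale0r.
    by rewrite addnS.
  by rewrite -scalerDl big_ord_recr exprD /=; congr (_ *: _); ring.
have Xx s t : actX T *m x s t = (xcoef q 2 s * (q ^+ t * gcoef q i N)) *: x s.-1 t + xcoef q N t *: x s t.-1.
  rewrite (@tens_col_X (S 0 2) (S i N)) !(string_modX n_gt0 d_dvd_n q_prim) string_modG.
  by rewrite !tens_colZl !tens_colZr scalerA.
have Gx s t : actG T *m x s t = (q ^+ s * q ^+ t * gcoef q i N.+1) *: x s t.
  rewrite (@tens_col_G (S 0 2) (S i N)) !string_modG tens_colZl tens_colZr scalerA; congr (_ *: _).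
  by rewrite mulrACA gcoefM add0r add2n gcoefSr.
have Ex s t : actE T (string_deg 0 s + string_deg i t) *m x s t = x s t.
  by apply: (tens_col_E d2M); apply: string_vec_E.
have sv0 : @string_vector k n q T i N.+1 (x 0%N 0%N).
  split.
  - by have := Ex 0%N 0%N; rewrite !string_deg0 add0r.
  - by rewrite Xx !xcoef0 mul0r !scale0r addr0.
  - by rewrite Gx !mul1r.
  rewrite Amx0 /x [unit_col k N (0 + N.+1)]unit_col_ge // [unit_col k N _.-1]unit_col_ge //.
  by rewrite !tens_col0r scaler0 addr0.
(* X sends x 0 1 and x 1 0 to multiples of x 0 0; the coefficients are chosen so that these
   multiples cancel in v. *)
pose al := xcoef q 2 1 * gcoef q i N; pose be := - xcoef q N 1.
pose v := al *: x 0%N 1%N + be *: x 1%N 0%N.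
have sv1 : @string_vector k n q T (i + Zp1) N.-1 v.
  split; rewrite /v mulmxDr -!scalemxAr.
  - have := Ex 0%N 1%N; have := Ex 1%N 0%N.
    by rewrite !string_degS !string_deg0 !add0r [Zp1 + i]addrC => -> ->.
  - rewrite !Xx !xcoef0 mul0r !scale0r add0r addr0 expr0 mul1r !scalerA -scalerDl.
    by rewrite /be mulNr mulrC subrr scale0r.
  - rewrite !Gx gcoefSl prednK // scalerDr !scalerA !expr0 !expr1 !mul1r !mulr1.
    by rewrite -(gcoefSr i N) (mulrC al) (mulrC be).
  rewrite Amx0 Amx1 add0n add1n prednK //= [x 0%N N]/x [unit_col k N N]unit_col_ge //.
  (* A^(N-1) v is a multiple of x 1 (N-1) alone, as x 0 N = 0; the factor vanishes by the geometric
     sum for q and q^(N-1) q^-N = q^-1. *)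
  rewrite tens_col0r add0r scalerA -scalerDl; suff -> : al * (q ^+ i * q ^+ 1 * \sum_(r < N.-1) q ^+ r) + be = 0.
    by rewrite scale0r.
  have e1 : (q - 1) * \sum_(r < N.-1) q ^+ r = q ^+ N.-1 - 1 by rewrite -subrX1.
  have e2 : q ^+ N.-1 * q^-1 ^+ N = q^-1.
    by rewrite -{2}(prednK N0) exprSr mulrA (q_exprVK q_prim) mul1r.
  have e3 := q_exprVK q_prim i.
  rewrite /al /be /xcoef /gcoef !big_ord1 !expr0 !mul1r !exprD !expr1.
  transitivity ((q ^+ i * q^-1 ^+ i) * q * q^-1 ^+ N * (1 - q * q^-1 ^+ 2) * q * (\sum_(r < N.-1) q ^+ r) - (1 - q * q^-1 ^+ N)).
    by ring.
  have e4 : (1 - q * q^-1 ^+ 2) * q = q - 1 by rewrite exprS expr1; field.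
  rewrite e3 mul1r -[_ * (1 - _) * q]mulrA e4 -mulrA e1.
  transitivity (q * (q ^+ N.-1 * q^-1 ^+ N) - 1); first by ring.
  by rewrite e2 divff // subrr.
have N1d : (N.-1 <= d)%N by lia.
have [f hf fw] := string_hom n_gt0 d_dvd_n q_prim ltN dT sv0.
have [g hg gw] := string_hom n_gt0 d_dvd_n q_prim N1d dT sv1.
have [d1 d2'] := (dS i ltN, dS (i + Zp1) N1d).
pose h := f *m prl_mx (S i N.+1) (S (i + Zp1) N.-1) + g *m prr_mx (S i N.+1) (S (i + Zp1) N.-1).
have hh : dhom (dadd (S i N.+1) (S (i + Zp1) N.-1)) T h.
  by apply: dhomD; apply: dhomM => //; [apply: dhom_prl|apply: dhom_prr].
apply: (dhom_inj_diso hh); last by rewrite /=; lia.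
apply: (mx_inj_ker_X (dadd_dmod d1 d2') hh) => y Xy hy.
pose y1 := prl_mx (S i N.+1) (S (i + Zp1) N.-1) *m y.
pose y2 := prr_mx (S i N.+1) (S (i + Zp1) N.-1) *m y.
have [a y1E] : exists a, y1 = a *: unit_col k N.+1 0.
  apply: (string_ker_X n_gt0 d_dvd_n q_prim ltN (i := i)).
  by rewrite /y1 mulmxA -(homX (dhom_prl _ _)) -mulmxA Xy mulmx0.
have [b y2E] : exists b, y2 = b *: unit_col k N.-1 0.
  apply: (string_ker_X n_gt0 d_dvd_n q_prim N1d (i := i + Zp1)).
  by rewrite /y2 mulmxA -(homX (dhom_prr _ _)) -mulmxA Xy mulmx0.
move: hy; rewrite /h mulmxDl -!mulmxA -/y1 -/y2 y1E y2E -!scalemxAr fw gw !mul_expr0 => e.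
have ent (s : 'I_2) (t : 'I_N) : a * ((s == 0%N :> nat)%:R * (t == 0%N :> nat)%:R)
    + b * (al * ((s == 0%N :> nat)%:R * (t == 1%N :> nat)%:R) + be * ((s == 1%N :> nat)%:R * (t == 0%N :> nat)%:R)) = 0.
  have xE s' t' : x s' t' (mxtens_index (s, t)) 0 = (s == s' :> nat)%:R * (t == t' :> nat)%:R.
    by rewrite tens_colE !mxE.
  have := congr1 (fun u : 'cV_(2 * N) => u (mxtens_index (s, t)) 0) e; rewrite /v -!xE.
  by move: (x 0%N 0%N) (x 0%N 1%N) (x 1%N 0%N) => x00 x01 x10; rewrite !mxE.
have a0 : a = 0 by have := ent ord0 (Ordinal N0); rewrite /= !(mulr0, mul0r, addr0, mulr1).
(* For N = 1 the second summand is zero-dimensional. Otherwise the coefficient [al] of x 0 1 in v is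
   nonzero. *)
have y20 : y2 = 0.
  rewrite y2E; have [lt|le] := ltnP 1 N; last by rewrite unit_col_ge ?scaler0 //; lia.
  have := ent ord0 (Ordinal lt); rewrite /= a0 !(mulr0, mul0r, addr0, mulr1, add0r) => /eqP.
  have al0 : al != 0.
    rewrite mulf_neq0 //; first exact: (xcoef_neq0 n_gt0 d_dvd_n q_prim d2).
    exact: gcoef_neq0 q_prim i N.
  by rewrite mulf_eq0 (negPf al0) orbF => /eqP ->; rewrite scale0r.
rewrite -[y]mul1mx -(dadd_id (S i N.+1) (S (i + Zp1) N.-1)) mulmxDl -!mulmxA -/y1 -/y2 y20 y1E a0.
by rewrite scale0r !mulmx0 addr0.
Qed.

End StringTensors.

(** * Combinatorics of the fusion range *)

Section FusionCombinatorics.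

Lemma count_mem_filter (T : eqType) (p : pred T) (s : seq T) x :
  count_mem x (filter p s) = (p x * count_mem x s)%N.
Proof.
elim: s => [|y s IH] /=; first by rewrite muln0.
case: ifP => py /=; rewrite IH; case: eqP => [<-|] /=; rewrite ?py ?add0n //; lia.
Qed.

Lemma count_mem_mapS (s : seq nat) x :
  count_mem x (map S s) = (if x is y.+1 then count_mem y s else 0)%N.
Proof. by case: x => [|x]; elim: s => //= y s ->; rewrite ?eqSS. Qed.

(** Truncated subtraction merges the two cases of the range: M + N - d is 0 when M + N <= d. *)
Lemma count_mem_fusion_range d M N x : count_mem x (fusion_range d M N) =
  ((M + N - d <= x) && (x < minn M N))%N.
Proof.
rewrite /fusion_range; case: ifP => h.
  by rewrite count_uniq_mem ?iota_uniq // mem_index_iota; congr nat_of_bool; lia.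
by rewrite count_uniq_mem ?iota_uniq // mem_index_iota.
Qed.

Lemma mem_fusion_range d M N x : (x \in fusion_range d M N) =
  ((M + N - d <= x) && (x < minn M N))%N.
Proof.
rewrite -has_pred1 has_count count_mem_fusion_range.
by case: (_ && _).
Qed.

(** The Clebsch-Gordan recursion at the level of indices: x labels a string of length M + 1 + N -
    2x, and the filter discards the lengths that vanish stably. Both sides are compared as
    multisets. *)
Lemma fusion_range_step d M N : (M.+1 < d)%N -> (0 < N < d)%N ->
  perm_eq [seq x <- fusion_range d M.+1 N ++ map S (fusion_range d M.+1 N) | (0 < M.+1 + N - 2 * x < d)%N]
          (map S (fusion_range d M N) ++ fusion_range d M.+2 N).
Proof.
move=> Md Nd; apply/allP => x _ /=; apply/eqP.
rewrite count_mem_filter !count_cat !count_mem_mapS !count_mem_fusion_range.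
case: x => [|x]; rewrite ?count_mem_fusion_range; lia.
Qed.

End FusionCombinatorics.

(** * The stable fusion rule for string modules *)

Section Fusion.
Variables (k : fieldType) (n d : nat) (q : k).
Hypotheses (n_gt0 : (0 < n)%N) (d_dvd_n : (d %| n)%N) (q_prim : d.-primitive_root q).
Hypothesis n_neq0 : n%:R != 0 :> k.
Implicit Types (i j : Zmod n) (N t s m : nat).
Let S i N := string_mod q i N.
Let dS i N := @string_mod_dmod k n d q n_gt0 d_dvd_n q_prim i N.
Let st := @stable k n d q.

Lemma string_mod0 i : diso (S i 0) (dzero k n).
Proof. exact: ddim0_iso. Qed.

Lemma inZpS t : inZp t.+1 = inZp t + Zp1 :> Zmod n.
Proof. by apply: val_inj; rewrite /= modnDm addn1. Qed.

Lemma inZp0 : inZp 0 = 0 :> Zmod n.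
Proof. by apply: val_inj; rewrite /= mod0n. Qed.

(** Induction on M in steps of two: S(0,2) (x) S(i,M+1) (x) S(j,N) is expanded from the right and
    from the left, and the known summand S(i+1,M) (x) S(j,N) is cancelled to leave S(i,M+2) (x)
    S(j,N). *)
Lemma string_fusion M N i j : (M < d)%N -> (0 < N < d)%N ->
  st (dtens q (S i M) (S j N))
     (dsum [seq S (i + j + inZp t) (M + N - 1 - 2 * t) | t <- fusion_range d M N]).
Proof.
move=> Md Nd; elim/ltn_ind: M i Md => - [|[|M]] IH i Md.
- have -> : fusion_range d 0 N = [::] by rewrite /fusion_range add0n min0n; case: ifP => //; lia.
  exact/diso_stable/ddim0_iso.
- have -> : fusion_range d 1 N = [:: 0%N].
    rewrite /fusion_range; have -> : (1 + N <= d)%N by lia.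
    by have -> : minn 1 N = 1%N by lia.
  apply: diso_stable => /=; rewrite inZp0 addr0 subn0 add1n subn1 /=.
  apply: diso_trans _ (diso_sym (daddd0 _)); apply: diso_sym.
  by apply: (string_mod1_tens n_gt0 d_dvd_n q_prim); lia.
have Md1 : (M.+1 < d)%N by lia.
have IH1 := IH M.+1 (ltnSn _) i Md1.
have IH0 := IH M (leqnSn _) (i + Zp1) (ltnW Md1).
have d2 : (2 <= d)%N by lia.
have [N0 N1] := andP Nd.
have [[dT dM1] dN] := (dS 0 d2, dS i (ltnW Md1), dS j (ltnW N1)).
pose h t := S (i + j + inZp t) (M.+1 + N - 2 * t).
have dh (r : seq nat) : (forall t, t \in r -> (M.+1 + N - 2 * t <= d)%N) -> is_dmod d q (dsum (map h r)).
  elim: r => [|t r IHs] hs /=; first exact: dzero_dmod.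
  apply: dadd_dmod; first by apply: dS; apply: hs; rewrite mem_head.
  by apply: IHs => t' ts; apply: hs; rewrite inE ts orbT.
(* Among lengths at most d, the filter removes exactly 0 and d: a zero module and a projective
   one. *)
have filter_h (r : seq nat) : (forall t, t \in r -> (M.+1 + N - 2 * t <= d)%N) ->
    st (dsum (map h r)) (dsum (map h [seq t <- r | (0 < M.+1 + N - 2 * t < d)%N])).
  elim: r => [|t r IHs] hs /=; first exact: stable_refl.
  have {}IHs := IHs (fun t' ts => hs t' (mem_behead (s := t :: r) ts)).
  have ht : (M.+1 + N - 2 * t <= d)%N by apply: hs; rewrite mem_head.
  case: ifP => gt /=; first by apply: stable_dadd => //; apply: stable_refl.
  apply: stable_trans IHs.
  have [e|e] : (M.+1 + N - 2 * t = d \/ M.+1 + N - 2 * t = 0)%N by lia.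
    apply: stable_trans (diso_stable _ _ (daddC _ _)) _; apply: stable_daddr_proj.
    by rewrite /h e; apply: steinberg_projective.
  apply: diso_stable; apply: diso_trans (diso_daddl _ _) (dadd0d _).
  by rewrite /h e; apply: string_mod0.
have frb t : t \in fusion_range d M.+1 N -> (0 < M.+1 + N - 1 - 2 * t < d)%N.
  by rewrite mem_fusion_range; lia.
have eqh t : t \in fusion_range d M.+1 N ->
    diso (dadd (h t) (h t.+1)) (dtens q (S 0 2) (S (i + j + inZp t) (M.+1 + N - 1 - 2 * t))).
  move=> /frb lt; apply: diso_trans _ (string_mod2_tens n_gt0 d_dvd_n q_prim _ lt).
  have -> : (M.+1 + N - 1 - 2 * t).+1 = (M.+1 + N - 2 * t)%N by lia.
  have -> : (M.+1 + N - 1 - 2 * t).-1 = (M.+1 + N - 2 * t.+1)%N by lia.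
  by rewrite -(addrA _ (inZp t)) -inZpS; apply: diso_refl.
(* First expansion: use the rule for M + 1, then multiply each string by S(0,2), which yields the
   indices t and t + 1. *)
have lhs : st (dtens q (S 0 2) (dtens q (S i M.+1) (S j N)))
    (dsum (map h (fusion_range d M.+1 N ++ map succn (fusion_range d M.+1 N)))).
  apply: stable_trans (stable_dtensr n_gt0 d_dvd_n q_prim dT IH1) _.
  apply: diso_stable; apply: diso_trans (dtens_dsumr _ _ _) _; rewrite -map_comp.
  rewrite map_cat; apply: diso_trans _ (diso_sym (dsum_cat _ _)); rewrite -map_comp.
  elim: (fusion_range _ _ _) eqh => [|t r IHs] hs /=; first exact: diso_sym (dadd0d _).
  apply: diso_trans _ (daddACA _ _ _ _); apply: diso_dadd.
    by apply: diso_sym; apply: hs; rewrite mem_head.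
  by apply: IHs => t' ts; apply: hs; rewrite inE ts orbT.
(* Second expansion: reassociate and split S(0,2) (x) S(i,M+1). The shift from i to i + 1 in the
   smaller term becomes a shift of the index t by one. *)
have rhs : st (dtens q (S 0 2) (dtens q (S i M.+1) (S j N)))
    (dadd (dsum (map h (map succn (fusion_range d M N)))) (dtens q (S i M.+2) (S j N))).
  apply: stable_trans (diso_stable _ _ (diso_sym (dtensA n_gt0 d_dvd_n q_prim dT dM1 dN))) _.
  have lt : (0 < M.+1 < d)%N by [].
  apply: stable_trans (diso_stable _ _ (diso_dtens q (diso_sym (string_mod2_tens n_gt0 d_dvd_n q_prim i lt)) (diso_refl _))) _.
  apply: stable_trans (diso_stable _ _ (dtens_addl _ _ _ _)) _.
  apply: stable_trans (diso_stable _ _ (daddC _ _)) _.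
  apply: stable_dadd; last exact: stable_refl.
  apply: stable_trans IH0 _; apply: diso_stable; rewrite -map_comp; apply: eq_dsum => t /=.
  rewrite mem_fusion_range => /andP[_ lt'].
  rewrite /h; have -> : (M.+1 + N - 2 * t.+1 = M + N - 1 - 2 * t)%N by lia.
  have -> : i + j + inZp t.+1 = i + Zp1 + j + inZp t by rewrite inZpS addrA (addrAC i Zp1 j) (addrAC _ Zp1).
  exact: diso_refl.
have bound t : t \in fusion_range d M.+1 N ++ map succn (fusion_range d M.+1 N) ->
    (M.+1 + N - 2 * t <= d)%N.
  rewrite mem_cat => /orP[/frb|/mapP[t' /frb + ->]]; lia.
have key : st (dsum (map h (fusion_range d M.+1 N ++ map succn (fusion_range d M.+1 N))))
    (dadd (dsum (map h (map succn (fusion_range d M N)))) (dsum (map h (fusion_range d M.+2 N)))).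
  apply: stable_trans (filter_h _ bound) _; apply: diso_stable.
  apply: diso_trans (dsum_perm h (fusion_range_step Md1 Nd)) _.
  by rewrite map_cat; apply: dsum_cat.
have -> : [seq S (i + j + inZp t) (M.+2 + N - 1 - 2 * t) | t <- fusion_range d M.+2 N] =
    map h (fusion_range d M.+2 N).
  by apply: eq_map => t; rewrite /h !addSn subn1.
apply: (stable_cancel (A := dsum (map h (map succn (fusion_range d M N))))).
- apply: dh => t /mapP[t']; rewrite mem_fusion_range => h' ->; lia.
- by apply: dh => t; rewrite mem_fusion_range; lia.
apply: stable_trans (stable_sym rhs) _; exact: stable_trans lhs key.
Qed.

End Fusion.

(** * From strings to simple modules and cores *)

Section StableFusion.
Variables (k : fieldType) (n d : nat) (q : k).
Hypotheses (n_gt0 : (0 < n)%N) (d_dvd_n : (d %| n)%N) (q_prim : d.-primitive_root q).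
Hypothesis n_neq0 : n%:R != 0 :> k.
Implicit Types (u v i j : Zmod n).

Lemma nonproj_indexE u i : nonproj_index d u i = (q ^+ u * q ^+ i * q ^+ i != q).
Proof.
rewrite -!exprD -[X in _ != X]expr1 (eq_prim_root_expr q_prim); congr (~~ _).
have -> : weight u i = (u + i + i)%N%:Z - 1%N%:Z by rewrite /weight; lia.
by rewrite -eqz_mod_dvd !modz_nat.
Qed.

Variable L : Zmod n -> Zmod n -> dmod k n.
Hypothesis L_spec : forall u i, nonproj_index d u i -> is_L d q u i (L u i).

(** Multiplying the congruences for the two dimensions shows that N + N' - 1 - 2t satisfies the
    congruence of the dimension of the target simple. Both numbers lie strictly between 0 and d, so
    they agree. *)
Lemma fusion_summand u v i j t : nonproj_index d u i -> nonproj_index d v j ->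
  t \in fusion_range d (ddim (L u i)) (ddim (L v j)) ->
  diso (string_mod q (i + j + inZp t) (ddim (L u i) + ddim (L v j) - 1 - 2 * t))
       (L (u + v) (i + j + inZp t)).
Proof.
move=> nu nv; have [lt e] := is_L_dim n_gt0 d_dvd_n q_prim nu (L_spec nu).
have [lt' e'] := is_L_dim n_gt0 d_dvd_n q_prim nv (L_spec nv).
move: (ddim (L u i)) (ddim (L v j)) lt e lt' e' => N N' lt e lt' e'.
rewrite mem_fusion_range => ht; set N2 := (N + N' - 1 - 2 * t)%N.
have lt2 : (0 < N2 < d)%N by rewrite /N2; lia.
have q0 := q_neq0 q_prim.
have e2 : q ^+ (u + v : Zmod n)%R * q ^+ (i + j + inZp t : Zmod n)%R * q ^+ (i + j + inZp t : Zmod n)%R * q ^+ N2 = q.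
  have ee : q * q = (q ^+ u * q ^+ i * q ^+ i * q ^+ N) * (q ^+ v * q ^+ j * q ^+ j * q ^+ N').
    by rewrite e e'.
  apply: (mulIf q0); rewrite ee !(q_expD n_gt0 d_dvd_n q_prim) (q_exp_inZp n_gt0 d_dvd_n q_prim).
  have eN : q ^+ N * q ^+ N' = q ^+ t * q ^+ t * q ^+ N2 * q.
    by rewrite -!exprD -exprSr; congr (_ ^+ _); rewrite /N2; lia.
  transitivity (q ^+ u * q ^+ v * q ^+ i * q ^+ i * q ^+ j * q ^+ j * (q ^+ t * q ^+ t * q ^+ N2 * q)); first by ring.
  by rewrite -eN; ring.
have np : nonproj_index d (u + v) (i + j + inZp t).
  rewrite nonproj_indexE; apply/eqP => e3; move: e2; rewrite e3 -[RHS]mulr1 => /(mulfI q0)/eqP.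
  rewrite -(prim_order_dvd q_prim) gtnNdvd //; lia.
have [lt3 e3] := is_L_dim n_gt0 d_dvd_n q_prim np (L_spec np).
suff <- : ddim (L (u + v) (i + j + inZp t)) = N2 by apply: is_L_string (L_spec np).
move: (ddim _) lt3 e3 => N3 lt3 e3; move: e3; rewrite -[in RHS]e2 => /mulfI.
have nz m : q ^+ m != 0 by apply: q_exp_neq0 q_prim m.
rewrite !mulf_neq0 // => /(_ isT) /eqP; rewrite (eq_prim_root_expr q_prim).
by rewrite !modn_small; [move/eqP|lia..].
Qed.

(** The theorem with an arbitrary module C in place of the image of the band representation: replace
    the inner core by the product itself, reassociate, and apply the fusion rule to the two simple
    factors. *)
Lemma core_fusion C u v i j : is_dmod d q C -> nonproj_index d u i -> nonproj_index d v j ->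
  diso (core d q (dtens q (core d q (dtens q C (L u i))) (L v j)))
       (dsum [seq core d q (dtens q C (L (u + v) (i + j + inZp t)))
             | t <- fusion_range d (ddim (L u i)) (ddim (L v j))]).
Proof.
move=> dC nu nv; have [[dLu _ _] _ _ _] := L_spec nu; have [[dLv _ _] _ _ _] := L_spec nv.
have dT := dtens_dmod n_gt0 d_dvd_n q_prim.
have [lu _] := is_L_dim n_gt0 d_dvd_n q_prim nu (L_spec nu).
have [lv _] := is_L_dim n_gt0 d_dvd_n q_prim nv (L_spec nv).
have cu := coreP (dT _ _ dC dLu); have dK := core_dmod cu.
pose fr := fusion_range d (ddim (L u i)) (ddim (L v j)).
have frdmod t : t \in fr -> is_dmod d q (L (u + v) (i + j + inZp t)).
  move=> ht; apply: diso_dmod (fusion_summand nu nv ht) _.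
  apply: (string_mod_dmod n_gt0 d_dvd_n q_prim); move: ht; rewrite mem_fusion_range; lia.
have cores : is_core d q (dsum [seq dtens q C (L (u + v) (i + j + inZp t)) | t <- fr])
    (dsum [seq core d q (dtens q C (L (u + v) (i + j + inZp t))) | t <- fr]).
  elim: fr frdmod => [|t r IH] hr /=; first by exists [::], [::]; split=> //; apply: diso_refl.
  apply: core_dadd; first by apply: coreP; apply: dT => //; apply: hr; rewrite mem_head.
  by apply: IH => t' tr; apply: hr; rewrite inE tr orbT.
have fus : stable d q (dtens q (L u i) (L v j)) (dsum [seq L (u + v) (i + j + inZp t) | t <- fr]).
  have iu := is_L_string n_gt0 d_dvd_n q_prim nu (L_spec nu).
  have iv := is_L_string n_gt0 d_dvd_n q_prim nv (L_spec nv).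
  apply: stable_trans (diso_stable _ _ (diso_sym (diso_dtens q iu iv))) _.
  have [_ ltu] := andP lu.
  apply: stable_trans (string_fusion n_gt0 d_dvd_n q_prim n_neq0 i j ltu lv) _.
  by apply: diso_stable; apply: eq_dsum => t ht; apply: fusion_summand.
apply: stable_core (coreP (dT _ _ dK dLv)) cores.
apply: stable_trans (stable_dtensl n_gt0 d_dvd_n q_prim dLv (stable_sym (core_stable cu))) _.
apply: stable_trans (diso_stable _ _ (dtensA n_gt0 d_dvd_n q_prim dC dLu dLv)) _.
apply: stable_trans (stable_dtensr n_gt0 d_dvd_n q_prim dC fus) _.
apply: diso_stable; apply: diso_trans (dtens_dsumr q C _) _.
by rewrite -map_comp; apply: diso_refl.
Qed.

End StableFusion.

(** * The case n = 0 in k: a module on which G is not semisimple *)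

Section LoopModule.
Variables (k : fieldType) (n d : nat) (q : k).
Hypotheses (n_gt0 : (0 < n)%N) (d_dvd_n : (d %| n)%N) (q_prim : d.-primitive_root q).
Hypotheses (n_eq0 : n%:R = 0 :> k) (d_gt1 : (1 < d)%N).
Implicit Types (j : Zmod n) (t s m : nat).

Definition mx_of_cols m (a : nat -> 'cV[k]_m) : 'M[k]_m := \matrix_(s, t) a t s 0.

Lemma mx_of_colsE m (a : nat -> 'cV[k]_m) t : (t < m)%N -> mx_of_cols a *m unit_col k m t = a t.
Proof. by move=> lt; rewrite (mul_unit_col _ (Ordinal lt)); apply/colP=> s; rewrite !mxE. Qed.

(** The chain w 0, ..., w (d-1) is continued by 0, so that the formulas for the generators hold for
    every t; the last basis vector y stands apart. *)
Let w t : 'cV[k]_d.+1 := if (t < d)%N then unit_col k d.+1 t else 0.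
Let y : 'cV[k]_d.+1 := unit_col k d.+1 d.

Definition loop_E j : 'M[k]_d.+1 := mx_of_cols (fun t =>
  (j == if t == d then 0 else inZp t)%:R *: unit_col k d.+1 t).
Definition loop_A : 'M[k]_d.+1 := mx_of_cols (fun t => w t.+1).
Definition loop_G : 'M[k]_d.+1 := mx_of_cols (fun t =>
  if t == d then y else q ^+ t *: w t + (t == 0)%N%:R *: y).
Definition loop_X : 'M[k]_d.+1 := mx_of_cols (fun t =>
  if t == d then 0 else xcoef q 1 t *: w t.-1 - (t == 1)%N%:R *: y).

(* The non-split self-extension of the trivial module through the simple module of *)
(* dimension [d - 1]; it exists only because [G] is not semisimple.                 *)
Definition loop_mod : dmod k n := DMod loop_E (fun j => loop_A *m loop_E j) loop_G loop_X.

Lemma loop_ext m (Y Z : 'M[k]_(m, d.+1)) :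
  (forall t, Y *m w t = Z *m w t) -> Y *m y = Z *m y -> Y = Z.
Proof.
move=> hw hy; apply: unit_col_ext => t; rewrite ltnS leq_eqVlt => /orP[/eqP -> //|lt].
by have := hw t; rewrite /w lt.
Qed.

Lemma w_ge t : (d <= t)%N -> w t = 0.
Proof. by rewrite /w ltnNge => ->. Qed.

Lemma wP t : w t = 0 \/ (t < d)%N /\ w t = unit_col k d.+1 t.
Proof. by rewrite /w; case: ifP; [right|left]. Qed.

Lemma loop_Ew j t : loop_E j *m w t = (j == inZp t)%:R *: w t.
Proof.
have [->|[lt ->]] := wP t; first by rewrite mulmx0 scaler0.
by rewrite mx_of_colsE ?leqW // ltn_eqF.
Qed.

Lemma loop_Ey j : loop_E j *m y = (j == 0)%:R *: y.
Proof. by rewrite mx_of_colsE // eqxx. Qed.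

Lemma loop_Aw t : loop_A *m w t = w t.+1.
Proof.
have [lt|le] := ltnP t d; last by rewrite !w_ge ?mulmx0 // leqW.
by rewrite {1}/w lt mx_of_colsE // leqW.
Qed.

Lemma loop_Ay : loop_A *m y = 0.
Proof. by rewrite mx_of_colsE // w_ge. Qed.

Lemma loop_Gw t : loop_G *m w t = q ^+ t *: w t + (t == 0)%N%:R *: y.
Proof.
have [lt|le] := ltnP t d.
  by rewrite {1}/w lt mx_of_colsE ?leqW // ltn_eqF.
rewrite w_ge // mulmx0 scaler0 add0r; have -> : (t == 0)%N = false by lia.
by rewrite scale0r.
Qed.

Lemma loop_Gy : loop_G *m y = y.
Proof. by rewrite mx_of_colsE // eqxx. Qed.

Lemma qnumber_order : \sum_(s < d) q ^+ s = 0.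
Proof.
have := subrX1 q d; rewrite (prim_expr_order q_prim) subrr => /esym/eqP.
rewrite mulf_eq0 subr_eq0 => /orP[/eqP q1|/eqP //].
have := prim_order_dvd q_prim 1; rewrite expr1 q1 eqxx dvdn1 => /eqP d1.
by move: d_gt1; rewrite d1.
Qed.

Lemma xcoef1_order : xcoef q 1 d = 0.
Proof. by rewrite /xcoef qnumber_order mul0r. Qed.

Lemma loop_Xw t : loop_X *m w t = xcoef q 1 t *: w t.-1 - (t == 1)%N%:R *: y.
Proof.
have [lt|le] := ltnP t d.
  by rewrite {1}/w lt mx_of_colsE ?leqW // ltn_eqF.
have -> : (t == 1)%N = false by lia.
rewrite w_ge // mulmx0 scale0r subr0; move: le; rewrite leq_eqVlt => /orP[/eqP <-|lt].
  by rewrite xcoef1_order scale0r.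
by rewrite w_ge ?scaler0 //; lia.
Qed.

Lemma loop_Xy : loop_X *m y = 0.
Proof. by rewrite mx_of_colsE // eqxx. Qed.

Lemma loop_weight_w t : weight_mx q loop_E *m w t = q ^+ t *: w t.
Proof.
rewrite mulmx_suml (bigD1 (inZp t)) //= big1 => [|j jt]; rewrite -scalemxAl loop_Ew.
  by rewrite eqxx scale1r addr0 (q_exp_mod n_gt0 d_dvd_n q_prim).
by rewrite (negPf jt) scale0r scaler0.
Qed.

Lemma loop_weight_y : weight_mx q loop_E *m y = y.
Proof.
rewrite mulmx_suml (bigD1 0) //= big1 => [|j jt]; rewrite -scalemxAl loop_Ey.
  by rewrite eqxx !scale1r addr0.
by rewrite (negPf jt) scale0r scaler0.
Qed.

(** The delicate point is w 0: there GK adds y, so 1 - GK gives -y, which is balanced by X A w 0 = X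
    w 1 = -y. *)
Lemma loop_dmod : is_dmod d q loop_mod.
Proof.
apply: (@total_dmod _ _ _ _ n_gt0 d_dvd_n q_prim loop_mod loop_A) => //.
have q0 := q_neq0 q_prim; have z0 := @xcoef0 k q 1.
have z1 : xcoef q 1 1 = 0 by rewrite (xcoefN q_prim).
have Y0 (Y : 'M[k]_d.+1) m : (0 < m)%N -> Y *m y = 0 -> Y ^+ m *m y = 0.
  by case: m => // m _ e; rewrite exprSr -mulmxE -mulmxA e mulmx0.
have d_gt0 := ltnW d_gt1.
split; rewrite /=.
- move=> i j; apply: loop_ext => [t|]; rewrite -mulmxA -scalemxAl ?loop_Ew ?loop_Ey -scalemxAr ?loop_Ew ?loop_Ey !scalerA.
    by case: (i =P inZp t) => [->|_]; [rewrite eq_sym|rewrite !mulr0].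
  by case: (i =P 0) => [->|_]; [rewrite eq_sym|rewrite !mulr0].
- apply: loop_ext => [t|]; rewrite mul1mx mulmx_suml.
    rewrite (bigD1 (inZp t)) //= big1 => [|j jt]; rewrite loop_Ew ?eqxx ?scale1r ?addr0 //.
    by rewrite (negPf jt) scale0r.
  rewrite (bigD1 0) //= big1 => [|j jt]; rewrite loop_Ey ?eqxx ?scale1r ?addr0 //.
  by rewrite (negPf jt) scale0r.
- move=> j; apply: loop_ext => [t|]; rewrite -!mulmxA.
    rewrite loop_Ew -scalemxAr loop_Aw loop_Ew inZpS.
    by rewrite (inj_eq (addIr _)).
  by rewrite loop_Ey -scalemxAr loop_Ay mulmx0 scaler0.
- have Aw m t : loop_A ^+ m *m w t = w (m + t)%N.
    elim: m t => [|m IH] t; first by rewrite mul_expr0.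
    by rewrite exprSr -mulmxE -mulmxA loop_Aw IH addnS.
  apply: loop_ext => [t|]; first by rewrite Aw mul0mx w_ge // leq_addr.
  by rewrite Y0 ?loop_Ay ?mul0mx.
- have Gw m t : loop_G ^+ m *m w t = (q ^+ t) ^+ m *: w t + (m%:R * (t == 0)%N%:R) *: y.
    elim: m => [|m IH]; first by rewrite mul_expr0 expr0 scale1r mul0r scale0r addr0.
    rewrite exprS -mulmxE -mulmxA IH mulmxDr -!scalemxAr loop_Gw loop_Gy scalerDr scalerA -exprSr -addrA.
    rewrite scalerA -scalerDl; congr (_ + _ *: _).
    by case: t {IH} => [|t]; rewrite ?mulr0 ?add0r // expr0 expr1n !mulr1 -natr1 addrC.
  have Gy m : loop_G ^+ m *m y = y.
    by elim: m => [|m IH]; [rewrite mul_expr0|rewrite exprS -mulmxE -mulmxA IH loop_Gy].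
  have qn : q ^+ n = 1 by apply/eqP; rewrite -(prim_order_dvd q_prim).
  apply: loop_ext => [t|]; last by rewrite Gy mul1mx.
  (* G^n sends w 0 to w 0 + n y, so the relation G^n = 1 holds exactly because n = 0 in k. *)
  by rewrite Gw n_eq0 mul0r scale0r addr0 -exprM mulnC exprM qn expr1n scale1r mul1mx.
- have Xw m t : (t < m)%N -> loop_X ^+ m *m w t = 0.
    elim: m t => // m IH t lt; rewrite exprSr -mulmxE -mulmxA loop_Xw mulmxBr -!scalemxAr.
    have -> : (t == 1)%N%:R *: (loop_X ^+ m *m y) = 0.
      case: t lt => [|[|t]] lt; rewrite ?scale0r //.
      by case: m IH lt => // m _ _; rewrite exprSr -mulmxE -mulmxA loop_Xy mulmx0 scaler0.
    case: t lt => [|t] lt; first by rewrite z0 scale0r subr0.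
    by rewrite IH // scaler0 subr0.
  apply: loop_ext => [t|]; rewrite mul0mx.
    have [lt|le] := ltnP t d; first exact: Xw.
    by rewrite w_ge // mulmx0.
  by rewrite Y0 ?loop_Xy.
- apply: loop_ext => [t|]; rewrite -scalemxAl -!mulmxA; last by rewrite loop_Gy loop_Xy mulmx0 scaler0.
  rewrite loop_Xw loop_Gw mulmxBr mulmxDr -!scalemxAr loop_Gw loop_Gy loop_Xw loop_Xy scaler0 addr0.
  case: t => [|[|t]] /=.
  + by rewrite z0 !scale0r subr0 !scaler0.
  + by rewrite z1 !scale0r !sub0r !scalerN !scalerA expr1 mulVf // scale1r mulr1 scale1r.
  by rewrite !scale0r !subr0 addr0 !scalerA; congr (_ *: _); rewrite !exprS; field.
- move=> j; apply: loop_ext => [t|]; rewrite -!mulmxA.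
    rewrite loop_Ew loop_Gw -scalemxAr loop_Gw mulmxDr -!scalemxAr loop_Ew loop_Ey scalerDr !scalerA.
    congr (_ *: _ + _ *: _); first by rewrite mulrC.
    by case: t => [|t]; rewrite ?(mulr0, mul0r) // mulr1 mul1r inZp0.
  by rewrite loop_Ey -scalemxAr loop_Gy loop_Ey.
- apply: loop_ext => [t|]; rewrite -scalemxAl -!mulmxA; last by rewrite loop_Ay loop_Gy loop_Ay mulmx0 scaler0.
  by rewrite loop_Aw !loop_Gw mulmxDr -!scalemxAr loop_Aw loop_Ay scaler0 scale0r !addr0 scalerA -exprS.
- move=> j; apply: loop_ext => [t|]; rewrite -!mulmxA; last by rewrite loop_Xy loop_Ey -scalemxAr loop_Xy mulmx0 scaler0.
  rewrite loop_Ew -scalemxAr loop_Xw mulmxBr -!scalemxAr loop_Ew loop_Ey scalerBr !scalerA.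
  case: t => [|[|t]] /=.
  + by rewrite z0 !(mul0r, mulr0) !scale0r.
  + rewrite z1 !(mul0r, mulr0) !scale0r !sub0r mulr1 mul1r inZpS inZp0 add0r.
    have -> : (j + Zp1 == Zp1) = (j == 0) by rewrite -{2}[Zp1]add0r (inj_eq (addIr _)).
    by [].
  by rewrite !(mul0r, mulr0) !scale0r !subr0 mulrC [inZp t.+2]inZpS (inj_eq (addIr _)).
apply: loop_ext => [t|]; rewrite mulmxBl mulmxDl mul1mx -scalemxAl -!mulmxA; last first.
  by rewrite loop_Ay loop_Xy !mulmx0 loop_weight_y loop_Gy scaler0 add0r subrr.
rewrite loop_Aw loop_weight_w !loop_Xw mulmxBr -!scalemxAr loop_Aw loop_Ay loop_Gw scaler0 subr0 /=.
have -> : xcoef q 1 t *: w t.-1.+1 = xcoef q 1 t *: w t.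
  by case: t => // ; rewrite z0 !scale0r.
have g1 : gcoef q (0 : Zmod n) 1 = 1 by rewrite /gcoef addn0 expr1 divff.
rewrite (xcoefS q_prim (0 : Zmod n)) g1 q_exp0 mulr1 mul1r eqSS.
rewrite scalerDr opprD addrA !scalerA; congr (_ - _ *: _).
  by rewrite scalerBl scalerDl scale1r.
by case: t => [|t]; rewrite ?mulr0 // expr0 mulr1.
Qed.

Lemma loop_totalA : total_A loop_mod = loop_A.
Proof.
apply: total_A_unique => //.
exact: totE1 (dmod_total n_gt0 d_dvd_n q_prim loop_dmod).
Qed.

(** The element G K^-1 is central, since G and K satisfy the same commutation relations with A and
    X. It therefore acts as a natural endomorphism of every module, which an equivalence carries
    over to the quiver. *)
Definition central_mx (M : dmod k n) : 'M_(ddim M) := actG M *m weight_mx q^-1 (actE M).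

Lemma central_mx_nat (M N : dmod k n) (f : 'M_(ddim N, ddim M)) : dhom M N f ->
  f *m central_mx M = central_mx N *m f.
Proof. by move=> hf; rewrite mulmxA (homG hf) -mulmxA (dhom_weight _ hf) mulmxA. Qed.

Lemma central_mx_dhom (M : dmod k n) : is_dmod d q M -> dhom M M (central_mx M).
Proof.
move=> dM; have t := dmod_total n_gt0 d_dvd_n q_prim dM; have q0 := q_neq0 q_prim.
have KKv := weight_mxV n_gt0 d_dvd_n q_prim dM.
have KvA := inv_commute q0 KKv (weight_mxA n_gt0 d_dvd_n q_prim t).
have qv0 : q^-1 != 0 by rewrite invr_neq0.
have XK := weight_mxX n_gt0 d_dvd_n q_prim t.
have KX : weight_mx q (actE M) *m actX M = q^-1 *: (actX M *m weight_mx q (actE M)).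
  by rewrite XK scalerA mulVf // scale1r.
have KvX := inv_commute qv0 KKv KX; rewrite invrK in KvX.
have KvE i := inv_commute1 KKv (weight_mxC t i).
have KvG := inv_commute1 KKv (weight_mxG t).
apply: (dhom_total dM dM) => [i|||]; rewrite /central_mx.
- by rewrite -[LHS]mulmxA KvE !mulmxA (totGE t).
- rewrite -[LHS]mulmxA KvA -scalemxAr (mulmxA (actG M)) (totGA t) -scalemxAl scalerA.
  by rewrite mulVf // scale1r mulmxA.
- by rewrite -[LHS]mulmxA KvG.
rewrite -[LHS]mulmxA KvX -scalemxAr (mulmxA (actG M)) (totGX t) -scalemxAl scalerA.
by rewrite divff // scale1r mulmxA.
Qed.

Lemma loop_central_w t : central_mx loop_mod *m w t = w t + (t == 0)%N%:R *: y.
Proof.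
have -> : central_mx loop_mod *m w t = q^-1 ^+ t *: (loop_G *m w t).
  rewrite -mulmxA mulmx_suml (bigD1 (inZp t)) //= big1 => [|j jt]; rewrite -scalemxAl loop_Ew.
    rewrite eqxx scale1r addr0 -scalemxAr; congr (_ *: _).
    by rewrite !exprVn (q_exp_mod n_gt0 d_dvd_n q_prim).
  by rewrite (negPf jt) scale0r scaler0.
rewrite loop_Gw scalerDr !scalerA mulrC (q_exprVK q_prim) scale1r.
by case: t => [|t]; rewrite ?mulr0 // expr0 mul1r.
Qed.

Lemma loop_central_y : central_mx loop_mod *m y = y.
Proof.
rewrite -mulmxA mulmx_suml (bigD1 0) //= big1 => [|j jt]; rewrite -scalemxAl loop_Ey.
  by rewrite eqxx scale1r addr0 scale1r loop_Gy.
by rewrite (negPf jt) scale0r scaler0.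
Qed.

Lemma y_neq0 : y != 0.
Proof. exact: unit_col_neq0. Qed.

Lemma loop_central_neq1 : central_mx loop_mod - 1%:M != 0.
Proof.
apply/eqP=> e; have := congr1 (fun Y => Y *m w 0) e.
rewrite mulmxBl loop_central_w mul1mx mul0mx scale1r addrAC subrr add0r => /eqP.
by rewrite (negPf y_neq0).
Qed.

Lemma loop_central_nil : (central_mx loop_mod - 1%:M) *m (central_mx loop_mod - 1%:M) = 0.
Proof.
have c1 : (central_mx loop_mod - 1%:M) *m y = 0.
  by rewrite mulmxBl loop_central_y mul1mx subrr.
apply: loop_ext => [t|]; last by rewrite -mulmxA c1 mulmx0 mul0mx.
rewrite -mulmxA [_ *m w t]mulmxBl loop_central_w mul1mx addrAC subrr add0r.
by rewrite -scalemxAr c1 scaler0 mul0mx.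
Qed.

Lemma loop_E_support j : actE loop_mod j != 0 -> ((j : nat) < d)%N.
Proof.
apply: contraNT; rewrite -leqNgt => le; have dn : (d <= n)%N by apply: dvdn_leq.
apply/eqP/loop_ext => [t|].
  rewrite [LHS]loop_Ew mul0mx; have [lt|le'] := ltnP t d; last by rewrite w_ge // scaler0.
  case: eqP => [e|_]; last by rewrite scale0r.
  by move: le; rewrite e /= modn_small; lia.
rewrite [LHS]loop_Ey mul0mx; case: eqP => [e|_]; last by rewrite scale0r.
by move: le; rewrite e /=; lia.
Qed.

Lemma col_unit_sum m (u : 'cV[k]_m) : u = \sum_t u t 0 *: unit_col k m t.
Proof.
apply/colP=> s; rewrite summxE (bigD1 s) //= !mxE eqxx mulr1 big1 ?addr0 // => t ts.
by rewrite !mxE (inj_eq val_inj) eq_sym (negPf ts) mulr0.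
Qed.

Lemma loop_E0 (u : 'cV[k]_d.+1) : exists a b, loop_E 0 *m u = a *: w 0 + b *: y.
Proof.
have d_gt0 := ltnW d_gt1; have dn : (d <= n)%N by apply: dvdn_leq.
exists (u (widen_ord (leqnSn d) (Ordinal d_gt0)) 0), (u ord_max 0).
rewrite {1}[u]col_unit_sum mulmx_sumr big_ord_recr /= -scalemxAr loop_Ey eqxx scale1r; congr (_ + _).
rewrite (bigD1 (Ordinal d_gt0)) //= big1 => [|t t0]; rewrite -scalemxAr mx_of_colsE ?leqW //=.
  by rewrite ltn_eqF // inZp0 eqxx scale1r addr0 /w d_gt0.
rewrite ltn_eqF //; suff /negPf -> : 0 != inZp t :> Zmod n by rewrite scale0r scaler0.
apply: contraNneq t0 => /(congr1 val) /=; rewrite modn_small => [e|]; first by apply/eqP/val_inj.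
by rewrite prednK // (leq_trans (ltn_ord t)).
Qed.

Lemma loop_Xw1 : loop_X *m (loop_A *m w 0) = - y.
Proof. by rewrite loop_Aw loop_Xw (xcoefN q_prim) scale0r sub0r scale1r. Qed.

(** By degree, e w 0 = a w 0 + b y, and y = - X A w 0 gives e y = a y. Idempotency yields a^2 = a
    and 2ab = b, so a is 0 or 1 and b = 0; then e is the scalar a on the whole chain. *)
Lemma loop_idempotent (e : 'M_d.+1) : dhom loop_mod loop_mod e -> e *m e = e -> e = 0 \/ e = 1%:M.
Proof.
move=> he ee; have eA := dhom_total_A he; rewrite loop_totalA in eA.
have e0 : e *m w 0 = loop_E 0 *m (e *m w 0).
  by rewrite [RHS]mulmxA -[loop_E 0 *m e](homE he 0) -[RHS]mulmxA [actE loop_mod 0 *m w 0]loop_Ew inZp0 eqxx scale1r.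
have [a [b ab]] := loop_E0 (e *m w 0); rewrite -e0 in ab.
have yE : y = - (loop_X *m (loop_A *m w 0)) by rewrite loop_Xw1 opprK.
have ey : e *m y = a *: y.
  rewrite {1}yE mulmxN (mulmxA e) [e *m loop_X](homX he) -[_ *m e *m _]mulmxA (mulmxA e) eA.
  rewrite -(mulmxA loop_A) ab !mulmxDr -!scalemxAr [actX loop_mod *m (loop_A *m w 0)]loop_Xw1 loop_Ay mulmx0 scaler0 addr0.
  by rewrite scalerN opprK.
have := congr1 (fun Y => Y *m w 0) ee; rewrite -mulmxA ab mulmxDr -!scalemxAr ab ey scalerDr !scalerA -addrA -scalerDl.
move=> /eqP; rewrite -subr_eq0 opprD addrACA -!scalerBl => /eqP E.
have d_gt0 := ltnW d_gt1.
have aa : a * a - a = 0.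
  have := congr1 (fun u : 'cV_d.+1 => u ord0 0) E; rewrite /w d_gt0 !mxE eqxx mulr1 ltn_eqF //.
  by rewrite mulr0 addr0.
have abb : a * b + b * a - b = 0.
  have := congr1 (fun u : 'cV_d.+1 => u ord_max 0) E; rewrite /w d_gt0 !mxE eqxx mulr1 /=.
  by rewrite gtn_eqF // mulr0 add0r.
have a01 : a = 0 \/ a = 1.
  have /eqP : a * (a - 1) = 0 by rewrite mulrBr mulr1.
  by rewrite mulf_eq0 subr_eq0 => /orP[/eqP|/eqP]; [left|right].
have b0 : b = 0.
  by case: a01 abb => ->; rewrite ?(mul0r, mulr0, mul1r, mulr1, addr0, sub0r, addrK) // => /eqP; rewrite oppr_eq0 => /eqP.
have ew t : e *m w t = a *: w t.
  elim: t => [|t IH]; first by rewrite ab b0 scale0r addr0.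
  by rewrite -loop_Aw mulmxA eA -mulmxA IH scalemxAr.
have eE : e = a%:M by apply: loop_ext => [t|]; rewrite mul_scalar_mx ?ew ?ey.
by rewrite eE; case: a01 => ->; [left; rewrite raddf0|right].
Qed.

Lemma loop_dindec : dindec d q loop_mod.
Proof.
split=> [||A B dA dB [f [g [hf hg fg gf]]]]; [exact: loop_dmod|by []|].
pose e := g *m (inl_mx A B *m prl_mx A B) *m f.
have he : dhom loop_mod loop_mod e.
  apply: dhomM hf; apply: dhomM hg _; apply: dhomM; [exact: dhom_inl|exact: dhom_prl].
have pp : inl_mx A B *m prl_mx A B *m (inl_mx A B *m prl_mx A B) = inl_mx A B *m prl_mx A B.
  by rewrite mulmxA -(mulmxA (inl_mx A B)) prl_inl mulmx1.
have ee : e *m e = e.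
  rewrite /e; move: (inl_mx A B *m _) pp => p pp.
  by rewrite !mulmxA -(mulmxA _ f g) fg mulmx1 -(mulmxA g p p) pp.
have fe : f *m e *m g = inl_mx A B *m prl_mx A B.
  by rewrite /e !mulmxA fg mul1mx -(mulmxA _ f g) fg mulmx1.
have zero_dim m : (1%:M : 'M[k]_m) = 0 -> m = 0%N.
  case: m => // m /(congr1 (fun Y : 'M_m.+1 => Y 0 0)); rewrite !mxE /= => /eqP.
  by rewrite oner_eq0.
case: (loop_idempotent he ee) => e0; [left|right]; apply: zero_dim.
  rewrite -(prl_inl A B) -[inl_mx A B]mulmx1 -(prl_inl A B) (mulmxA (inl_mx A B)) -fe e0.
  by rewrite mulmx0 !mul0mx mulmx0.
have : inr_mx A B *m prr_mx A B = 0.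
  apply: (addrI (inl_mx A B *m prl_mx A B)); rewrite dadd_id addr0 -fe e0.
  by rewrite mulmx1 fg.
move=> z; rewrite -(prr_inr A B) -[inr_mx A B]mulmx1 -(prr_inr A B) (mulmxA (inr_mx A B)) z.
by rewrite mul0mx mulmx0.
Qed.

Lemma dtriv_loop : dhom (dtriv k n) loop_mod y.
Proof.
apply/dhomP=> - [j|j||]; rewrite /act /=.
- rewrite [RHS]loop_Ey; case: eqP => _; rewrite ?scale1r ?scale0r ?mulmx1 //.
  by rewrite raddf0 mulmx0.
- by rewrite mulmx0 -mulmxA loop_Ey -scalemxAr loop_Ay scaler0.
- by rewrite [RHS]loop_Gy -[1]/1%:M mulmx1.
by rewrite mulmx0 [RHS]loop_Xy.
Qed.

Lemma y_mx_inj : mx_inj y.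
Proof.
move=> v yv; have := congr1 (fun u : 'cV_d.+1 => u ord_max 0) yv.
rewrite !mxE big_ord1 !mxE eqxx mul1r => v0; apply/colP=> i; rewrite (ord1 i) v0 mxE //.
Qed.

(** The relations are inherited from the embedding of the trivial module as the line spanned by
    y. *)
Lemma dtriv_dmod : is_dmod d q (dtriv k n).
Proof.
have [g gy] := mx_inj_left_inv y_mx_inj.
exact: left_inv_dmod loop_dmod dtriv_loop gy.
Qed.

Lemma dtriv_dsimple : dsimple d q (dtriv k n).
Proof.
split=> [||U _]; [exact: dtriv_dmod|by []|].
have := dimvS (subvf U); rewrite dimvf /dim /= => le.
have [/eqP|U0] := posnP (\dim U); first by rewrite dimv_eq0 => /eqP; left.
by right; apply/eqP; rewrite eqEdim subvf dimvf /dim /=.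
Qed.

(** An indecomposable module with the trivial module among its composition factors lies entirely in
    the block. *)
Lemma loop_block : in_block0 d q loop_mod.
Proof.
split=> [|T cT]; first exact: loop_dmod.
apply: Relation_Operators.rst_step; exists loop_mod; split=> //; first exact: loop_dindec.
split; first exact: dtriv_dsimple.
exists (dtriv k n), y, 1%:M; split; first exact: dtriv_dmod.
split; [exact: dtriv_loop|exact: y_mx_inj|exact: dhom1|].
by move=> v; exists v; rewrite mul1mx.
Qed.

End LoopModule.

(** * Thin quiver representations and maps out of them *)

Section ThinRepresentations.
Variables (k : fieldType) (n d : nat).
Hypotheses (n_gt0 : (0 < n)%N) (d_dvd_n : (d %| n)%N).
Notation vertex := (Zmod (qvert n d)).
Implicit Types (V W : qrep k n d) (a r : vertex).

(** The family of vectors supported at the vertex a; the match transports u along a = r, because the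
    space depends on the vertex. *)
Definition at_vertex V a (u : 'cV[k]_(qdim V a)) r : 'cV[k]_(qdim V r) :=
  match a =P r with
  | ReflectT e => let: erefl in _ = r' := e return 'cV[k]_(qdim V r') in u
  | ReflectF _ => 0
  end.

Lemma at_vertex_id V a (u : 'cV_(qdim V a)) : at_vertex u a = u.
Proof. by rewrite /at_vertex; case: eqP => // e; rewrite eq_axiomK. Qed.

Lemma at_vertex_ne V a (u : 'cV_(qdim V a)) r : a != r -> at_vertex u r = 0.
Proof. by rewrite /at_vertex; case: eqP. Qed.

Lemma at_vertex0 V a r : at_vertex (0 : 'cV_(qdim V a)) r = 0.
Proof. by rewrite /at_vertex; case: eqP => // e; case: r / e. Qed.

Lemma at_vertex_b V a (u : 'cV_(qdim V a)) r :
  qb V r *m at_vertex u r = at_vertex (qb V a *m u) (r + Zp1).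
Proof.
have [ar|ne] := eqVneq a r; first by case: r / ar; rewrite !at_vertex_id.
by rewrite !at_vertex_ne ?mulmx0 // (inj_eq (addIr _)).
Qed.

Lemma at_vertex_bb V a (u : 'cV_(qdim V (a + Zp1))) r :
  qbb V r *m at_vertex u (r + Zp1) = at_vertex (qbb V a *m u) r.
Proof.
have [ar|ne] := eqVneq a r; first by case: r / ar; rewrite !at_vertex_id.
by rewrite !at_vertex_ne ?mulmx0 // (inj_eq (addIr _)).
Qed.

Lemma at_vertex_bbbb V a (u : 'cV_(qdim V (a + Zp1))) r : is_qrep V ->
  qbb V r *m at_vertex (qbb V a *m u) (r + Zp1) = 0.
Proof.
move=> rV; have [ar|ne] := eqVneq a (r + Zp1); last by rewrite at_vertex_ne ?mulmx0.
by subst a; rewrite at_vertex_id mulmxA (relbbbb rV) mul0mx.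
Qed.

Definition thin_rep (c : vertex -> nat) (be ga : pred vertex) : qrep k n d :=
  @QRep k n d c (fun r => if be r then const_mx 1 else 0) (fun r => if ga r then const_mx 1 else 0).

(** Where [c r] is 1 the row [const_mx 1] is the scalar 1 and the basis vector goes to u r; where
    [c r] is 0 the map is empty. No case distinction on dimensions is needed. *)
Definition thin_map V (c : vertex -> nat) be ga (u : forall r, 'cV[k]_(qdim V r)) :
  qmap (thin_rep c be ga) V := fun r => u r *m const_mx 1.

Lemma const_row_mul m p : m = 1%N -> (const_mx 1 : 'rV[k]_m) *m (const_mx 1 : 'M_(m, p)) = const_mx 1.
Proof. by move=> ->; apply/matrixP=> i j; rewrite !mxE big_ord1 !mxE mulr1. Qed.

Lemma thin_map_hom V c be ga (u : forall r, 'cV[k]_(qdim V r)) :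
  (forall r, qb V r *m u r = if be r then u (r + Zp1) else 0) ->
  (forall r, qbb V r *m u (r + Zp1) = if ga r then u r else 0) ->
  (forall r, be r -> c (r + Zp1) = 1%N) -> (forall r, ga r -> c r = 1%N) ->
  is_qhom (thin_map c be ga u).
Proof.
move=> hb hbb cb cbb; split=> r; rewrite /thin_map /= mulmxA.
  rewrite hb; case: ifP => br; last by rewrite mulmx0 mul0mx.
  by rewrite -mulmxA const_row_mul // cb.
rewrite hbb; case: ifP => br; last by rewrite mulmx0 mul0mx.
by rewrite -mulmxA const_row_mul // cbb.
Qed.

Lemma thin_map_inj V c be ga (u : forall r, 'cV[k]_(qdim V r)) r :
  (c r <= 1)%N -> (c r = 1%N -> u r != 0) -> mx_inj (@thin_map V c be ga u r).
Proof.
rewrite /thin_map /=; case: (c r) => [|[|m]] // _ h v.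
  by move=> _; apply/colP=> - [].
have {}h := h erefl; have -> : const_mx 1 = 1%:M :> 'rV[k]_1.
  by apply/matrixP=> i j; rewrite (ord1 i) (ord1 j) !mxE.
have -> : v = (v 0 0)%:M by rewrite -mx11_scalar.
rewrite mulmx1 mul_mx_scalar => /eqP; rewrite scaler_eq0 (negPf h) orbF => /eqP ->.
by rewrite raddf0.
Qed.

Lemma succ2_neq a : (2 < qvert n d)%N -> (a + Zp1 + Zp1 == a) = false.
Proof.
move=> Q2; apply/eqP=> e; have : Zp1 + Zp1 = 0 :> vertex.
  by apply: (addrI a); rewrite addrA e addr0.
by case: (qvert n d) Q2 => [|[|[|m]]] // _ /(congr1 val) /=.
Qed.

Let sn a : (a + Zp1 == a) = false := succ_neq n_gt0 d_dvd_n a.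

Lemma sn' a : (a == a + Zp1) = false.
Proof. by rewrite eq_sym sn. Qed.

(* The quotient of the indecomposable projective at [a + 1] by its socle. *)
Definition top_dim a r : nat := ((r == (a + Zp1)%R) + ((r == (a + Zp1 + Zp1)%R) + (r == a)))%N.
Definition top_rep a := thin_rep (top_dim a) (fun r => r == a + Zp1) (fun r => r == a).

Lemma top_repP a : is_qrep (top_rep a).
Proof.
split=> r /=.
- case: eqP => [|_]; last by rewrite mul0mx.
  by move=> /addIr ->; rewrite sn' mulmx0.
- case: (r =P a) => [->|_]; last by rewrite mul0mx.
  by rewrite sn mulmx0.
rewrite (inj_eq (addIr _)); case: (r + Zp1 =P a) => [<-|_].
  by rewrite sn' mulmx0 ?mul0mx; case: (_ == _); rewrite ?mulmx0 ?mul0mx.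
rewrite mul0mx; case: (r =P a) => [->|_]; last by rewrite mulmx0.
by rewrite sn' mul0mx.
Qed.

Section Vectors.
Variables (V : qrep k n d) (a : vertex) (v : 'cV[k]_(qdim V (a + Zp1))).
Hypotheses (rV : is_qrep V) (Q2 : (2 < qvert n d)%N).

(** The image of [top_rep a] under the map sending its generator to v: the vectors v, b v and bbar
    v. This is a morphism when the loop kills v ([top_hom]). *)
Definition top_vec r := at_vertex v r +
  (at_vertex (qb V (a + Zp1) *m v) r + at_vertex (qbb V a *m v) r).

Lemma top_hom : qbb V (a + Zp1) *m (qb V (a + Zp1) *m v) = 0 ->
  is_qhom (thin_map (top_dim a) (fun r => r == a + Zp1) (fun r => r == a) top_vec).
Proof.
move=> z; have z' : qb V a *m (qbb V a *m v) = 0 by rewrite mulmxA -(relbbb rV) -mulmxA.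
have s2 := succ2_neq _ Q2.
apply: thin_map_hom => [r|r|r /eqP ->|r /eqP ->]; rewrite /top_vec /top_dim.
- rewrite !mulmxDr !at_vertex_b z' mulmxA (relbb rV) mul0mx !at_vertex0 !addr0.
  have [->|ne] := eqVneq r (a + Zp1); last by rewrite at_vertex_ne // (inj_eq (addIr _)) eq_sym.
  by rewrite (at_vertex_ne v) ?sn' // (at_vertex_ne (qbb V a *m v)) 1?eq_sym ?s2 // addr0 add0r.
- rewrite !mulmxDr !at_vertex_bb z at_vertex0 at_vertex_bbbb // !addr0.
  have [->|ne] := eqVneq r a; last by rewrite at_vertex_ne // eq_sym.
  by rewrite (at_vertex_ne v) ?sn // (at_vertex_ne (qb V _ *m v)) ?s2 // !add0r.
- by rewrite !sn s2 eqxx.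
by rewrite sn' eq_sym s2 eqxx.
Qed.

Lemma top_vec_top : top_vec (a + Zp1) = v.
Proof.
by rewrite /top_vec at_vertex_id !at_vertex_ne ?sn ?sn' // !addr0.
Qed.

Let w := qbb V (a + Zp1) *m (qb V (a + Zp1) *m v).

Lemma loopE : qb V a *m (qbb V a *m v) = w.
Proof. by rewrite mulmxA -(relbbb rV) -mulmxA. Qed.

(** The subrepresentation generated by bbar v: it ends in w = b bbar v and is a copy of [qlen2b a]
    when w is nonzero. *)
Definition low_vec r := at_vertex (qbb V a *m v) r + at_vertex w r.

Lemma low_hom : is_qhom (thin_map (qdim2 a) (fun r => r == a) (fun=> false) low_vec).
Proof.
apply: thin_map_hom => [r|r|r /eqP ->|r] //; rewrite /low_vec.
- rewrite mulmxDr !at_vertex_b loopE -{2}loopE (mulmxA (qb V _)) (relbb rV) mul0mx at_vertex0 addr0.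
  have [->|ne] := eqVneq r a; last by rewrite at_vertex_ne // (inj_eq (addIr _)) eq_sym.
  by rewrite (at_vertex_ne (qbb V a *m v)) ?sn' // add0r.
- rewrite mulmxDr at_vertex_bbbb // at_vertex_bb /w (mulmxA (qbb V a)) (relbbbb rV) mul0mx at_vertex0.
  by rewrite addr0.
by rewrite /qdim2 sn eqxx.
Qed.

Lemma low_inj r : w != 0 -> mx_inj (thin_map (qdim2 a) (fun r => r == a) (fun=> false) low_vec r).
Proof.
move=> w0; apply: thin_map_inj; rewrite /qdim2 /low_vec.
  by case: (r =P a) => [->|_]; rewrite ?sn' //; case: eqP.
have bv0 : qbb V a *m v != 0 by apply: contraNneq w0 => e; rewrite -loopE e mulmx0.
case: (r =P a) => [->|_]; first by rewrite at_vertex_id at_vertex_ne ?sn // addr0.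
case: (r =P a + Zp1) => [->|//]; by rewrite at_vertex_id at_vertex_ne ?sn' // add0r.
Qed.

(** The subrepresentation generated by b v: it ends in the same w = bbar b v and is a copy of
    [qlen2bb (a + 1)] when w is nonzero. *)
Definition high_vec r := at_vertex (qb V (a + Zp1) *m v) r + at_vertex w r.

Lemma high_hom : is_qhom (thin_map (qdim2 (a + Zp1)) (fun=> false) (fun r => r == a + Zp1) high_vec).
Proof.
apply: thin_map_hom => [r|r|r|r /eqP ->] //; rewrite /high_vec.
- rewrite mulmxDr !at_vertex_b (mulmxA (qb V _)) (relbb rV) mul0mx at_vertex0 add0r.
  by rewrite -loopE (mulmxA (qb V _)) (relbb rV) mul0mx at_vertex0.
- rewrite mulmxDr at_vertex_bb at_vertex_bbbb // addr0.
  have [->|ne] := eqVneq r (a + Zp1); last by rewrite at_vertex_ne // eq_sym.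
  by rewrite (at_vertex_ne (qb V _ *m v)) ?sn // add0r.
by rewrite /qdim2 sn' eqxx.
Qed.

Lemma high_inj r : w != 0 ->
  mx_inj (thin_map (qdim2 (a + Zp1)) (fun=> false) (fun r => r == a + Zp1) high_vec r).
Proof.
move=> w0; apply: thin_map_inj; rewrite /qdim2 /high_vec.
  by case: (r =P a + Zp1) => [->|_]; rewrite ?sn' //; case: eqP.
have bv0 : qb V (a + Zp1) *m v != 0 by apply: contraNneq w0 => e; rewrite /w e mulmx0.
case: (r =P a + Zp1) => [->|_]; first by rewrite at_vertex_id at_vertex_ne ?sn // add0r.
case: (r =P a + Zp1 + Zp1) => [->|//]; by rewrite at_vertex_id at_vertex_ne ?sn' // addr0.
Qed.

End Vectors.
End ThinRepresentations.

(** Kernels as modules in their own right: a is the inclusion of the kernel and a' a linear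
    retraction, through which the action is restricted. *)
Lemma dhom_kernel (k : fieldType) n (M W : dmod k n) (f : 'M_(ddim W, ddim M)) : dhom M W f ->
  exists N (a : 'M_(ddim M, ddim N)) (a' : 'M_(ddim N, ddim M)),
    [/\ dhom N M a, a' *m a = 1%:M, f *m a = 0 & forall y : 'cV_(ddim M), f *m y = 0 -> y = a *m (a' *m y)].
Proof.
move=> /dhomP hf; have [r [a [a' [aa fa hk]]]] : exists r (a : 'M_(ddim M, r)) (a' : 'M_(r, ddim M)),
    [/\ a' *m a = 1%:M, f *m a = 0 & forall m (y : 'M_(ddim M, m)), f *m y = 0 -> y = a *m (a' *m y)].
  have /row_freeP[b ab] := row_base_free (kermx f^T).
  have aa : b^T *m (row_base (kermx f^T))^T = 1%:M by rewrite -trmx_mul ab trmx1.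
  exists _, (row_base (kermx f^T))^T, b^T; split=> // [|m y fy].
    apply: trmx_inj; rewrite trmx_mul trmxK trmx0; apply/sub_kermxP.
    by rewrite eq_row_base.
  have /submxP[c yc] : (y^T <= row_base (kermx f^T))%MS.
    by rewrite eq_row_base; apply/sub_kermxP; rewrite -trmx_mul fy trmx0.
  have -> : y = (row_base (kermx f^T))^T *m c^T by rewrite -trmx_mul -yc trmxK.
  by rewrite (mulmxA b^T) aa mul1mx.
pose N := DMod (fun i => a' *m actE M i *m a) (fun i => a' *m actA M i *m a)
  (a' *m actG M *m a) (a' *m actX M *m a).
have actNE o : act N o = a' *m act M o *m a by case: o.
exists N, a, a'; split=> // [|y]; last exact: hk.
apply/dhomP=> o; rewrite actNE -!mulmxA; apply/esym/hk.
by rewrite mulmxA hf -mulmxA fa mulmx0.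
Qed.

(** * No block equivalence exists when n = 0 in k *)

Section BlockContradiction.
Variables (k : closedFieldType) (n d : nat) (q : k).
Hypotheses (n_gt0 : (0 < n)%N) (d_dvd_n : (d %| n)%N) (q_prim : d.-primitive_root q).
Hypotheses (n_eq0 : n%:R = 0 :> k) (d_gt1 : (1 < d)%N) (d2n : (2 * d <= n)%N).
Variables (L : Zmod n -> Zmod n -> dmod k n) (F : qrep k n d -> dmod k n)
  (F1 : forall V W : qrep k n d, qmap V W -> 'M[k]_(ddim (F W), ddim (F V))).
Hypothesis L_spec : forall u i : Zmod n, nonproj_index d u i -> is_L d q u i (L u i).
Hypothesis F_equiv : is_block_equivalence d q L F F1.
Notation vertex := (Zmod (qvert n d)).
Implicit Types (V W : qrep k n d) (a r : vertex).

(** A zero map equals -1 times itself plus itself, so linearity of [F1] makes its image vanish. *)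
Lemma F1_eq0 V W (f : qmap V W) : is_qrep V -> is_qrep W -> is_qhom f ->
  (forall p, f p = 0) -> F1 f = 0.
Proof.
move=> rV rW hf f0; have e := @eqv_linear _ _ _ _ _ _ _ F_equiv _ _ (-1) _ _ rV rW hf hf.
have fE : f = (fun p => -1 *: f p + f p).
  by apply: functional_extensionality_dep => p; rewrite f0 scaler0 addr0.
by rewrite {1}fE e scaleN1r addNr.
Qed.

(** Equivalences preserve monomorphisms: the kernel of [F1 f] lies in the block, so its inclusion
    comes from some s with f s = 0. Then s = 0 and the kernel is trivial. *)
Lemma F1_inj V W (f : qmap V W) : is_qrep V -> is_qrep W -> is_qhom f ->
  (forall p, mx_inj (f p)) -> mx_inj (F1 f).
Proof.
move=> rV rW hf inj_f; have hF := @eqv_hom _ _ _ _ _ _ _ F_equiv _ _ _ rV rW hf.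
have [N [a [a' [ha aa fa hk]]]] := dhom_kernel hF.
have [dV bV] := @eqv_obj _ _ _ _ _ _ _ F_equiv _ rV.
(* Composition factors of a submodule of F V are composition factors of F V. *)
have bN : in_block0 d q N.
  split=> [|T [sT [U [g [h [dU [hg ig hh sh]]]]]]]; first exact: left_inv_dmod dV ha aa.
  apply: bV; split=> //; exists U, (a *m g), h; split=> //; split=> //; first exact: dhomM.
  by move=> y; rewrite -mulmxA => /(left_inv_mx_inj aa) /ig.
have [U rU [g [h [hg hh gh hg1]]]] := @eqv_surj _ _ _ _ _ _ _ F_equiv _ bN.
have [s hs sE] := @eqv_full _ _ _ _ _ _ _ F_equiv _ _ _ rU rV (dhomM ha hg).
have hfs : is_qhom (fun p => f p *m s p).
  case: hf hs => [f1 f2] [s1 s2]; split=> p; rewrite mulmxA.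
    by rewrite -f1 -mulmxA s1 mulmxA.
  by rewrite -f2 -mulmxA s2 mulmxA.
have h0 : is_qhom (fun p => 0 : 'M_(qdim W p, qdim U p)).
  by split=> p; rewrite mulmx0 mul0mx.
have s0 p : s p = 0.
  have fs0 : f p *m s p = 0.
    apply: (@eqv_faithful _ _ _ _ _ _ _ F_equiv _ _ (fun p => f p *m s p) (fun p => 0) rU rW hfs h0).
    rewrite (@eqv_comp _ _ _ _ _ _ _ F_equiv _ _ _ _ _ rU rV rW hs hf) sE mulmxA fa mul0mx.
    by rewrite F1_eq0.
  have [t tf] := mx_inj_left_inv (inj_f p).
  by rewrite -[s p]mul1mx -tf -mulmxA fs0 mulmx0.
have a0 : a = 0.
  by rewrite -[a]mulmx1 -gh mulmxA -sE F1_eq0 ?mul0mx.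
by move=> y /hk; rewrite a0 mul0mx.
Qed.

Let P (j : nat) : Zmod n := inZp j.

Lemma inZp_val_small t : (t < n)%N -> (P t : nat) = t.
Proof. by move=> lt; rewrite /P /= prednK // modn_small. Qed.

Lemma bracket_small (x : int) (m : nat) : (0 < m <= d)%N -> (d%:Z %| x - m%:Z)%Z -> bracket d x = m.
Proof.
move=> /andP[m0 md]; rewrite -eqz_mod_dvd => /eqP xm; rewrite /bracket xm.
move: md; rewrite leq_eqVlt => /orP[/eqP <-|lt]; first by rewrite modzz.
by rewrite modz_nat modn_small //=; case: eqP => // m00; rewrite m00 in m0.
Qed.

(** Passing to the representative of j modulo n changes the weight by a multiple of n, hence of
    d. *)
Lemma weight_dvd (j : nat) x : (d%:Z %| 2%:Z * j%:Z - 1 - x)%Z -> (d%:Z %| weight (0%R : Zmod n) (P j) - x)%Z.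
Proof.
move=> h; have -> : weight (0%R : Zmod n) (P j) - x =
    2%:Z * j%:Z - 1 - x - 2%:Z * ((j %/ n.-1.+1) * n.-1.+1)%N%:Z.
  have jE := divn_eq j n.-1.+1; rewrite /weight /P /=.
  move: (j %/ _ * _)%N jE => c jE; lia.
apply: rpredB => //; apply: dvdz_mull; rewrite dvdzE /= prednK //.
exact: dvdn_mull.
Qed.

Lemma bracket_even m : bracket d (weight (0%R : Zmod n) (P (m * d))) = d.-1.
Proof.
apply: bracket_small; first by lia.
apply: weight_dvd; apply/dvdzP; exists (2%:Z * m%:Z - 1); rewrite PoszM.
have -> : d.-1%:Z = d%:Z - 1 by lia.
ring.
Qed.

Lemma bracket_odd m : bracket d (weight (0%R : Zmod n) (P (m * d).+1)) = 1%N.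
Proof.
apply: bracket_small; first by lia.
apply: weight_dvd; apply/dvdzP; exists (2%:Z * m%:Z).
have -> : ((m * d).+1)%:Z = m%:Z * d%:Z + 1 by rewrite -PoszM; lia.
ring.
Qed.

Lemma sigma_P j b : bracket d (weight (0%R : Zmod n) (P j)) = b -> (b <= d)%N ->
  sigma d (0%R : Zmod n) (P j) = P (j + (d - b)).
Proof.
move=> h le; rewrite /sigma h; apply: val_inj; rewrite /= -addnBAC // addnC modnDml.
by [].
Qed.

(** Starting from 0, the permutation adds alternately 1 and d - 1, so vertex 2m sits in degree m d
    and vertex 2m + 1 in degree m d + 1. *)
Lemma iter_sigma p : iter p (sigma d (0%R : Zmod n)) 0 = P (p./2 * d + odd p).
Proof.
elim: p => [|p IH]; first by apply: val_inj; rewrite /= mod0n.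
rewrite iterS IH; case: (boolP (odd p)) => op.
  rewrite addn1 (sigma_P (bracket_odd _)) ?(ltnW d_gt1) //; congr P.
  by rewrite /= op uphalf_half op /=; lia.
rewrite addn0 (sigma_P (bracket_even _)) ?leq_pred //; congr P.
by rewrite /= (negPf op) uphalf_half (negPf op) /=; lia.
Qed.

Lemma dim_L0 j b : bracket d (weight (0%R : Zmod n) (P j)) = b -> (b < d)%N -> (0 < b)%N ->
  ddim (L 0 (P j)) = (d - b)%N.
Proof.
move=> h lt b0; rewrite (L_dim (L_spec _)) ?h //; apply/negP=> /dvdz_mod0P e.
by move: h lt; rewrite /bracket e /= => <-; rewrite ltnn.
Qed.

(** The product of the a's carries degree j to degree j + N, so it can only be nonzero if both
    degrees occur in the module. *)
Lemma gamma_degrees (M : dmod k n) j N : is_dmod d q M -> gamma M j N * actE M j != 0 ->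
  actE M j != 0 /\ actE M (j + inZp N) != 0.
Proof.
move=> dM h; have t := dmod_total n_gt0 d_dvd_n q_prim dM.
split; first by apply: contraNneq h => ->; rewrite mulr0.
apply: contraNneq h => e0; suff -> : gamma M j N * actE M j = actE M (j + inZp N) * gamma M j N * actE M j.
  by rewrite e0 !mul0r.
elim: N {e0} => [|m IH] /=.
  by rewrite !mulr1 inZp0 addr0 [RHS](relEE dM) eqxx scale1r mul1r.
have EA : actE M (j + inZp m.+1) * actA M (j + inZp m) = actA M (j + inZp m).
  by rewrite (relA dM) inZpS addrA !mulrA (relEE dM) eqxx scale1r.
by rewrite mulrA EA.
Qed.

Let M := loop_mod n d q.
Let dM : is_dmod d q M := loop_dmod n_gt0 d_dvd_n q_prim n_eq0 d_gt1.

Lemma gamma_hom (A B : dmod k n) (f : 'M_(ddim B, ddim A)) i m : dhom A B f -> f *m gamma A i m = gamma B i m *m f.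
Proof.
move=> hf; elim: m => [|m IH] /=; first by rewrite -[1]/1%:M mulmx1 -[1]/1%:M mul1mx.
by rewrite -!mulmxE mulmxA (homA hf) -mulmxA IH mulmxA.
Qed.

Lemma X_hom (A B : dmod k n) (f : 'M_(ddim B, ddim A)) m : dhom A B f -> f *m actX A ^+ m = actX B ^+ m *m f.
Proof.
move=> hf; elim: m => [|m IH]; first by rewrite expr0 mulmx1 mul_expr0.
by rewrite !exprS -!mulmxE mulmxA (homX hf) -mulmxA IH mulmxA.
Qed.

Lemma mx_inj_mul0 m p (c : nat) (f : 'M[k]_(m, p)) (Y : 'M_(p, c)) : mx_inj f -> f *m Y = 0 -> Y = 0.
Proof.
by move=> /mx_inj_left_inv[f' ff] fY; rewrite -[Y]mul1mx -ff -mulmxA fY mulmx0.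
Qed.

Lemma qvert_ge4 : (4 <= qvert n d)%N.
Proof. by rewrite qvertE // (@leq_mul 2 2 2) // leq_divRL ?(ltnW d_gt1). Qed.

(* On [F V = M] the central element acts non-trivially, as [1 + phi] with [phi] square *)
(* zero.  A natural endomorphism acts by a scalar on the top vector of [top_rep a], so  *)
(* [phi] would vanish if every loop [bbar b] acted by zero on [V].                     *)
Lemma loop_acts V (g : 'M_(ddim M, ddim (F V))) h : is_qrep V -> dhom (F V) M g ->
  g *m h = 1%:M -> h *m g = 1%:M ->
  exists a (v : 'cV_(qdim V (a + Zp1))), qbb V (a + Zp1) *m (qb V (a + Zp1) *m v) != 0.
Proof.
move=> rV hg gh hg1; apply: NNPP => nex.
have loop0 a (v : 'cV_(qdim V (a + Zp1))) : qbb V (a + Zp1) *m (qb V (a + Zp1) *m v) = 0.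
  by apply/eqP; apply/negP=> /negP ne; apply: nex; exists a, v.
have [dV _] := @eqv_obj _ _ _ _ _ _ _ F_equiv _ rV.
have central_hom W : is_qrep W -> dhom (F W) (F W) (central_mx q (F W) - 1%:M).
  move=> rW; have [dW _] := @eqv_obj _ _ _ _ _ _ _ F_equiv _ rW.
  exact: dhomB (central_mx_dhom n_gt0 d_dvd_n q_prim dW) (dhom1 _).
have [psi hpsi psiE] := @eqv_full _ _ _ _ _ _ _ F_equiv _ _ _ rV rV (central_hom _ rV).
have gc : g *m (central_mx q (F V) - 1%:M) = (central_mx q M - 1%:M) *m g.
  by rewrite mulmxBr mulmxBl mulmx1 mul1mx central_mx_nat.
have nil (phi : 'M_(ddim (F V))) : g *m phi = (central_mx q M - 1%:M) *m g -> phi *m phi = 0.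
  move=> e; rewrite -[LHS]mul1mx -hg1 -mulmxA (mulmxA g) e -(mulmxA _ g) e.
  have cc := loop_central_nil n_gt0 d_dvd_n q_prim d_gt1; rewrite -/M in cc.
  by rewrite (mulmxA (_ - _) (_ - _)) cc mul0mx mulmx0.
have psi2 p : psi p *m psi p = 0.
  have h0 : is_qhom (fun p => 0 : 'M_(qdim V p, qdim V p)) by split=> r; rewrite mulmx0 mul0mx.
  have hpp : is_qhom (fun p => psi p *m psi p).
    by case: hpsi => f1 f2; split=> r; rewrite mulmxA -?f1 -?f2 -!mulmxA ?f1 ?f2.
  apply: (@eqv_faithful _ _ _ _ _ _ _ F_equiv _ _ (fun p => psi p *m psi p) (fun p => 0) rV rV hpp h0).
  rewrite (@eqv_comp _ _ _ _ _ _ _ F_equiv _ _ _ _ _ rV rV rV hpsi hpsi) psiE (F1_eq0 rV rV h0) //.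
  exact: nil.
have psiv a (v : 'cV_(qdim V (a + Zp1))) : psi (a + Zp1) *m v = 0.
  have Q2 : (2 < qvert n d)%N by apply: leq_trans qvert_ge4.
  have rT := top_repP k n_gt0 d_dvd_n a.
  have [tau tauE] : exists tau : qmap (top_rep k a) V,
      tau = thin_map (top_dim a) (fun r => r == a + Zp1) (fun r => r == a) (top_vec v) by eexists.
  have ht : is_qhom tau by rewrite tauE; apply: (top_hom n_gt0 d_dvd_n rV Q2 (loop0 a v)).
  have [z hz zE] := @eqv_full _ _ _ _ _ _ _ F_equiv _ _ _ rT rT (central_hom _ rT).
  have hF := @eqv_hom _ _ _ _ _ _ _ F_equiv _ _ _ rT rV ht.
  have e : tau (a + Zp1) *m z (a + Zp1) = psi (a + Zp1) *m tau (a + Zp1).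
    case: (ht) (hpsi) (hz) => t1 t2 [p1 p2] [z1 z2].
    apply: (@eqv_faithful _ _ _ _ _ _ _ F_equiv _ _ (fun p => tau p *m z p) (fun p => psi p *m tau p) rT rV).
    - by split=> r; rewrite mulmxA -?t1 -?t2 -!mulmxA ?z1 ?z2.
    - by split=> r; rewrite mulmxA -?p1 -?p2 -!mulmxA ?t1 ?t2.
    rewrite (@eqv_comp _ _ _ _ _ _ _ F_equiv _ _ _ _ _ rT rT rV hz ht).
    rewrite (@eqv_comp _ _ _ _ _ _ _ F_equiv _ _ _ _ _ rT rV rV ht hpsi) psiE zE.
    by rewrite mulmxBr mulmxBl mulmx1 mul1mx (central_mx_nat q hF).
  have d1 : top_dim a (a + Zp1) = 1%N.
    by rewrite /top_dim eqxx (sn' n_gt0 d_dvd_n) (succ_neq n_gt0 d_dvd_n).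
  move: e; rewrite tauE /thin_map (top_vec_top n_gt0 d_dvd_n) /=.
  move: (z (a + Zp1)); rewrite /= d1 => z1.
  have -> : const_mx 1 = 1%:M :> 'rV[k]_1 by apply/matrixP=> i j; rewrite (ord1 i) (ord1 j) !mxE.
  rewrite !mulmx1 [z1]mx11_scalar mul_mx_scalar => e.
  (* Here psi v = c v with c the scalar by which the endomorphism acts on the one-dimensional top;
     psi squared is 0, so c = 0 or v = 0. *)
  have : psi (a + Zp1) *m (psi (a + Zp1) *m v) = 0 by rewrite mulmxA psi2 mul0mx.
  rewrite -e -scalemxAr -e scalerA => /eqP; rewrite scaler_eq0 mulf_eq0 orbb => /orP[/eqP->|/eqP ->].
    by rewrite scale0r.
  by rewrite scaler0.
have psi0 p : psi p = 0.
  rewrite -(subrK Zp1 p); apply: unit_col_ext => t _; by rewrite mul0mx psiv.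
have := loop_central_neq1 n_gt0 d_dvd_n q_prim d_gt1; rewrite -/M => /eqP; apply.
have : (central_mx q M - 1%:M) *m (g *m h) = 0.
  by rewrite mulmxA -gc -psiE (F1_eq0 rV rV hpsi psi0) mulmx0 mul0mx.
by rewrite gh mulmx1.
Qed.

(** Both length-2 representations attached to the non-trivial loop embed into [loop_mod], whose
    degrees are all below d. The degrees prescribed by the normalisation of the equivalence do not
    fit. *)
Lemma loop_module_contradiction : False.
Proof.
have [V rV [g [h [hg hh gh hg1]]]] := @eqv_surj _ _ _ _ _ _ _ F_equiv _ (loop_block n_gt0 d_dvd_n q_prim n_eq0 d_gt1).
have [a [v nz]] := loop_acts rV hg gh hg1.
have Q4 := qvert_ge4; have d_gt0 := ltnW d_gt1.
have emb W (f : qmap W V) : is_qrep W -> is_qhom f -> (forall r, mx_inj (f r)) ->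
    exists2 s : 'M_(ddim M, ddim (F W)), dhom (F W) M s & mx_inj s.
  move=> rW hf fi; exists (g *m F1 f).
    exact: dhomM hg (@eqv_hom _ _ _ _ _ _ _ F_equiv _ _ _ rW rV hf).
  move=> y; rewrite -mulmxA => /(left_inv_mx_inj hg1); exact: F1_inj.
have support j : actE M j != 0 -> ((j : nat) < d)%N := @loop_E_support k n d q n_gt0 d_dvd_n q_prim d_gt1 j.
have small t : (t < n)%N -> actE M (P t) != 0 -> (t < d)%N.
  by move=> lt /support; rewrite inZp_val_small.
have dn : (d < n)%N by lia.
have hl := low_hom n_gt0 d_dvd_n v rV.
have hi r := low_inj n_gt0 d_dvd_n rV (r := r) nz.
have [s hs is_] := emb (qlen2b k a) _ (qlen2bP k n_gt0 d_dvd_n a) hl hi.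
have [gam _] := @eqv_b _ _ _ _ _ _ _ F_equiv a.
have {}gam : gamma M (iter a (sigma d 0) 0) (ddim (L 0 (iter a (sigma d 0) 0))) *
    actE M (iter a (sigma d 0) 0) != 0.
  apply: contraNneq gam => e; apply/eqP; set i := iter a _ 0 in e *; set N := ddim (L 0 i) in e *.
  have Y0 : gamma (F (qlen2b k a)) i N *m actE (F (qlen2b k a)) i = 0.
    apply: (mx_inj_mul0 is_).
    have e' : gamma M i N *m actE M i = 0 := e.
    by rewrite mulmxA (gamma_hom _ _ hs) -mulmxA (homE hs) mulmxA e' mul0mx.
  exact: Y0.
have [] := gamma_degrees dM gam; rewrite iter_sigma.
have a2 : (a < 2 * (n %/ d))%N by rewrite -qvertE //; have := ltn_ord a; lia.
have am : (a./2 < n %/ d)%N by lia.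
have amd : (a./2 * d + d <= n)%N.
  by rewrite -{2}(divnK d_dvd_n) -mulSnr leq_mul2r am orbT.
case: (boolP (odd a)) => oa.
  (* With a = 2m + 1, the degrees m d + 1 and (m + 1) d must both be below d. The first forces m =
     0, and then the second is d, which is a genuine residue since d < n. *)
  rewrite addn1 (dim_L0 (bracket_odd _)) // => /small h1 /= h2.
  have {}h1 : ((a./2 * d).+1 < d)%N by apply: h1; lia.
  have m0 : (a./2 = 0)%N by nia.
  have e : P (a./2 * d).+1 + inZp (d - 1) = P d.
    by apply: val_inj; rewrite m0 mul0n /= modnDm subnKC.
  by move: h2; rewrite e => /(small _ dn); rewrite ltnn.
rewrite addn0 => /small h1 _.
have {}h1 : (a./2 * d < d)%N by apply: h1; lia.
have m0 : (a./2 = 0)%N by nia.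
(* With a = 2m, degree m d below d forces m = 0. The other length-2 module must now be used. *)
have a0 : a = 0 by apply: val_inj => /=; rewrite -[LHS]odd_double_half (negPf oa) m0.
have hl2 := high_hom n_gt0 d_dvd_n v rV.
have hi2 r := high_inj n_gt0 d_dvd_n (r := r) nz.
have [s2 hs2 is2] := emb (qlen2bb k (a + Zp1)) _ (qlen2bbP k n_gt0 d_dvd_n (a + Zp1)) hl2 hi2.
(* [qlen2bb (a + 1)] belongs to the vertex a + 2 = 2, where the degree is d and the simple has
   dimension 1: X acts non-trivially on degree d, which does not occur. *)
have := @eqv_bb _ _ _ _ _ _ _ F_equiv (a + Zp1 + Zp1); rewrite addrK.
have -> : nat_of_ord (a + Zp1 + Zp1) = 2%N.
  by rewrite a0 add0r; case: (qvert n d) Q4 => [|[|[|c]]].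
rewrite iter_sigma /= mul1n addn0 => [[_ xx]].
have bd : bracket d (weight (0%R : Zmod n) (P d)) = d.-1 by have := bracket_even 1; rewrite mul1n.
move: xx; rewrite (dim_L0 bd) ?ltn_predL //; last by lia.
have -> : (d - d.-1 = 1)%N by lia.
have -> : P d + inZp 1 - Zp1 = P d by rewrite -[X in _ - X]/(inZp 1) addrK.
move=> xx; have : actE M (P d) != 0.
  apply: contraNneq xx => e; apply/eqP.
  have Y0 : actX (F (qlen2bb k (a + Zp1))) ^+ 1 *m actE (F (qlen2bb k (a + Zp1))) (P d) = 0.
    by apply: (mx_inj_mul0 is2); rewrite mulmxA (X_hom _ hs2) -mulmxA (homE hs2) e mul0mx mulmx0.
  exact: Y0.
by move=> /(small _ dn); rewrite ltnn.
Qed.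

End BlockContradiction.

Theorem proposition4p4
  (k : closedFieldType) (n d : nat) (q : k)
  (n_gt0 : (0 < n)%N) (d_gt0 : (0 < d)%N) (d_dvd_n : (d %| n)%N)
  (char_d : forall p : nat, p \in [pchar k] -> ~~ (p %| d)%N)
  (q_prim : d.-primitive_root q)
  (L : Zmod n -> Zmod n -> dmod k n)
  (L_spec : forall u i : Zmod n, nonproj_index d u i -> is_L d q u i (L u i))
  (F : qrep k n d -> dmod k n)
  (F1 : forall V W : qrep k n d, qmap V W -> 'M[k]_(ddim (F W), ddim (F V)))
  (F_equiv : is_block_equivalence d q L F F1)
  (l : nat) (l_gt0 : (0 < l)%N) (lam : k) (lam_neq0 : lam != 0)
  (u i v j : Zmod n)
  (ui_nonproj : nonproj_index d u i) (vj_nonproj : nonproj_index d v j) :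
  diso (core d q (dtens q (Cband d q F L lam l u i) (L v j)))
       (dsum [seq Cband d q F L lam l (u + v) (i + j + inZp theta)
             | theta <- fusion_range d (ddim (L u i)) (ddim (L v j))]).

Proof.
(* For n nonzero in k the fusion argument applies; for n = 0 the hypothesis on the equivalence is
   contradictory. *)
have [n0|n0] := eqVneq (n%:R : k) 0; last first.
  apply: (core_fusion n_gt0 d_dvd_n q_prim n0 L_spec) => //.
  by have [] := @eqv_obj _ _ _ _ _ _ _ F_equiv _ (@qbandP k _ _ n_gt0 d_dvd_n lam l).
(* For d = 1 every index would be projective. *)
have d_gt1 : (1 < d)%N.
  by move: ui_nonproj d_gt0; rewrite /nonproj_index; case: (d) => [|[|d']] //; rewrite dvd1z.
have d_neq0 : d%:R != 0 :> k := prim_root_natf_neq0 q_prim.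
(* A multiple n of d other than d itself: n is zero in k while d, the order of a primitive root, is
   not. *)
have d2n : (2 * d <= n)%N.
  have /dvdnP[e ne] := d_dvd_n; rewrite ne leq_mul2r; apply/orP; right.
  case: e ne => [|[|e]] // ne; first by rewrite ne in n_gt0.
  by move: n0 d_neq0; rewrite ne mul1n => ->; rewrite eqxx.
by case: (loop_module_contradiction n_gt0 d_dvd_n q_prim n0 d_gt1 d2n L_spec F_equiv).
Qed.
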